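(* Let $m_0\ge1$ and let $\{\lambda_m\}_{m\ge m_0}$ be a sequence with $\lambda_m\in\mathcal P_m^{+,N}$ for all $m$, such that for every $m\ge m_0$ either $\lambda_{m+1}=\widetilde\phi_-(\lambda_m)$ or $\lambda_{m+1}=\widetilde\phi_+(\lambda_m)$, with $\widetilde\phi_+$ occurring only finitely many times. Then the limit $\lambda:=\frac32\lim_{m\to\infty}5^m\lambda_m$ exists, and $\lambda\in\mathcal P^{+,N}$.
   Context: Let $q_0,q_1,q_2$ be the vertices of an equilateral triangle in the plane, $F_i x=\frac12(x+q_i)$, and let $\mathcal{SG}$ (Sierpinski gasket) be the attractor of $\{F_0,F_1,F_2\}$. For a word $w=w_1\cdots w_n$ put $F_w=F_{w_1}\circ\cdots\circ F_{w_n}$. $V_0=\{q_0,q_1,q_2\}$, $V_m=\bigcup_{|w|=m}F_w(V_0)$; distinct $x,y\in V_m$ satisfy $x\sim_m y$ iff both lie in $F_w(V_0)$ for some word $w$ of length $m$. $L$ is the closed segment joining $q_1$ and $q_2$, $\Omega=\mathcal{SG}\setminus(\{q_0\}\cup L)$. $\mu$ is the probability measure on $\mathcal{SG}$ giving mass $3^{-m}$ to each $F_w(\mathcal{SG})$, $|w|=m$. $V_m^\Omega=V_m\setminus L$; $\Omega_m$ is the graph on $V_m^\Omega$ with adjacency $\sim_m$; $\partial\Omega_m=\{q_0\}\cup\{F_wq_0:w\in\{1,2\}^m\}$. For a word $w$, $R_w$ is the reflection symmetry of the cell $F_w(\mathcal{SG})$ fixing $F_wq_0$ and exchanging $F_wq_1,F_wq_2$.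 Neumann Laplacian on $\Omega$. For $u,v$ on $\Omega_*=\bigcup_mV_m^\Omega$ let $\mathcal E^\Omega(u,v)=\lim_m(5/3)^m\sum(u(x)-u(y))(v(x)-v(y))$, the sum over edges $\{x,y\}$ of $\Omega_m$, defined on $\mathcal F^\Omega=\{u:\mathcal E^\Omega(u,u)<\infty\}$; this is a resistance form. Let $\widetilde\Omega$ be the completion of $\Omega_*$ in the associated resistance metric; it is identified with $\Omega\cup\{q_0\}\cup\widetilde L$, where $\widetilde L$ is the Cantor set obtained from $L$ by distinguishing left and right sides of each dyadic point. Functions in $\mathcal F^\Omega$ extend uniquely to continuous functions on $\widetilde\Omega$, giving the form $(\widetilde{\mathcal E},\widetilde{\mathcal F})$; $\widetilde\mu(A)=\mu(A\cap\Omega)$. An eigenvalue/eigenfunction of $-\Delta_N$ is $\lambda\in\mathbb R$ and nonzero $u\in\widetilde{\mathcal F}$ with $\widetilde{\mathcal E}(u,v)=\lambda\int_\Omega uv\,d\mu$ for all $v\in\widetilde{\mathcal F}$. It is symmetric primitive if $u\circ R_w=u$ on $F_w(\mathcal{SG})\cap\Omega$ for all nonempty words $w$ in $\{1,2\}$ and $u\circ R_\emptyset=u$ on $\Omega$; $\mathcal P^{+,N}$ is the set of eigenvalues of symmetric primitive eigenfunctions of $-\Delta_N$. The sets $\mathcal P_m^{+,N}$. A Neumann eigenfunction of $-\Delta_m$ on $\Omega_m$ with eigenvalue $\lambda_m$ is a nonzero $u_m:V_m^\Omega\to\mathbb R$ with $\sum_{y\sim_mx}(u_m(x)-u_m(y))=\lambda_mu_m(x)$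 for $x\in V_m^\Omega\setminus\partial\Omega_m$ and $2\sum_{y\sim_mx}(u_m(x)-u_m(y))=\lambda_mu_m(x)$ for $x\in\partial\Omega_m$ ($y$ ranging over neighbours of $x$ in $\Omega_m$). $\mathcal P_m^{+,N}$ is the set of eigenvalues having such an eigenfunction with $u_m\circ R_w=u_m$ on $F_w(\mathcal{SG})\cap V_m^\Omega$ for every (possibly empty) word $w$ in $\{1,2\}$. The relations $\widetilde\phi_\pm$. For $m\ge1$, $\mathcal P_m^{+,N}$ consists of $2^m$ distinct numbers $0=\lambda_{m,1}<\cdots<\lambda_{m,2^m}=6$. For $2\le k\le2^m$ define $\widetilde\phi_-(\lambda_{m,k})=\lambda_{m+1,k}$ and $\widetilde\phi_+(\lambda_{m,k})=\lambda_{m+1,2^{m+1}+1-k}$. (Equivalently, with $\phi_\pm(x)=\frac{5\pm\sqrt{25-4x}}2$: $\widetilde\phi_-(\lambda_{m,k})$ is the element of $\mathcal P_{m+1}^{+,N}$ between $\phi_-(\lambda_{m,k-1})$ and $\phi_-(\lambda_{m,k})$ and $\widetilde\phi_+(\lambda_{m,k})$ the one between $\phi_+(\lambda_{m,k})$ and $\phi_+(\lambda_{m,k-1})$.) They are not defined at $\lambda_{m,1}=0$. *)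

(* Defs.v *)
From HB Require Import structures.
From mathcomp Require Import all_boot all_order all_algebra.
From mathcomp Require Import finmap.
From mathcomp Require Import all_classical all_reals all_analysis.

Set Implicit Arguments.
Unset Strict Implicit.
Unset Printing Implicit Defensive.
Import Order.TTheory GRing.Theory Num.Theory.
Import numFieldNormedType.Exports.

Local Open Scope classical_set_scope.
Local Open Scope ring_scope.

(* [measurableTypeR R] is [R] with its Borel sets, so the plane carries the
   product topology and the product (= Borel) sigma-algebra. *)
Notation plane R := (measurableTypeR R * measurableTypeR R)%type.

Section Geometry.
Context {R : realType}.

Definition dotp (x y : plane R) : R := x.1 * y.1 + x.2 * y.2.

Definition sqdist (x y : plane R) : R := dotp (x - y) (x - y).

Definition equilateral (q : 'I_3 -> plane R) : Prop :=
  exists2 d : R, 0 < d & forall i j : 'I_3, i != j -> sqdist (q i) (q j) = d.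

Variable q : 'I_3 -> plane R.

Definition contr (i : 'I_3) (x : plane R) : plane R :=
  ((x.1 + (q i).1) / 2, (x.2 + (q i).2) / 2).

(* F_(w_1 ... w_n) = F_(w_1) \o ... \o F_(w_n) *)
Definition contrw (w : seq 'I_3) (x : plane R) : plane R := foldr contr x w.

(* By Hutchinson's theorem there is exactly one such set. *)
Definition is_attractor (K : set (plane R)) : Prop :=
  [/\ compact K, K !=set0 & K = \bigcup_(i in [set: 'I_3]) (contr i @` K)].

Definition vertices (m : nat) : set (plane R) :=
  [set x | exists w i, size w = m /\ x = contrw w (q i)].

Definition adj (m : nat) (x y : plane R) : Prop :=
  x <> y /\ exists w, [/\ size w = m,
    exists i, x = contrw w (q i) & exists j, y = contrw w (q j)].

Definition segL : set (plane R) :=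
  [set x | exists2 t : R, 0 <= t <= 1 &
    x = ((1 - t) * (q 1).1 + t * (q 2).1, (1 - t) * (q 1).2 + t * (q 2).2)].

Definition Omega (SG : set (plane R)) : set (plane R) :=
  SG `\` ([set q 0] `|` segL).

Definition VOmega (m : nat) : set (plane R) := vertices m `\` segL.

Definition VOmegaStar : set (plane R) := \bigcup_m VOmega m.

Definition adjOmega (m : nat) (x y : plane R) : Prop :=
  [/\ VOmega m x, VOmega m y & adj m x y].

Definition word12 (w : seq 'I_3) : bool := all (fun i => i != 0) w.

Definition bdOmega (m : nat) : set (plane R) :=
  [set x | x = q 0 \/
     exists w, [/\ size w = m, word12 w & x = contrw w (q 0)]].

(* R_w: the orthogonal reflection of the plane in the line through F_w q_0
   perpendicular to q_2 - q_1.  As the F_i are homotheties and the triangle is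
   equilateral, this line is the axis of symmetry of the cell F_w(SG) that
   passes through F_w q_0, and F_w q_1, F_w q_2 are exchanged. *)
Definition cellrefl (w : seq 'I_3) (x : plane R) : plane R :=
  let e := q 2 - q 1 in
  let c := 2 * dotp (x - contrw w (q 0)) e / dotp e e in
  (x.1 - c * e.1, x.2 - c * e.2).

End Geometry.

Section Discrete.
Context {R : realType}.
Variables (q : 'I_3 -> plane R) (SG : set (plane R)).

Definition lapl (m : nat) (u : plane R -> R) (x : plane R) : R :=
  \sum_(y \in [set y | adjOmega q m x y]) (u x - u y).

(* Functions on V_m^Omega are represented by functions on the plane, whose
   values outside V_m^Omega are never used. *)
Definition neumann_eigenfunction (m : nat) (l : R) (u : plane R -> R) : Prop :=
  [/\ exists2 x, VOmega q m x & u x != 0,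
      forall x, VOmega q m x -> ~ bdOmega q m x -> lapl m u x = l * u x &
      forall x, bdOmega q m x -> 2 * lapl m u x = l * u x].

Definition PNm (m : nat) : set R :=
  [set l | exists u : plane R -> R, neumann_eigenfunction m l u /\
     forall w, word12 w ->
       forall x, (contrw q w @` SG) x -> VOmega q m x ->
         u (cellrefl q w x) = u x].

(* lambda_(m,k), 1 <= k <= 2 ^ m: the k-th smallest element of the finite set
   [PNm m]. *)
Definition lamN (m k : nat) : R :=
  nth 0 (sort <=%R (fset_set (PNm m))) k.-1.

(* The partial maps phi~_- and phi~_+ from [PNm m] to [PNm m.+1], as graphs. *)
Definition phit_minus (m : nat) (x y : R) : Prop :=
  exists k, [/\ (2 <= k <= 2 ^ m)%N, x = lamN m k & y = lamN m.+1 k].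

Definition phit_plus (m : nat) (x y : R) : Prop :=
  exists k, [/\ (2 <= k <= 2 ^ m)%N, x = lamN m k &
                y = lamN m.+1 (2 ^ m.+1 + 1 - k)].

End Discrete.

Section Continuous.
Context {R : realType}.
Variables (q : 'I_3 -> plane R) (SG : set (plane R)).

(* The sum over ordered pairs counts every edge twice. *)
Definition energym (m : nat) (u v : plane R -> R) : R :=
  (5 / 3) ^+ m *
  (2^-1 * \sum_(e \in [set e : plane R * plane R | adjOmega q m e.1 e.2])
            ((u e.1 - u e.2) * (v e.1 - v e.2))).

(* Functions on Omega_* are represented by functions on the plane, whose
   values outside Omega_* are never used. *)
Definition EOmega (u v : plane R -> R) : R :=
  limn (fun m => energym m u v).

Definition FOmega : set (plane R -> R) :=
  [set u | (limn (fun m => (energym m u u)%:E) < +oo)%E].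

Definition resistance (x y : plane R) : R :=
  sup [set (u x - u y) ^+ 2 / EOmega u u |
       u in [set u | FOmega u /\ 0 < EOmega u u]].

(* The completion of (Omega_*, resistance): points are represented by Cauchy
   sequences, two of which represent the same point iff [dtilde] vanishes on
   them.  A real function which is continuous for [dtilde] takes the same
   value on any two such sequences, hence the continuous functions on the
   completion are exactly the functions of Cauchy sequences which are
   continuous for [dtilde], and no quotient is needed. *)
Definition Otilde : set (nat -> plane R) :=
  [set s | (forall n, VOmegaStar q (s n)) /\
     forall e : R, 0 < e -> exists N, forall i j,
       (N <= i)%N -> (N <= j)%N -> resistance (s i) (s j) < e].

Definition dtilde (s t : nat -> plane R) : R :=
  limn (fun n => resistance (s n) (t n)).

Definition continuous_Otilde (U : (nat -> plane R) -> R) : Prop :=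
  forall s, Otilde s -> forall e : R, 0 < e ->
    exists2 d : R, 0 < d &
      forall t, Otilde t -> dtilde s t < d -> `|U s - U t| < e.

Definition on_star (U : (nat -> plane R) -> R) (x : plane R) : R := U (cst x).

Definition Ftilde : set ((nat -> plane R) -> R) :=
  [set U | continuous_Otilde U /\ FOmega (on_star U)].

Definition Etilde (U V : (nat -> plane R) -> R) : R :=
  EOmega (on_star U) (on_star V).

(* The identification of Omega with a subset of the completion: x corresponds
   to the class of the Cauchy sequences for the resistance metric which
   converge to x in the plane. *)
Definition to_Otilde (x : plane R) : nat -> plane R :=
  xget (cst x) [set s | Otilde s /\ s @ \oo --> x].

Definition on_Omega (U : (nat -> plane R) -> R) (x : plane R) : R :=
  U (to_Otilde x).

Definition neumann_eigen (mu : probability (plane R) R) (l : R)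
    (U : (nat -> plane R) -> R) : Prop :=
  [/\ Ftilde U,
      exists2 s, Otilde s & U s != 0 &
      forall V, Ftilde V ->
        Etilde U V = l * \int[mu]_(x in Omega q SG) (on_Omega U x * on_Omega V x)].

(* For the empty word [contrw q [::] @` SG] is SG. *)
Definition symmetric_primitive (U : (nat -> plane R) -> R) : Prop :=
  forall w, word12 w ->
    forall x, (contrw q w @` SG) x -> Omega q SG x ->
      on_Omega U (cellrefl q w x) = on_Omega U x.

Definition PN (mu : probability (plane R) R) : set R :=
  [set l | exists U, neumann_eigen mu l U /\ symmetric_primitive U].

End Continuous.

(* Main.v *)
Require Import Defs.
From HB Require Import structures.
From mathcomp Require Import all_boot all_order all_algebra finmap.
From mathcomp Require Import all_classical all_reals all_analysis.
From mathcomp Require Import measurable_realfun.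
From mathcomp Require Import ring lra zify.
Import Order.TTheory GRing.Theory Num.Theory.
Import numFieldNormedType.Exports.
Local Open Scope classical_set_scope.
Local Open Scope ring_scope.
Set Implicit Arguments.
Unset Strict Implicit.
Unset Printing Implicit Defensive.

(* On level m, a Neumann eigenfunction is a solution of a weak equation
   EE(u, v) = l MP(u, v), where both forms are sums over the cells which do not
   touch L. A symmetric one takes a single value a at the bottom vertices
   F_w q_0, |w| = m, w in {1,2}. Spectral decimation relates level m + 1 with
   eigenvalue l < 2 to level m with eigenvalue l (5 - l), but for the mass
   MQ = MP + kappa a^2 instead of MP. Eigenfunctions with a = 0 do not see the
   change of mass, so their eigenvalues follow phi_- exactly; those with a <> 0
   form a simple spectrum, which a rank-one change of mass interlaces, so that
   the j-th of them at level m + 1 is at most phi_- of the j-th at level m.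
   Hence, from some level on, the k-th smallest eigenvalue t_m satisfies
   t_(m+1) <= phi_-(t_m), and 5^m t_m converges. Once only phi~_- occurs, the
   index k of lambda_m is constant.

   For the second claim, eigenfunctions with sup norm 1 have bounded energy, so
   they are uniformly Hoelder; along an ultrafilter they converge pointwise to
   some nonzero u of finite energy. Since E_m - E_n is nonnegative for n <= m,
   Cauchy-Schwarz bounds E_m(u_m, v) - E_n(u_m, v) by C (E(v) - E_n(v))^(1/2),
   uniformly in m, and the discrete masses are Riemann sums up to O((4/5)^n).
   Therefore the weak equation passes to the limit. *)

(** * Barycentric coordinates and words *)

(** The obstacle is that both families share one increasing list, so bounds for each of them say
    nothing yet about the k-th entry of that list. What helps is that a value with a <> 0 moves by
    at most phi_- and one with a = 0 by exactly phi_-, which is increasing: once the former is at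
    most the latter, this persists. Each of the finitely many relevant comparisons changes at most
    once, so ranks freeze, and from then on the k-th entry follows a single branch. The threshold 2
    is the lowest eigenvalue of a cell whose corners are held at 0. Below it, a function on level m
    + 1 that vanishes at the old vertices cannot be an eigenfunction, so an eigenfunction with a = 0
    is recovered from its restriction. All forms are sums over corners of cells instead of vertices:
    cells then decouple, and the weight 1/2 of a corner encodes the Neumann condition. *)

Section Trig.
Lemma I3P (i : 'I_3) : [\/ i = 0, i = 1 | i = 2].
Proof.
case: i => [[|[|[|//]]] Hi]; [constructor 1|constructor 2|constructor 3]; exact/val_inj.
Qed.

Lemma big3 (R : nmodType) (F : 'I_3 -> R) : \sum_i F i = F 0 + F 1 + F 2.
Proof.
rewrite !big_ord_recl big_ord0 addr0 addrA; congr (_ + _ + _); congr F; exact/val_inj.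
Qed.

(** Arithmetic in ['I_3] is modulo 3: negation fixes 0, exchanges 1 and 2, and commutes with
    formulas such as [- (k + i)] for the third index. *)
Definition swap12 (i : 'I_3) : 'I_3 := - i.

Lemma swap12K : involutive swap12. Proof. by move=> i; rewrite /swap12 opprK. Qed.

Lemma swap12E : (swap12 0 = 0) * (swap12 1 = 2) * (swap12 2 = 1).
Proof. by split; [split|]; apply/val_inj. Qed.

Lemma swap12_eq0 i : (swap12 i == 0) = (i == 0).
Proof. by rewrite /swap12 oppr_eq0. Qed.
End Trig.

Section Bary.
Context {R : realType}.
Variable q : 'I_3 -> plane R.
Hypothesis hq : equilateral q.

Definition cross (a b : plane R) : R := a.1 * b.2 - a.2 * b.1.

Definition area : R := cross (q 1 - q 0) (q 2 - q 0).

(** Cramer's rule, with indices modulo 3. In these coordinates the maps F_i and the reflections no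
    longer depend on the triangle. *)
Definition bary (i : 'I_3) (x : plane R) : R :=
  cross (q (i + 1) - x) (q (i + 2) - x) / area.

Lemma baryE0 x : bary 0 x = cross (q 1 - x) (q 2 - x) / area.
Proof. by rewrite /bary !add0r. Qed.

Lemma baryE1 x : bary 1 x = cross (q 2 - x) (q 0 - x) / area.
Proof.
have e1 : 1 + 1 = 2 :> 'I_3 by apply/val_inj.
have e2 : 1 + 2 = 0 :> 'I_3 by apply/val_inj.
by rewrite /bary e1 e2.
Qed.

Lemma baryE2 x : bary 2 x = cross (q 0 - x) (q 1 - x) / area.
Proof.
have e1 : 2 + 1 = 0 :> 'I_3 by apply/val_inj.
have e2 : 2 + 2 = 1 :> 'I_3 by apply/val_inj.
by rewrite /bary e1 e2.
Qed.

Definition baryE := (baryE0, baryE1, baryE2).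

Lemma equilateral_dot : exists2 d : R, 0 < d &
  [/\ dotp (q 1 - q 0) (q 1 - q 0) = d, dotp (q 2 - q 0) (q 2 - q 0) = d &
     dotp (q 1 - q 0) (q 2 - q 0) = d / 2].
Proof.
case: hq => d d0 H; exists d => //.
have := H 1 0 isT; have := H 2 0 isT; have := H 2 1 isT.
rewrite /sqdist /dotp /=.
case: (q 0) (q 1) (q 2) => a0 b0 [a1 b1] [a2 b2] /= h1 h2 h3.
split; nra.
Qed.

Lemma area_neq0 : area != 0.
Proof.
have [d d0 []] := equilateral_dot.
rewrite /area /cross /dotp /=.
case: (q 0) (q 1) (q 2) => a0 b0 [a1 b1] [a2 b2] /= h1 h2 h3.
set X := (X in X != 0).
have : X ^+ 2 = 3 / 4 * d ^+ 2.
  have -> : X ^+ 2 = ((a1 - a0) * (a1 - a0) + (b1 - b0) * (b1 - b0)) *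
    ((a2 - a0) * (a2 - a0) + (b2 - b0) * (b2 - b0)) -
    ((a1 - a0) * (a2 - a0) + (b1 - b0) * (b2 - b0)) ^+ 2 by rewrite /X; ring.
  by rewrite h1 h2 h3; field.
move=> E; apply/eqP => X0; move: E; rewrite X0 expr0n /= => /esym/eqP.
by rewrite mulf_eq0 expf_eq0 /= (gt_eqF d0) orbF mulf_eq0 invr_eq0 !pnatr_eq0.
Qed.

Lemma bary_contr i j x : bary i (contr q j x) = (bary i x + (i == j)%:R) / 2.
Proof.
have := area_neq0.
case: (I3P i) => ->; case: (I3P j) => ->; rewrite !baryE /contr /area /cross /=.
all: case: (q 0) (q 1) (q 2) x => a0 b0 [a1 b1] [a2 b2] [x y] /= hh.
all: by field.
Qed.

Lemma bary_sum x : bary 0 x + bary 1 x + bary 2 x = 1.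
Proof.
have := area_neq0; rewrite !baryE /area /cross /=.
case: (q 0) (q 1) (q 2) x => a0 b0 [a1 b1] [a2 b2] [x y] /= hh.
by field.
Qed.

Lemma bary_q i j : bary i (q j) = (i == j)%:R.
Proof.
have := area_neq0.
case: (I3P i) => ->; case: (I3P j) => ->; rewrite !baryE /area /cross /=.
all: case: (q 0) (q 1) (q 2) => a0 b0 [a1 b1] [a2 b2] /= hh.
all: by field.
Qed.

Lemma baryK x :
  (x.1 = bary 0 x * (q 0).1 + bary 1 x * (q 1).1 + bary 2 x * (q 2).1) /\
  (x.2 = bary 0 x * (q 0).2 + bary 1 x * (q 1).2 + bary 2 x * (q 2).2).
Proof.
have := area_neq0; rewrite !baryE /area /cross /=.
case: (q 0) (q 1) (q 2) x => a0 b0 [a1 b1] [a2 b2] [x y] /= hh.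
by split; field.
Qed.

Lemma bary_inj x y : (forall i, bary i x = bary i y) -> x = y.
Proof.
move=> H; have [a b] := baryK x; have [c d] := baryK y.
apply/eqP; rewrite -pair_eqE /=; apply/andP; split; apply/eqP.
  by rewrite a c !H.
by rewrite b d !H.
Qed.

Lemma bary_shift i x c : bary i (x.1 - c * (q 2 - q 1).1, x.2 - c * (q 2 - q 1).2) =
  bary i x - c * ((i == 2)%:R - (i == 1)%:R).
Proof.
have := area_neq0.
case: (I3P i) => ->; rewrite !baryE /area /cross /=.
all: case: (q 0) (q 1) (q 2) x => a0 b0 [a1 b1] [a2 b2] [x y] /= hh.
all: by field.
Qed.

(** With e = q_2 - q_1 and d the squared side, (q_1 - q_0).e = - d/2, (q_2 - q_0).e = d/2 and e.e =
    d. So projecting on e reads off a difference of barycentric coordinates, and the orthogonal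
    reflection becomes a permutation of them. *)
Lemma refl_coef p x :
  2 * dotp (x - p) (q 2 - q 1) / dotp (q 2 - q 1) (q 2 - q 1) =
  (bary 2 x - bary 1 x) - (bary 2 p - bary 1 p).
Proof.
have [d d0 []] := equilateral_dot.
have [] := baryK x; have [] := baryK p; have := bary_sum x; have := bary_sum p.
move: (bary 0 x) (bary 1 x) (bary 2 x) (bary 0 p) (bary 1 p) (bary 2 p).
move=> x0 x1 x2 p0 p1 p2 /(canRL (addrK _)) /(canRL (addrK _)) -> /(canRL (addrK _)) /(canRL (addrK _)) ->.
rewrite /dotp /=; case: x p => [x1' x2'] [p1' p2'] /=.
case: (q 0) (q 1) (q 2) => a0 b0 [a1 b1] [a2 b2] /= -> -> -> -> h1 h2 h3.
have E : (a2 - a1) * (a2 - a1) + (b2 - b1) * (b2 - b1) = d by nra.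
rewrite E; apply: (canLR (mulfK _)); first by rewrite gt_eqF.
have -> : d = (a1 - a0) * (a1 - a0) + (b1 - b0) * (b1 - b0) by rewrite h1.
have h4 : (a1 - a0) * (a2 - a0) + (b1 - b0) * (b2 - b0) =
   ((a1 - a0) * (a1 - a0) + (b1 - b0) * (b1 - b0)) / 2 by rewrite h3 h1.
have h5 : (a2 - a0) * (a2 - a0) + (b2 - b0) * (b2 - b0) =
   ((a1 - a0) * (a1 - a0) + (b1 - b0) * (b1 - b0)) by rewrite h1 h2.
move: h4 h5.
have -> : a2 = (a2 - a0) + a0 by rewrite subrK.
have -> : b2 = (b2 - b0) + b0 by rewrite subrK.
have -> : a1 = (a1 - a0) + a0 by rewrite subrK.
have -> : b1 = (b1 - b0) + b0 by rewrite subrK.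
move: (a2 - a0) (b2 - b0) (a1 - a0) (b1 - b0) => A2 B2 A1 B1 h4 h5.
have h6 : A1 * A2 + B1 * B2 = (A1 * A1 + B1 * B1) / 2 by move: h4; rewrite !addrK.
have h7 : A2 * A2 + B2 * B2 = A1 * A1 + B1 * B1 by move: h5; rewrite !addrK.
transitivity (2 * ((x2 - p2) * (A2 * A2 + B2 * B2) - (x1 - p1) * (A1 * A1 + B1 * B1) + ((x1 - p1) - (x2 - p2)) * (A1 * A2 + B1 * B2))); first by ring.
by rewrite h7 h6; field.
Qed.

Lemma bary_refl i x : bary i (cellrefl q [::] x) = bary (swap12 i) x.
Proof.
rewrite /cellrefl /= bary_shift refl_coef !bary_q /=.
have := bary_sum x.
by case: (I3P i) => ->; rewrite swap12E /=; lra.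
Qed.

Lemma contrw_cat u v x : contrw q (u ++ v) x = contrw q u (contrw q v x).
Proof. by rewrite /contrw foldr_cat. Qed.

Lemma contrw_rcons u a x : contrw q (rcons u a) x = contrw q u (contr q a x).
Proof. by rewrite /contrw foldr_rcons. Qed.

(** Differences eliminate the translation part of F_w, so no closed formula for F_w is required;
    injectivity and diameters follow. *)
Lemma bary_contrwB i w x y :
  bary i (contrw q w x) - bary i (contrw q w y) = 2 ^- size w * (bary i x - bary i y).
Proof.
elim: w => [|a w IH] /=; first by rewrite expr0 invr1 mul1r.
rewrite !bary_contr -mulrBl opprD addrACA subrr addr0.
have -> : bary i (foldr (contr q) x w) - bary i (foldr (contr q) y w) = 2 ^- size w * (bary i x - bary i y) := IH.
by rewrite exprS invfM; ring.
Qed.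

Lemma contrw_inj w : injective (contrw q w).
Proof.
move=> x y E; apply: bary_inj => i; apply/eqP; rewrite -subr_eq0.
have := bary_contrwB i w x y; rewrite E subrr => /esym/eqP.
by rewrite mulf_eq0 invr_eq0 expf_eq0 pnatr_eq0 /= andbF.
Qed.

Lemma cellrefl_contrw w x :
  cellrefl q w (contrw q w x) = contrw q w (cellrefl q [::] x).
Proof.
apply: bary_inj => i.
have := bary_contrwB i w (cellrefl q [::] x) x => /(canRL (subrK _)) ->.
rewrite /cellrefl /= !bary_shift !refl_coef.
have := bary_contrwB 1 w x (q 0); have := bary_contrwB 2 w x (q 0).
rewrite !bary_q /=.
move: (bary 1 (contrw q w x)) (bary 2 (contrw q w x)) (bary 1 (contrw q w (q 0)))
  (bary 2 (contrw q w (q 0))) => a b c d /(canRL (subrK _)) -> /(canRL (subrK _)) ->.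
ring.
Qed.

Lemma contr_refl i x : cellrefl q [::] (contr q i x) = contr q (swap12 i) (cellrefl q [::] x).
Proof.
apply: bary_inj => j; rewrite bary_refl !bary_contr bary_refl.
by rewrite (can2_eq swap12K swap12K).
Qed.

Lemma refl_q i : cellrefl q [::] (q i) = q (swap12 i).
Proof. by apply: bary_inj => j; rewrite bary_refl !bary_q (can2_eq swap12K swap12K). Qed.

Lemma refl_contrw w x :
  cellrefl q [::] (contrw q w x) = contrw q (map swap12 w) (cellrefl q [::] x).
Proof. by elim: w => //= a w IH; rewrite contr_refl; congr contr. Qed.

Lemma cellrefl_cat w v x : cellrefl q w (contrw q (w ++ v) x) =
  contrw q (w ++ map swap12 v) (cellrefl q [::] x).
Proof. by rewrite !contrw_cat cellrefl_contrw refl_contrw. Qed.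

Definition tri : set (plane R) := [set x | forall i, 0 <= bary i x].

Lemma tri_q i : tri (q i).
Proof. by move=> j; rewrite bary_q ler0n. Qed.

Lemma bary_le1 i x : tri x -> bary i x <= 1.
Proof.
move=> tx; have := bary_sum x; have := tx 0; have := tx 1; have := tx 2.
case: (I3P i) => ->; lra.
Qed.

Lemma bary_eq1 a x : tri x -> bary a x = 1 -> x = q a.
Proof.
move=> tx; have := bary_sum x; have := tx 0; have := tx 1; have := tx 2.
move=> t2 t1 t0 ts e; apply: bary_inj => i; rewrite bary_q.
by move: e; case: (I3P a) => ->; case: (I3P i) => -> /=; lra.
Qed.

Lemma tri_contr a x : tri x -> tri (contr q a x).
Proof. by move=> tx i; rewrite bary_contr mulr_ge0 ?invr_ge0 ?addr_ge0 ?ler0n. Qed.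

Lemma tri_contrw w x : tri x -> tri (contrw q w x).
Proof. by elim: w => //= a w IH tx; apply: tri_contr; apply: IH. Qed.

Lemma contrw_nseq n a : contrw q (nseq n a) (q a) = q a.
Proof.
elim: n => // n IH; rewrite /contrw /= -/(contrw q (nseq n a) (q a)) IH.
apply: bary_inj => i; rewrite bary_contr bary_q; by field.
Qed.

(** q_a is the only point of the triangle with a-th coordinate 1, and averaging with q_b attains 1
    only if b = a and the other point already has it. *)
Lemma contrw_eq_q v y a : tri y -> contrw q v y = q a -> v = nseq (size v) a /\ y = q a.
Proof.
move=> ty; elim: v => [//|b v IH] /= E.
have tv := tri_contrw v ty.
have : bary a (contr q b (contrw q v y)) = 1 by rewrite E bary_q eqxx.
rewrite bary_contr; have := bary_le1 a tv => h1.
case: eqVneq => [|_] /=; last by move=> ?; exfalso; clear E IH; lra.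
move=> ab h2; have h3 : bary a (contrw q v y) = 1 by clear E IH; lra.
by have [{1}-> ->] := IH (bary_eq1 tv h3); rewrite ab.
Qed.

(* Two distinct cells of the same level share at most the junction
   F_u F_a q_a' = F_u F_a' q_a. *)
Lemma contrw_meet w w' y y' : size w = size w' -> tri y -> tri y' ->
  contrw q w y = contrw q w' y' ->
  (w = w' /\ y = y') \/
  exists u a a' n, [/\ a != a', w = u ++ a :: nseq n a', w' = u ++ a' :: nseq n a,
    y = q a' & y' = q a].
Proof.
move=> + ty ty'; elim: w w' => [|a w IH] [|a' w'] //=; first by left.
move=> [ss] E.
have t1 := tri_contrw w ty; have t2 := tri_contrw w' ty'.
have [eaa|neq] := eqVneq a a'.
  subst a'.
  have : contrw q w y = contrw q w' y'.
    by apply: (@contrw_inj [:: a]).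
  case/(IH _ ss) => [[-> ->]|[u [b [b' [n [nb -> -> -> ->]]]]]]; first by left.
  by right; exists (a :: u), b, b', n.
right; exists [::], a, a', (size w).
(* Different first letters a and a': the a-th coordinate is at least 1/2 on the left and at most 1/2
   on the right, which forces F_w' y' = q_a; in the same way a' forces F_w y = q_a'. *)
have := congr1 (bary a) E; have := congr1 (bary a') E.
rewrite !bary_contr !eqxx (eq_sym a') (negPf neq) /=.
rewrite -/(contrw q w y) -/(contrw q w' y').
have b1 := bary_le1 a t2; have b2 := bary_le1 a' t1.
have b3 := t1 a; have b4 := t2 a'.
move=> e1 e2.
have [] := @contrw_eq_q w y a' ty _ => [|ew ->].
  by apply: bary_eq1 => //; clear E IH; lra.
have [] := @contrw_eq_q w' y' a ty' _ => [|ew' ->].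
  by apply: bary_eq1 => //; clear E IH; lra.
by split => //; [rewrite {1}ew | rewrite {1}ew' ss].
Qed.

(** A letter 0 adds a positive amount to the 0-th coordinate, and later halvings never remove it. *)
Lemma bary0_contrw w y : tri y ->
  (bary 0 (contrw q w y) == 0) = word12 w && (bary 0 y == 0).
Proof.
move=> ty; elim: w => // a w IH; rewrite /word12 /= -andbA -/(word12 w) -IH.
rewrite bary_contr mulf_eq0 invr_eq0 pnatr_eq0 orbF -/(contrw q w y).
have t := tri_contrw w ty 0.
case: (eqVneq a 0) => [_|_] /=; last by rewrite addr0.
by apply/negbTE; rewrite gt_eqF // ltr_wpDl.
Qed.

Lemma segLE x : tri x -> segL q x <-> bary 0 x = 0.
Proof.
move=> tx; split.
  move=> [t t01 ->].
  have -> : bary 0 ((1 - t) * (q 1).1 + t * (q 2).1, (1 - t) * (q 1).2 + t * (q 2).2) =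
     bary 0 (((q 1).1 - (- t) * (q 2 - q 1).1, (q 1).2 - (- t) * (q 2 - q 1).2)).
    by congr (bary 0 (_, _)) => /=; ring.
  by rewrite bary_shift bary_q /=; lra.
move=> x0; exists (bary 2 x).
  by rewrite tx bary_le1.
have [] := baryK x; have := bary_sum x; rewrite x0 !mul0r !add0r => s.
have -> : 1 - bary 2 x = bary 1 x by lra.
by move=> <- <-; rewrite -surjective_pairing.
Qed.

(* [F_w q_i] lies on L; such vertices are not in Omega_m. *)
Definition onL (w : seq 'I_3) (i : 'I_3) := word12 w && (i != 0).

Lemma segL_contrw w i : segL q (contrw q w (q i)) <-> onL w i.
Proof.
rewrite segLE; last exact/tri_contrw/tri_q.
have := bary0_contrw w (tri_q i); rewrite bary_q (eq_sym 0).
have -> : (((i == 0)%:R : R) == 0) = (i != 0).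
  by case: (i == 0); rewrite ?oner_eq0 ?eqxx.
by rewrite /onL => <-; split => /eqP.
Qed.

Lemma VOmegaP m x : VOmega q m x <->
  exists w i, [/\ size w = m, x = contrw q w (q i) & ~~ onL w i].
Proof.
split.
  move=> [[w [i [sw ->]]]] nL; exists w, i; split => //.
  by apply/negP => /segL_contrw.
move=> [w [i [sw -> nL]]]; split; first by exists w, i.
by move/segL_contrw => h; rewrite h in nL.
Qed.

End Bary.

(** * Cells of the gasket *)

Section Attractor.
Context {R : realType}.
Variable q : 'I_3 -> plane R.
Hypothesis hq : equilateral q.
Variable SG : set (plane R).
Hypothesis hSG : is_attractor q SG.

Definition cell (w : seq 'I_3) : set (plane R) := contrw q w @` SG.

Lemma plane_dist (x y : plane R) :
  `|x - y| <= \sum_i `|bary q i x - bary q i y| * (`|(q i).1| + `|(q i).2|).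
Proof.
have [a b] := baryK hq x; have [c d] := baryK hq y.
rewrite prod_normE ge_max /= a b c d big3.
have key : forall A B C A' B' C' p r s p' r' s' : R,
   `|A * p + B * r + C * s - (A' * p + B' * r + C' * s)| <=
   `|A - A'| * (`|p| + `|p'|) + `|B - B'| * (`|r| + `|r'|) + `|C - C'| * (`|s| + `|s'|).
  move=> A B C A' B' C' p r s p' r' s'.
  have -> : A * p + B * r + C * s - (A' * p + B' * r + C' * s) =
    (A - A') * p + (B - B') * r + (C - C') * s by ring.
  apply: le_trans (ler_normD _ _) _; apply: lerD; last first.
    by rewrite normrM ler_wpM2l // lerDl.
  apply: le_trans (ler_normD _ _) _; apply: lerD;
    by rewrite normrM ler_wpM2l // lerDl.
apply/andP; split; first exact: key.
rewrite [X in _ <= _ * X + _ + _]addrC [X in _ <= _ + _ * X + _]addrC.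
rewrite [X in _ <= _ + _ + _ * X]addrC.
exact: key.
Qed.

Definition diam : R := \sum_i (`|(q i).1| + `|(q i).2|).

Lemma diam_ge0 : 0 <= diam.
Proof. by apply: sumr_ge0 => i _; rewrite addr_ge0. Qed.

Lemma contrw_dist w x y : tri q x -> tri q y ->
  `|contrw q w x - contrw q w y| <= 2 ^- size w * diam.
Proof.
move=> tx ty; apply: le_trans (plane_dist _ _) _.
rewrite /diam mulr_sumr; apply: ler_sum => i _.
apply: ler_wpM2r; first by rewrite addr_ge0.
rewrite (bary_contrwB hq) normrM ger0_norm ?invr_ge0 ?exprn_ge0 //.
rewrite ler_piMr ?invr_ge0 ?exprn_ge0 //.
have := tx i; have := ty i; have := bary_le1 hq i tx; have := bary_le1 hq i ty.
move=> *; rewrite ler_norml; lra.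
Qed.

Lemma plane_cvg (s : nat -> plane R) (x : plane R) (e : nat -> R) :
  (e @ \oo --> 0) -> (forall n, `|s n - x| <= e n) -> s @ \oo --> x.
Proof.
move=> e0 H; apply/cvgrPdist_le => d d0.
have /cvgrPdist_le/(_ _ d0) := e0; apply: filterS => n.
rewrite sub0r normrN => h; rewrite distrC.
by apply: le_trans (H n) _; apply: le_trans (ler_norm _) h.
Qed.

Lemma cvg_half (c : R) : (fun n => 2 ^- n * c) @ \oo --> (0 : R).
Proof.
rewrite -(mul0r c); apply: cvgM; last exact: cvg_cst.
rewrite [X in X @ _ --> _](_ : _ = geometric 1 (2^-1)).
  by apply: cvg_geometric; rewrite ger0_norm ?invr_ge0 // invf_lt1 // ltr1n.
by apply/funext => n; rewrite /geometric /= mul1r exprVn.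
Qed.

Lemma SG_contr i x : SG x -> SG (contr q i x).
Proof. by case: hSG => _ _ E sx; rewrite E; exists i => //; exists x. Qed.

Lemma SG_contrw w x : SG x -> SG (contrw q w x).
Proof. by elim: w => //= a w IH sx; apply: SG_contr; apply: IH. Qed.

Lemma SG_dec n x : SG x -> exists w y, [/\ size w = n, SG y & x = contrw q w y].
Proof.
elim: n x => [|n IH] x sx; first by exists [::], x.
case: hSG => _ _ E; move: (sx); rewrite {1}E => -[i _ [y sy <-]].
have [w [z [sw sz ->]]] := IH y sy.
by exists (i :: w), z; rewrite /= sw.
Qed.

Lemma bary_affine i : exists a b c : R, forall x, bary q i x = a * x.1 + b * x.2 + c.
Proof.
rewrite /bary /cross; set A := q _; set B := q _.
exists ((A.2 - B.2) / area q), ((B.1 - A.1) / area q), ((A.1 * B.2 - A.2 * B.1) / area q).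
move=> x /=; have := area_neq0 hq.
move: (area q) A.1 A.2 B.1 B.2 x.1 x.2 => D a1 a2 b1 b2 x1 x2 D0.
by field.
Qed.

Lemma bary_continuous i : continuous (bary q i : plane R -> R).
Proof.
have [a [b [c H]]] := bary_affine i.
rewrite (_ : bary q i = fun x => a * x.1 + b * x.2 + c); last by apply/funext.
move=> x; apply: cvgD; last exact: cvg_cst.
apply: cvgD; apply: cvgM; try exact: cvg_cst.
  exact: cvg_fst.
exact: cvg_snd.
Qed.

(** Let c minimise the i-th coordinate on the compact set SG, and write c = F_j y. The minimum is
    then at least half of itself, hence nonnegative. *)
Lemma SG_tri : SG `<=` tri q.
Proof.
have aux : forall u v : R, 0 <= v -> (u + v) / 2 <= u -> 0 <= (u + v) / 2 by move=> *; lra.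
case: hSG => cK K0 E x sx i.
have [c /[!inE] cSG cmin] := compact_EVT_min K0 cK (@continuous_subspaceT _ _ SG _ (@bary_continuous i)).
have h : bary q i c <= bary q i x by apply: cmin; rewrite inE.
apply: le_trans h.
move: (cSG); rewrite {1}E => -[j _ [y sy yc]].
have := cmin y; rewrite inE -yc => /(_ sy); rewrite (bary_contr hq).
by apply: aux; rewrite ler0n.
Qed.

Lemma SG_closed : closed SG.
Proof. by case: hSG => cK _ _; apply: compact_closed cK. Qed.

Lemma SG_q i : SG (q i).
Proof.
case: hSG => _ [x sx] _.
have : (fun n => contrw q (nseq n i) x) @ \oo --> q i.
  apply: (plane_cvg (cvg_half diam)) => n.
  have -> : contrw q (nseq n i) x - q i = contrw q (nseq n i) x - contrw q (nseq n i) (q i).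
    by rewrite contrw_nseq.
  by apply: le_trans (contrw_dist _ _ _) _; [exact: SG_tri|exact: tri_q|rewrite size_nseq].
apply: (closed_cvg _ SG_closed).
by apply: nearW => n; apply: SG_contrw.
Qed.

Lemma SG_point w i : SG (contrw q w (q i)).
Proof. exact/SG_contrw/SG_q. Qed.

Lemma cell_point w v i : cell w (contrw q (w ++ v) (q i)).
Proof. by exists (contrw q v (q i)); [exact: SG_point|rewrite contrw_cat]. Qed.

Lemma cell_dist w x y : cell w x -> cell w y -> `|x - y| <= 2 ^- size w * diam.
Proof. by move=> [x' /SG_tri tx <-] [y' /SG_tri ty <-]; exact: contrw_dist. Qed.

Lemma cell_cvg (w : nat -> seq 'I_3) (s : nat -> plane R) x :
  (forall n, size (w n) = n) -> (forall n, cell (w n) x) -> (forall n, cell (w n) (s n)) ->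
  s @ \oo --> x.
Proof.
move=> sw cx cs; apply: (plane_cvg (cvg_half diam)) => n.
by have := cell_dist (cs n) (cx n); rewrite sw.
Qed.

(** Exchanging 1 and 2 in the addresses of x gives points of the closed set SG which converge to the
    mirror image. *)
Lemma SG_refl x : SG x -> SG (cellrefl q [::] x).
Proof.
move=> sx.
have /choice[w Hw] : forall n, exists w : seq 'I_3, size w = n /\ cell w x.
  by move=> n; have [w [y [sw sy ->]]] := SG_dec n sx; exists w; split => //; exists y.
pose s n := contrw q (map swap12 (w n)) (q 0).
have : s @ \oo --> cellrefl q [::] x.
  apply: (plane_cvg (cvg_half diam)) => n; have [sw [y sy <-]] := Hw n.
  rewrite (refl_contrw hq) /s; apply: le_trans (contrw_dist _ _ _) _.
  - exact: tri_q.
  - by move=> i; rewrite (bary_refl hq); exact: SG_tri.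
  - by rewrite size_map sw.
apply: (closed_cvg _ SG_closed).
by apply: nearW => n; apply: SG_point.
Qed.

Lemma contrw_continuous w : continuous (contrw q w : plane R -> plane R).
Proof.
elim: w => [|a v IH] y; first exact: cvg_id.
have h1 : (((contrw q v x).1 + (q a).1) / 2 : R) @[x --> y] --> (((contrw q v y).1 + (q a).1) / 2 : R).
  apply: cvgM; last exact: cvg_cst.
  apply: cvgD; last exact: cvg_cst.
  by apply: cvg_comp (IH y) _; exact: cvg_fst.
have h2 : (((contrw q v x).2 + (q a).2) / 2 : R) @[x --> y] --> (((contrw q v y).2 + (q a).2) / 2 : R).
  apply: cvgM; last exact: cvg_cst.
  apply: cvgD; last exact: cvg_cst.
  by apply: cvg_comp (IH y) _; exact: cvg_snd.
exact: (cvg_pair h1 h2).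
Qed.

Lemma cell_closed w : closed (cell w).
Proof.
have [cK _ _] := hSG.
have cc : compact (cell w).
  exact: (continuous_compact (@continuous_subspaceT _ _ SG _ (@contrw_continuous w)) cK).
exact: compact_closed cc.
Qed.

Lemma cell_meet w w' x : size w = size w' -> cell w x -> cell w' x -> w = w' \/
  exists a a', x = contrw q w (q a) /\ x = contrw q w' (q a').
Proof.
move=> ss [y sy yx] [y' sy' yx'].
have [[-> _]|[u [a [a' [n [_ e1 e2 e3 e4]]]]]] :=
  contrw_meet hq ss (SG_tri sy) (SG_tri sy') (etrans yx (esym yx')); first by left.
by right; exists a', a; rewrite -e3 -e4 yx yx'.
Qed.

(** Letters are appended on the right, where the subdivision of a cell adds them. *)
Fixpoint words (n : nat) : seq (seq 'I_3) :=
  if n is m.+1 then [seq rcons w k | w <- words m, k <- [:: 0; 1; 2]] else [:: [::]].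

Lemma wordsS n : words n.+1 = [seq rcons w k | w <- words n, k <- [:: 0; 1; 2]].
Proof. by []. Qed.

Lemma mem_words n w : (w \in words n) = (size w == n).
Proof.
elim: n w => [|n IH] w; first by rewrite inE size_eq0.
rewrite wordsS.
apply/idP/eqP.
  move=> /allpairsPdep[v [k [vn _ ->]]].
  by rewrite size_rcons; congr S; apply/eqP; rewrite -IH.
case/lastP: w => // v k; rewrite size_rcons => -[sv].
apply/allpairsPdep; exists v, k; split => //; first by rewrite IH sv.
by case: (I3P k) => ->.
Qed.

Lemma words_uniq n : uniq (words n).
Proof.
elim: n => // n IH; rewrite wordsS.
by apply: allpairs_uniq => // -[w k] [w' k'] _ _ /= /rcons_inj[-> ->].
Qed.

(** The finitely many cells of level n that miss x are closed, so a neighbourhood of x avoids them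
    all. *)
Lemma near_cell x n : \forall y \near x, SG y ->
  exists w, [/\ size w = n, cell w x & cell w y].
Proof.
pose F w := ~` cell w.
have : \forall y \near x, forall w : n.-tuple 'I_3, ~ cell w x -> ~ cell w y.
  have := @filter_forall _ _ (fun (w : n.-tuple 'I_3) y => ~ cell w x -> ~ cell w y) (nbhs x) (nbhs_filter x).
  apply => w.
  have [cx|ncx] := pselect (cell w x); first by apply: nearW.
  have : \forall y \near x, (~` cell w) y.
    have op : open (~` cell w) by apply: closed_openC; exact: cell_closed.
    exact: (open_nbhs_nbhs (conj op ncx)).
  by apply: filterS => y hy ncx'; exact: hy.
apply: filterS => y H sy; have [w [z [sw sz yw]]] := SG_dec n sy.
exists w; split => //; last by exists z.
apply: contrapT => ncx; have := H (Tuple (introT eqP sw)); apply => //=.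
by exists z.
Qed.

End Attractor.

Lemma fsbig_inj (R : nmodType) (T : eqType) (X : choiceType) (s : seq T) (h : T -> X)
    (A : set X) (F : X -> R) : uniq s -> {in s &, injective h} ->
  (forall x, A x <-> exists2 t, t \in s & x = h t) ->
  \sum_(x \in A) F x = \sum_(t <- s) F (h t).
Proof.
move=> us ih HA.
have -> : A = [set` map h s].
  apply/seteqP; split => x /=.
    by move=> /HA[t ts ->]; apply: map_f.
  by move=> /mapP[t ts ->]; apply/HA; exists t.
by rewrite -fsbig_seq ?map_inj_in_uniq // big_map.
Qed.

Lemma big_fiber (R : nmodType) (T X : eqType) (s : seq T) (h : T -> X) (F : T -> R) :
  \sum_(t <- s) F t = \sum_(x <- undup (map h s)) \sum_(t <- s | h t == x) F t.
Proof.
rewrite (exchange_big_dep xpredT) //=.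
rewrite big_seq [in RHS]big_seq; apply: eq_bigr => t ts.
have hs : h t \in undup (map h s) by rewrite mem_undup map_f.
rewrite -big_filter (_ : [seq x <- undup (map h s) | h t == x] = [:: h t]) ?big_seq1 //.
rewrite (eq_filter (a2 := pred1 (h t))) => [|x /=]; last by rewrite eq_sym.
by apply: filter_pred1_uniq => //; apply: undup_uniq.
Qed.

(** * Graph energies as sums over corners *)

Section Corners.
Context {R : realType}.
Variable q : 'I_3 -> plane R.
Hypothesis hq : equilateral q.

(** A name of the vertex F_w q_i; a vertex may have two names. *)
Definition corner : Type := (seq 'I_3 * 'I_3)%type.

Definition pt (c : corner) : plane R := contrw q c.1 (q c.2).

Definition ref (w : seq 'I_3) : plane R := pt (w, 0).

(** A cell with word in {1,2} has two of its three vertices on L and carries no edge of Omega_m; all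
    other cells are disjoint from L. *)
Definition gwords (m : nat) : seq (seq 'I_3) := [seq w <- words m | ~~ word12 w].

Definition gcorners (m : nat) : seq corner :=
  [seq (w, i) | w <- gwords m, i <- [:: 0; 1; 2]].

Definition flux (u : plane R -> R) (c : corner) : R :=
  \sum_j (u (pt c) - u (pt (c.1, j))).

Definition EE (m : nat) (u v : plane R -> R) : R :=
  \sum_(w <- gwords m) \sum_(ij <- [:: (0, 1); (0, 2); (1, 2)] : seq ('I_3 * 'I_3))
    ((u (pt (w, ij.1)) - u (pt (w, ij.2))) * (v (pt (w, ij.1)) - v (pt (w, ij.2)))).

(** For m > 0 a vertex weighs 1 in the interior and 1/2 on the boundary, where it has one good name
    only. This absorbs the factor 2 of the Neumann condition. *)
Definition MP (m : nat) (u v : plane R -> R) : R :=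
  2^-1 * \sum_(c <- gcorners m) u (pt c) * v (pt c).

Lemma q_inj : injective q.
Proof.
move=> i j e; have := bary_q hq i j; rewrite -e (bary_q hq) eqxx.
by case: eqVneq => // _ /eqP; rewrite oner_eq0.
Qed.

Lemma mem_gwords m w : (w \in gwords m) = ~~ word12 w && (size w == m).
Proof. by rewrite mem_filter mem_words. Qed.

Lemma gwords_uniq m : uniq (gwords m).
Proof. exact/filter_uniq/words_uniq. Qed.

Lemma I3_enum (i : 'I_3) : i \in [:: 0; 1; 2].
Proof. by case: (I3P i) => ->. Qed.

Lemma mem_gcorners m c : (c \in gcorners m) = ~~ word12 c.1 && (size c.1 == m).
Proof.
rewrite -mem_gwords; case: c => w i /=; apply/allpairsPdep/idP.
  by move=> [v [k [vg _ [-> _]]]].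
by move=> wg; exists w, i; split => //; apply: I3_enum.
Qed.

Lemma gcorners_uniq m : uniq (gcorners m).
Proof. by apply: allpairs_uniq => //; [apply: gwords_uniq|move=> [a b] [c d]]. Qed.

Lemma big_gcorners m (F : corner -> R) :
  \sum_(c <- gcorners m) F c = \sum_(w <- gwords m) \sum_i F (w, i).
Proof.
rewrite big_allpairs_dep; apply: eq_bigr => w _.
by rewrite !big_cons big_nil /= addr0 big3 addrA.
Qed.

(** Distinct cells of one level share at most one vertex, so an edge knows its cell. Edge sums on
    Omega_m thereby become sums over cells. *)
Lemma pt_pair_inj w w' i i' j j' : size w = size w' -> i != j -> i' != j' ->
  pt (w, i) = pt (w', i') -> pt (w, j) = pt (w', j') -> [/\ w = w', i = i' & j = j'].
Proof.
move=> sw ij ij' e1 e2; rewrite /pt /= in e1 e2.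
have key k : ((k == i)%:R - (k == j)%:R : R) = (k == i')%:R - (k == j')%:R.
  have := bary_contrwB hq k w (q i) (q j).
  rewrite e1 e2 (bary_contrwB hq) sw !(bary_q hq) => /mulfI h.
  by apply/esym/h; rewrite invr_eq0 expf_eq0 pnatr_eq0 andbF.
have ei : i = i'.
  have := key i; rewrite eqxx (negPf ij) subr0.
  case: (eqVneq i i') => // _; case: (i == j'); rewrite ?subrr ?sub0r ?subr0 => /eqP.
    by rewrite -subr_eq0 opprK -natrD pnatr_eq0.
  by rewrite oner_eq0.
have ej : j = j'.
  have := key j; rewrite eqxx eq_sym (negPf ij) sub0r.
  case: (eqVneq j j') => // _; case: (j == i'); rewrite ?subrr ?sub0r ?subr0 => /eqP.
    by rewrite -subr_eq0 -opprD oppr_eq0 -natrD pnatr_eq0.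
  by rewrite oppr_eq0 oner_eq0.
split => //; subst i' j'.
have [[]//|[u [a [a' [n [naa _ _ e3 e4]]]]]] := contrw_meet hq sw (tri_q hq i) (tri_q hq i) e1.
by case/eqP: naa; apply: q_inj; rewrite -e3 -e4.
Qed.

Lemma onL_good w i : ~~ word12 w -> ~~ onL w i.
Proof. by rewrite /onL => /negPf ->. Qed.

Lemma adjOmegaP m x y : adjOmega q m x y <->
  exists w i j, [/\ w \in gwords m, i != j, x = pt (w, i) & y = pt (w, j)].
Proof.
split.
  move=> [[_ nx] [_ ny] [nxy [w [sw [i xi] [j yj]]]]].
  have nij : i != j by apply/eqP => ij; apply: nxy; rewrite xi yj ij.
  exists w, i, j; split => //; rewrite mem_gwords sw eqxx andbT; apply/negP => bw.
  case/eqP: nij.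
  have : i == 0.
    by apply: contrapT => /negP i0; apply: nx; rewrite xi; apply/(segL_contrw hq); rewrite /onL bw.
  move=> /eqP ->; apply/esym/eqP.
  by apply: contrapT => /negP i0; apply: ny; rewrite yj; apply/(segL_contrw hq); rewrite /onL bw.
move=> [w [i [j [wg nij -> ->]]]].
have /andP[gw /eqP sw] : ~~ word12 w && (size w == m) by rewrite -mem_gwords.
split.
- by apply/(VOmegaP hq); exists w, i; split => //; apply: onL_good.
- by apply/(VOmegaP hq); exists w, j; split => //; apply: onL_good.
split; last by exists w; split => //; [exists i|exists j].
by move=> /(contrw_inj hq)/q_inj/eqP; apply/negP.
Qed.

Definition six : seq ('I_3 * 'I_3) := [:: (0, 1); (0, 2); (1, 0); (1, 2); (2, 0); (2, 1)].

Lemma mem_six i j : ((i, j) \in six) = (i != j).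
Proof. by case: (I3P i) => ->; case: (I3P j) => ->. Qed.

Definition gpairs m : seq (seq 'I_3 * ('I_3 * 'I_3)) := [seq (w, ij) | w <- gwords m, ij <- six].

Lemma mem_gpairs m w i j : ((w, (i, j)) \in gpairs m) = (w \in gwords m) && (i != j).
Proof.
rewrite -mem_six; apply/allpairsPdep/andP.
  by move=> [v [k [vg kk [-> ->]]]].
by move=> [wg ij]; exists w, (i, j).
Qed.

Lemma gpairs_uniq m : uniq (gpairs m).
Proof. by apply: allpairs_uniq => //; [apply: gwords_uniq|move=> [a b] [c d]]. Qed.

Lemma energymE m u v : energym q m u v = (5 / 3) ^+ m * EE m u v.
Proof.
rewrite /energym; congr (_ * _).
rewrite (@fsbig_inj _ _ _ (gpairs m) (fun t => (pt (t.1, t.2.1), pt (t.1, t.2.2)))).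
- rewrite big_allpairs_dep /EE mulr_sumr; apply: eq_bigr => w _.
  rewrite !big_cons !big_nil /= !addr0.
  move: (u (pt (w, 0))) (u (pt (w, 1))) (u (pt (w, 2))) (v (pt (w, 0))) (v (pt (w, 1))) (v (pt (w, 2))).
  by move=> a b c d e f; field.
- exact: gpairs_uniq.
- move=> [w [i j]] [w' [i' j']]; rewrite !mem_gpairs => /andP[wg ij] /andP[wg' ij'] [e1 e2].
  have sw : size w = size w'.
    by move: wg wg'; rewrite !mem_gwords => /andP[_ /eqP ->] /andP[_ /eqP ->].
  by have [-> -> ->] := pt_pair_inj sw ij ij' e1 e2.
move=> [x y] /=; rewrite adjOmegaP; split.
  move=> [w [i [j [wg nij -> ->]]]]; exists (w, (i, j)) => //.
  by rewrite mem_gpairs wg.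
move=> [[w [i j]]]; rewrite mem_gpairs => /andP[wg nij] [-> ->].
by exists w, i, j.
Qed.

Lemma laplE m u x : lapl q m u x = \sum_(c <- gcorners m | pt c == x) flux u c.
Proof.
rewrite /lapl (@fsbig_inj _ _ _ [seq t <- gpairs m | pt (t.1, t.2.1) == x] (fun t => pt (t.1, t.2.2))).
- rewrite big_filter big_mkcond big_allpairs_dep /=.
  rewrite [RHS]big_mkcond big_allpairs_dep /=; apply: eq_bigr => w _.
  rewrite !big_cons !big_nil /= !addr0 /flux !big3 /= !subrr !addr0 !add0r.
  by do 3 (case: eqVneq => [<-|_]; rewrite ?add0r ?addr0 // ?addrA).
- exact/filter_uniq/gpairs_uniq.
- move=> [w [i j]] [w' [i' j']]; rewrite !mem_filter !mem_gpairs => /andP[/eqP e1 /andP[wg ij]] /andP[/eqP e1' /andP[wg' ij']] e2.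
  have sw : size w = size w'.
    by move: wg wg'; rewrite !mem_gwords => /andP[_ /eqP ->] /andP[_ /eqP ->].
  by have [-> -> ->] := pt_pair_inj sw ij ij' (etrans e1 (esym e1')) e2.
move=> y /=; rewrite adjOmegaP; split.
  move=> [w [i [j [wg nij -> ->]]]]; exists (w, (i, j)) => //.
  by rewrite mem_filter mem_gpairs wg eqxx.
move=> [[w [i j]]]; rewrite mem_filter mem_gpairs => /andP[/eqP <- /andP[wg nij]] ->.
by exists w, i, j.
Qed.

Lemma EE_flux m u v : EE m u v = \sum_(c <- gcorners m) flux u c * v (pt c).
Proof.
rewrite big_gcorners; apply: eq_bigr => w _.
rewrite !big_cons !big_nil /flux !big3 /= !subrr !addr0 !add0r.
ring.
Qed.

End Corners.

(** * Names of a vertex and the weak Neumann equation *)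

Section Mult.
Context {R : realType}.
Variable q : 'I_3 -> plane R.
Hypothesis hq : equilateral q.
Local Notation pt := (@pt R q).
Local Notation gcorners := (@gcorners).

Definition mult m (x : plane R) : nat := count (fun c => pt c == x) (gcorners m).

Lemma nseqSr (T : Type) n (x : T) : nseq n.+1 x = rcons (nseq n x) x.
Proof. by elim: n => //= n <-. Qed.

(** The last letter different from i decides whether the corner (w, i) has a second name: u a i^n
    with corner i is the vertex u i a^n with corner a, while i^n with corner i is q_i. *)
Lemma dec_tail (w : seq 'I_3) i :
  w = nseq (size w) i \/ exists u a n, a != i /\ w = u ++ a :: nseq n i.
Proof.
elim/last_ind: w => [|w k [->|[u [a [n [ai ->]]]]]]; first by left.
  case: (eqVneq k i) => [->|ki]; first by left; rewrite -nseqSr size_nseq.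
  by right; exists (nseq (size w) i), k, 0%N; rewrite cats1.
case: (eqVneq k i) => [->|ki]; last by right; exists (u ++ a :: nseq n i), k, 0%N; rewrite cats1.
by right; exists u, a, n.+1; rewrite rcons_cat rcons_cons -nseqSr.
Qed.

Lemma dec_tail_uniq (u u' : seq 'I_3) a a' i n n' : a != i -> a' != i ->
  u ++ a :: nseq n i = u' ++ a' :: nseq n' i -> [/\ u = u', a = a' & n = n'].
Proof.
move=> ai ai'; elim: n n' => [|n IH] [|n'].
- by rewrite !cats1 => /rcons_inj[-> ->].
- rewrite cats1 nseqSr -rcons_cons -rcons_cat => /rcons_inj[_ e].
  by rewrite e eqxx in ai.
- rewrite cats1 nseqSr -rcons_cons -rcons_cat => /rcons_inj[_ e].
  by rewrite e eqxx in ai'.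
rewrite !nseqSr -!rcons_cons -!rcons_cat => /rcons_inj[e].
by have [-> -> ->] := IH _ e.
Qed.

Lemma dec_tail_nseq (u : seq 'I_3) a i n m : a != i -> u ++ a :: nseq n i <> nseq m i.
Proof.
move=> ai e; have : a \in nseq m i by rewrite -e mem_cat inE eqxx orbT.
by rewrite mem_nseq (negPf ai) andbF.
Qed.

Lemma pt_partner u a i n : pt (u ++ a :: nseq n i, i) = pt (u ++ i :: nseq n a, a).
Proof.
rewrite /pt /= !contrw_cat; congr contrw; rewrite /contrw /= -!/(contrw q _ _).
rewrite -!/(contrw q (nseq n _) _) !contrw_nseq //.
by apply: (bary_inj hq) => k; rewrite !(bary_contr hq) !(bary_q hq) addrC.
Qed.

Lemma pt_eq c c' : size c.1 = size c'.1 -> pt c = pt c' ->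
  c = c' \/ exists u a a' n, [/\ a != a', c = (u ++ a :: nseq n a', a') &
    c' = (u ++ a' :: nseq n a, a)].
Proof.
case: c c' => w i [w' i'] /= ss e.
have [[-> /(q_inj hq) ->]|[u [a [a' [n [naa -> -> /(q_inj hq) -> /(q_inj hq) ->]]]]]] :=
  contrw_meet hq ss (tri_q hq i) (tri_q hq i') e; first by left.
by right; exists u, a, a', n.
Qed.

Lemma word12_cat (u v : seq 'I_3) : word12 (u ++ v) = word12 u && word12 v.
Proof. exact: all_cat. Qed.

Lemma word12_nseq n (a : 'I_3) : word12 (nseq n a) = (n == 0%N) || (a != 0).
Proof. by rewrite /word12 all_nseq. Qed.

Lemma count_mem_seq (T : eqType) (s t : seq T) (p : pred T) : uniq s -> uniq t ->
  (forall x, (x \in t) = (x \in s) && p x) -> count p s = size t.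
Proof.
move=> us ut H; rewrite -size_filter; apply: perm_size; apply: uniq_perm => //.
  exact: filter_uniq.
by move=> x; rewrite mem_filter H andbC.
Qed.

(** A good corner has at most one other name. There is none at q_0, since i^m is good only for i =
    0, and the other name belongs to a cell touching L exactly at the bottom vertices F_w q_0. Level
    0 has no good cell at all, hence [0 < m]. *)
Lemma mult_eq m x : (0 < m)%N -> VOmega q m x ->
  (bdOmega q m x /\ mult m x = 1%N) \/ (~ bdOmega q m x /\ mult m x = 2%N).
Proof.
move=> m0 /(VOmegaP hq) [w0 [i0 [sw0 x0 nL0]]].
(* If the given cell touches L, its vertex off L is the top one, and F_v F_k q_0 = F_v F_0 q_k names
   it through a good cell. *)
have [w [i [sw gw xwi]]] : exists w i, [/\ size w = m, ~~ word12 w & x = pt (w, i)].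
  have [bw|gw] := boolP (word12 w0); last by exists w0, i0.
  have i00 : i0 = 0 by move: nL0; rewrite /onL bw /= negbK => /eqP.
  case/lastP: w0 sw0 x0 bw {nL0} => [/esym e|v k]; first by rewrite e in m0.
  rewrite size_rcons => sv x0 bw; exists (rcons v 0), k; split.
  - by rewrite size_rcons.
  - by rewrite /word12 all_rcons eqxx.
  by have := pt_partner v k 0 0%N; rewrite !cats1 /pt /= => <-; rewrite x0 i00.
have gc : (w, i) \in gcorners m by rewrite mem_gcorners gw sw eqxx.
have [wn|[u [a [n [ai we]]]]] := dec_tail w i.
  left; split.
    left; rewrite xwi wn; have -> : i = 0; last by rewrite /pt /= contrw_nseq.
    by apply/eqP; move: gw; rewrite wn word12_nseq sw negb_or negbK => /andP[].
  rewrite /mult (@count_mem_seq _ _ [:: (w, i)]) ?gcorners_uniq //= => c.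
  rewrite inE; apply/eqP/andP; first by move=> ->; rewrite gc xwi.
  move=> [cg /eqP]; rewrite xwi => e.
  have ss : size c.1 = size (w, i).1.
    by move: cg; rewrite mem_gcorners => /andP[_ /eqP ->].
  have [//|[v [b [b' [k [nb -> /= [e1 e2]]]]]]] := pt_eq ss e.
  have := @dec_tail_nseq v b' b k (size w); rewrite eq_sym => /(_ nb); case.
  by rewrite -e1 {1}wn e2.
set c' : corner := (u ++ i :: nseq n a, a).
have xc' : pt c' = x by rewrite xwi we pt_partner.
have sc' : size c'.1 = m by rewrite -sw we /= !size_cat /= !size_nseq.
have fiber c : size c.1 = m -> pt c = x -> c = (w, i) \/ c = c'.
  move=> sc; rewrite xwi => e.
  have ss : size c.1 = size (w, i).1 by rewrite sc sw.
  have [->|[v [b [b' [k [nb -> /= [e1 e2]]]]]]] := pt_eq ss e; first by left.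
  have nb' : b' != i by rewrite e2 eq_sym.
  right; move: e1; rewrite we -e2 => /(dec_tail_uniq ai nb')[<- <- <-].
  by [].
have cneq : (w, i) != c' by rewrite xpair_eqE negb_and (eq_sym i) ai orbT.
have [bc'|gc'] := boolP (word12 c'.1).
  left; split.
    right; exists c'.1; split => //; rewrite -xc' /pt /=; congr (contrw q _ (q _)).
    move: gw bc'; rewrite we /= !word12_cat /= => gw /andP[bu /andP[bi bn]].
    by move: gw; rewrite bu /= word12_nseq bi orbT andbT negbK => /eqP.
  rewrite /mult (@count_mem_seq _ _ [:: (w, i)]) ?gcorners_uniq //= => c.
  rewrite inE; apply/eqP/andP; first by move=> ->; rewrite gc xwi.
  move=> [cg /eqP e]; have sc : size c.1 = m by move: cg; rewrite mem_gcorners => /andP[_ /eqP].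
  have [//|ec] := fiber c sc e.
  by move: cg; rewrite mem_gcorners ec bc'.
right; split; last first.
  rewrite /mult (@count_mem_seq _ _ [:: (w, i); c']) ?gcorners_uniq //=.
    by rewrite inE cneq.
  move=> c; rewrite !inE; apply/orP/andP.
    move=> [/eqP ->|/eqP ->]; first by rewrite gc xwi.
    by rewrite xc' mem_gcorners gc' sc' !eqxx.
  move=> [cg /eqP e]; have sc : size c.1 = m by move: cg; rewrite mem_gcorners => /andP[_ /eqP].
  by have [->|->] := fiber c sc e; rewrite eqxx; [left|right].
move=> [xq|[w1 [sw1 bw1 xw1]]].
  have [|||] := fiber (nseq m 0, 0); rewrite /= ?size_nseq //.
  - by rewrite /pt /= contrw_nseq.
  - by move=> [e1 e2]; apply: (@dec_tail_nseq u a i n m ai); rewrite -we -e1 e2.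
  - move=> [e1 e2]; apply: (@dec_tail_nseq u i a n m); first by rewrite eq_sym.
    by rewrite -e1 e2.
have [||e|e] := fiber (w1, 0) => //.
  by move: gw; case: e => <- _; rewrite bw1.
by move: gc'; rewrite -e /= bw1.
Qed.

Lemma bd_VOmega m x : bdOmega q m x -> VOmega q m x.
Proof.
move=> [->|[w [sw bw ->]]]; apply/(VOmegaP hq).
  by exists (nseq m 0), 0; rewrite size_nseq contrw_nseq // /onL eqxx andbF.
by exists w, 0; rewrite /onL eqxx andbF.
Qed.

(** By [mult_eq] both cases of the Neumann equation are one condition on the sum over the names of
    x. *)
Lemma neumannP m l u : (0 < m)%N -> neumann_eigenfunction q m l u <->
  (exists2 x, VOmega q m x & u x != 0) /\
  (forall x, VOmega q m x -> \sum_(c <- gcorners m | pt c == x) (flux q u c - l / 2 * u (pt c)) = 0).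
Proof.
move=> m0.
have key x : \sum_(c <- gcorners m | pt c == x) (flux q u c - l / 2 * u (pt c)) =
    lapl q m u x - l / 2 * (mult m x)%:R * u x.
  rewrite sumrB -(laplE hq); congr (_ - _).
  rewrite (eq_bigr (fun _ => l / 2 * u x)) => [|c /eqP ->//].
  by rewrite big_const_seq iter_addr addr0 -/(mult m x) -(mulr_natr (_ * _)) [RHS]mulrAC.
split.
  move=> [nz h1 h2]; split => // x vx; rewrite key.
  have [[bx ->]|[bx ->]] := mult_eq m0 vx.
    by have := h2 x bx => e; rewrite mulr1; lra.
  by rewrite h1 //; lra.
move=> [nz H]; split => //.
  move=> x vx nbx; have := H x vx; rewrite key.
  by have [[//]|[_ ->]] := mult_eq m0 vx; lra.
move=> x bx; have vx := bd_VOmega bx; have := H x vx; rewrite key.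
have [[_ ->]|[nb _]] := mult_eq m0 vx; last by [].
by rewrite mulr1; lra.
Qed.

(** Green's formula with an arbitrary v: the limit form is tested with functions that have no
    symmetry. *)
Lemma neumann_weak m l u v : (0 < m)%N -> neumann_eigenfunction q m l u ->
  EE q m u v = l * MP q m u v.
Proof.
move=> m0 /(neumannP _ _ m0)[_ H].
rewrite EE_flux /MP mulrA mulr_sumr.
apply/eqP; rewrite -subr_eq0 -sumrB; apply/eqP.
rewrite (eq_bigr (fun c => (flux q u c - l / 2 * u (pt c)) * v (pt c))); last by move=> c _; ring.
rewrite (big_fiber _ pt) big1_seq // => x /andP[_]; rewrite mem_undup => /mapP[c cg xc].
rewrite (eq_bigr (fun c => (flux q u c - l / 2 * u (pt c)) * v x)) => [|d /eqP ->//].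
rewrite -mulr_suml H ?mul0r //; apply/(VOmegaP hq).
move: cg; rewrite mem_gcorners => /andP[gc /eqP sc].
by exists c.1, c.2; split => //; apply: onL_good.
Qed.

End Mult.

(** * Reflections on corners and symmetric test functions *)

Section Symm.
Context {R : realType}.
Variable q : 'I_3 -> plane R.
Hypothesis hq : equilateral q.
Local Notation pt := (@pt R q).

(** Vanishing off V_m^Omega leaves finitely many free values, so that the mass form is definite. On
    corners, symmetry is a substitution of letters. *)
Definition symf m (u : plane R -> R) : Prop :=
  (forall x, ~ VOmega q m x -> u x = 0) /\
  forall w v i, word12 w -> size (w ++ v) = m -> ~~ onL (w ++ v) i ->
    u (pt (w ++ map swap12 v, swap12 i)) = u (pt (w ++ v, i)).

(** R_w lifted to corners and extended by the identity outside the cell w. *)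
Definition rho (w : seq 'I_3) (c : corner) : corner :=
  if prefix w c.1 then (w ++ map swap12 (drop (size w) c.1), swap12 c.2) else c.

Lemma rho_cat w v i : rho w (w ++ v, i) = (w ++ map swap12 v, swap12 i).
Proof. by rewrite /rho /= prefix_prefix drop_size_cat. Qed.

Lemma rhoK w : involutive (rho w).
Proof.
move=> [w1 i]; have [/prefixP[v ->]|h] := boolP (prefix w w1).
  by rewrite !rho_cat swap12K -map_comp (eq_map (g := id)) ?map_id // => k /=; rewrite swap12K.
by rewrite /rho /= (negPf h) /= (negPf h).
Qed.

Lemma word12_swap v : word12 (map swap12 v) = word12 v.
Proof. by rewrite /word12 all_map; apply: eq_all => k /=; rewrite swap12_eq0. Qed.

Lemma onL_swap w v i : onL (w ++ map swap12 v) (swap12 i) = onL (w ++ v) i.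
Proof. by rewrite /onL !word12_cat word12_swap swap12_eq0. Qed.

Lemma rho_gcorners m w c : (rho w c \in gcorners m) = (c \in gcorners m).
Proof.
rewrite !mem_gcorners; case: c => w1 i.
have [/prefixP[v ->]|h] := boolP (prefix w w1); last by rewrite /rho /= (negPf h).
by rewrite rho_cat /= !word12_cat word12_swap !size_cat size_map.
Qed.

Lemma rho_perm m w : perm_eq (map (rho w) (gcorners m)) (gcorners m).
Proof.
apply: uniq_perm; [|exact: gcorners_uniq|].
  by rewrite map_inj_uniq ?gcorners_uniq //; apply: can_inj (rhoK w).
move=> c; apply/mapP/idP; first by move=> [d dg ->]; rewrite rho_gcorners.
by move=> cg; exists (rho w c); rewrite ?rho_gcorners // rhoK.
Qed.

Lemma refl_inj : injective (cellrefl q [::]).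
Proof.
move=> x y e; apply: (bary_inj hq) => i.
by rewrite -(swap12K i) -!(bary_refl hq) e.
Qed.

Lemma refl_tri x : tri q x -> tri q (cellrefl q [::] x).
Proof. by move=> tx i; rewrite (bary_refl hq). Qed.

Lemma pt_rho w v i : pt (w ++ map swap12 v, swap12 i) = cellrefl q w (pt (w ++ v, i)).
Proof. by rewrite /pt /= (cellrefl_cat hq) (refl_q hq). Qed.

Lemma cellrefl_ref w : cellrefl q w (ref q w) = ref q w.
Proof. by have := pt_rho w [::] 0; rewrite swap12E cats0. Qed.

Lemma pt_onL c : segL q (pt c) <-> onL c.1 c.2.
Proof. by case: c => w i; exact: segL_contrw. Qed.

(** F_w q_1 and F_w q_2 lie on L, so a vertex of Omega_m in the cell w either is the fixed point F_w
    q_0 of R_w or has all its names inside w. Extending R_w by the identity is therefore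
    consistent. *)
Lemma prefix_rep w c y : word12 w -> tri q y -> pt c = contrw q w y ->
  ~~ onL c.1 c.2 -> prefix w c.1 \/ pt c = ref q w.
Proof.
move=> bw ty e nL.
have corner_case a : y = q a -> pt c = ref q w.
  move=> ya; suff -> : pt c = pt (w, a).
    congr pt; congr pair; apply/eqP; apply: contrapT => /negP a0.
    by move/negP: nL; apply; apply/pt_onL; rewrite e ya; apply/(segL_contrw hq); rewrite /onL bw.
  by rewrite e ya.
case: c e nL corner_case => w1 i; rewrite /pt /= => e nL corner_case.
have [le|lt] := leqP (size w) (size w1).
  rewrite -(cat_take_drop (size w) w1) contrw_cat in e.
  have ss : size (take (size w) w1) = size w by rewrite size_take_min (minn_idPl le).
  have [[<- _]|[u [a [a' [n [_ _ _ _ ya]]]]]] :=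
    contrw_meet hq ss (tri_contrw hq _ (tri_q hq i)) ty e; last by right; exact: corner_case ya.
  by left; rewrite prefix_take.
right; rewrite -(cat_take_drop (size w1) w) contrw_cat in e.
have ss : size w1 = size (take (size w1) w) by rewrite size_take_min (minn_idPl (ltnW lt)).
have t := tri_contrw hq (drop (size w1) w) ty.
have [[_ /esym h]|[u [a [a' [n [_ _ _ _ h]]]]]] := contrw_meet hq ss (tri_q hq i) t e.
  by have [_ ya] := contrw_eq_q hq ty h; exact: corner_case ya.
by have [_ ya] := contrw_eq_q hq ty h; exact: corner_case ya.
Qed.

Lemma symf_geom m SG u : is_attractor q SG -> symf m u -> forall w, word12 w ->
  forall x, (contrw q w @` SG) x -> VOmega q m x -> u (cellrefl q w x) = u x.
Proof.
move=> hSG [_ H] w bw _ [y sy <-] /(VOmegaP hq)[w1 [i [sw1 e nL]]].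
have [|e'] := prefix_rep (c := (w1, i)) bw (SG_tri hq hSG sy) (esym e) nL.
  move=> /= /prefixP[v w1v]; rewrite e w1v -/(pt (w ++ v, i)) -pt_rho.
  by apply: H => //; rewrite -w1v.
by rewrite e -[contrw _ _ _]/(pt (w1, i)) e' cellrefl_ref.
Qed.

Lemma geom_symf m SG u : is_attractor q SG ->
  (forall w, word12 w -> forall x, (contrw q w @` SG) x -> VOmega q m x -> u (cellrefl q w x) = u x) ->
  symf m (fun x => if `[< VOmega q m x >] then u x else 0).
Proof.
move=> hSG H; split => [x /asboolPn/negPf -> //|w v i bw sv nL].
have vx : VOmega q m (pt (w ++ v, i)) by apply/(VOmegaP hq); exists (w ++ v), i.
have vx' : VOmega q m (pt (w ++ map swap12 v, swap12 i)).
  apply/(VOmegaP hq); exists (w ++ map swap12 v), (swap12 i).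
  by rewrite onL_swap nL -sv !size_cat size_map.
rewrite (asboolT vx) (asboolT vx') pt_rho; apply: H => //.
exact: cell_point.
Qed.

Section FluxSum.
Variables (m : nat) (l : R) (u : plane R -> R).
Hypothesis su : symf m u.

Definition residual (c : corner) : R := flux q u c - l / 2 * u (pt c).

Definition Lres (x : plane R) : R :=
  if `[< VOmega q m x >] then \sum_(c <- gcorners m | pt c == x) residual c else 0.

Lemma residual_rho w v i : word12 w -> size (w ++ v) = m -> ~~ word12 (w ++ v) ->
  residual (w ++ map swap12 v, swap12 i) = residual (w ++ v, i).
Proof.
move=> bw sv gw; have H j : u (pt (w ++ map swap12 v, swap12 j)) = u (pt (w ++ v, j)).
  by case: su => _; apply => //; apply: onL_good.
rewrite /residual /flux H; congr (_ - _).
rewrite (reindex_inj (inv_inj swap12K)) /=.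
by apply: eq_bigr => j _; rewrite H.
Qed.

(** [rho w] permutes the good corners. For x in the cell w, away from the fixed point F_w q_0, it
    carries the names of x to those of its mirror image. *)
Lemma Lres_symf : symf m Lres.
Proof.
split => [x /asboolPn/negPf h|w v i bw sv nL]; first by rewrite /Lres h.
set x := pt (w ++ v, i); set x' := pt _.
have x'E : x' = cellrefl q w x by rewrite /x' pt_rho.
have [xr|/eqP nxr] := eqVneq x (ref q w); first by rewrite x'E xr cellrefl_ref.
have vx : VOmega q m x by apply/(VOmegaP hq); exists (w ++ v), i.
have vx' : VOmega q m x'.
  apply/(VOmegaP hq); exists (w ++ map swap12 v), (swap12 i).
  by rewrite onL_swap nL -sv !size_cat size_map.
have [y ty xy] : exists2 y, tri q y & x = contrw q w y.
  by exists (contrw q v (q i)); [apply: tri_contrw => //; apply: tri_q|rewrite /x /pt contrw_cat].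
have x'y : x' = contrw q w (cellrefl q [::] y) by rewrite x'E xy (cellrefl_contrw hq).
have nxr' : x' <> ref q w.
  rewrite x'y => e; apply: nxr; rewrite xy.
  have : cellrefl q [::] y = q 0 by apply: (contrw_inj hq e).
  have /= := refl_q hq 0; rewrite swap12E => {1}<- /refl_inj ->.
  by [].
rewrite /Lres (asboolT vx) (asboolT vx') -(perm_big _ (rho_perm m w)) /= big_map.
rewrite big_seq_cond [RHS]big_seq_cond.
have cond c : (c \in gcorners m) && (pt (rho w c) == x') = (c \in gcorners m) && (pt c == x).
  case cg: (c \in gcorners m) => //=; have [gc _] : ~~ word12 c.1 /\ True.
    by move: cg; rewrite mem_gcorners => /andP[].
  have nLc j : ~~ onL c.1 j := onL_good j gc.
  have [/prefixP[v1 e]|np] := boolP (prefix w c.1).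
    case: c e {cg gc nLc} => w1 j /= ->; rewrite rho_cat pt_rho.
    apply/eqP/eqP; last by move=> ->.
    rewrite x'E xy (cellrefl_contrw hq) /pt /= contrw_cat (cellrefl_contrw hq).
    by move=> /(contrw_inj hq)/refl_inj ->.
  have -> : rho w c = c by rewrite /rho (negPf np).
  have -> : (pt c == x') = false.
    apply/eqP => e; rewrite -e in nxr'; rewrite x'y in e.
    by have [h|//] := prefix_rep bw (refl_tri ty) e (nLc _); rewrite h in np.
  apply/esym/eqP => e; rewrite -e in nxr; rewrite xy in e.
  by have [h|//] := prefix_rep bw ty e (nLc _); rewrite h in np.
rewrite (eq_bigl _ _ cond); apply: eq_bigr => c /andP[cg /eqP cx].
have gc : ~~ word12 c.1 by move: cg; rewrite mem_gcorners => /andP[].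
have [/prefixP[v1 e]|np] := boolP (prefix w c.1); last first.
  by rewrite /rho (negPf np).
have sc : size c.1 = m by move: cg; rewrite mem_gcorners => /andP[_ /eqP].
case: c e gc sc {cg cx} => w1 j /= -> gc sc; rewrite rho_cat.
exact: residual_rho.
Qed.

End FluxSum.

(** Symmetric test functions suffice: the residual of a symmetric u is symmetric, and testing with
    it makes a sum of squares vanish. *)
Lemma weak_neumann m l u : (0 < m)%N -> symf m u -> (exists x, u x != 0) ->
  (forall v, symf m v -> EE q m u v = l * MP q m u v) ->
  neumann_eigenfunction q m l u.
Proof.
move=> m0 su [x0 nz] H; apply/(neumannP hq _ _ m0); split.
  exists x0 => //; apply: contrapT => nv; move/eqP: nz; apply.
  by case: su => h _; apply: h.
have := H _ (Lres_symf l su).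
rewrite EE_flux /MP mulrA mulr_sumr => /eqP.
rewrite -subr_eq0 -sumrB => /eqP.
rewrite (eq_bigr (fun c => residual l u c * Lres m l u (pt c))); last by move=> c _; rewrite /residual; ring.
rewrite (big_fiber _ pt) => e x vx.
have [c0 c0g c0x] : exists2 c, c \in gcorners m & pt c = x.
  apply: contrapT => h; have [[_ e1]|[_ e1]] := mult_eq hq m0 vx; move: e1; rewrite /mult;
  by (rewrite (_ : count _ _ = 0%N) //; apply/eqP; rewrite -leqn0 leqNgt -has_count;
  apply/hasPn => c cg; apply/negP => /eqP cx; apply: h; exists c).
have key y : \sum_(c <- gcorners m | pt c == y) residual l u c * Lres m l u (pt c) =
   (\sum_(c <- gcorners m | pt c == y) residual l u c) * Lres m l u y.
  by rewrite mulr_suml; apply: eq_bigr => c /eqP ->.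
move: e; rewrite (eq_bigr _ (fun y _ => key y)) => e.
have nn y : 0 <= (\sum_(c <- gcorners m | pt c == y) residual l u c) * Lres m l u y.
  by rewrite /Lres; case: ifP => _; rewrite ?mulr0 // -expr2 sqr_ge0.
move/eqP: e; rewrite psumr_eq0 => [/allP|//] => /(_ x).
rewrite mem_undup -{1}c0x map_f // => /(_ isT) /=.
by rewrite /Lres (asboolT vx) mulf_eq0 orbb => /eqP.
Qed.

Lemma PNm_weak SG m l : (0 < m)%N -> is_attractor q SG -> PNm q SG m l <->
  exists u, [/\ symf m u, exists x, u x != 0 &
    forall v, symf m v -> EE q m u v = l * MP q m u v].
Proof.
move=> m0 hSG; split.
  move=> [u [nu Hu]]; pose u' x := if `[< VOmega q m x >] then u x else 0.
  have uu' c : c \in gcorners m -> u' (pt c) = u (pt c).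
    rewrite mem_gcorners => /andP[gc /eqP sc]; rewrite /u' asboolT //.
    by apply/(VOmegaP hq); exists c.1, c.2; split => //; apply: onL_good.
  exists u'; split.
  - exact: geom_symf hSG Hu.
  - by case: nu => -[x vx nz] _ _; exists x; rewrite /u' asboolT.
  move=> v _.
  have -> : EE q m u' v = EE q m u v.
    rewrite /EE big_seq [RHS]big_seq; apply: eq_bigr => w wg; apply: eq_bigr => ij _.
    by rewrite !uu' // mem_gcorners -mem_gwords.
  have -> : MP q m u' v = MP q m u v.
    rewrite /MP; congr (_ * _); rewrite big_seq [RHS]big_seq; apply: eq_bigr => c cg.
    by rewrite uu'.
  exact: neumann_weak.
move=> [u [su nz H]]; exists u; split; first exact: weak_neumann.
exact: symf_geom.
Qed.

End Symm.

(** * Eigenvectors of finite quadratic forms *)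

Section Ultra.
Context {R : realType} (G : set_system nat).
Hypothesis UG : UltraFilter G.
Local Instance G_proper : ProperFilter G := @ultra_proper _ _ UG.

(** A cluster point in a compact interval is a limit along an ultrafilter. One ultrafilter serves
    all points of the plane at once and replaces diagonal extraction. *)
Lemma ultra_bounded_cvg (a : nat -> R) (C : R) :
  (\forall n \near G, `|a n| <= C) -> exists l : R, a n @[n --> G] --> l.
Proof.
move=> H; have cK := @segment_compact R (- C) C.
have [|x [_ clx]] := cK (a n @[n --> G]) _.
  by apply: filterS H => n; rewrite /= in_itv /= ler_norml.
exists x => U nU.
have [//|nG] := @in_ultra_setVsetC _ G (a @^-1` U) UG.
have [y [ny Uy]] := clx (~` U) U nG nU.
by case: ny.
Qed.

Lemma cvg_bigsum (F : set_system nat) (FF : Filter F) (I : Type) (s : seq I)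
    (a : nat -> I -> R) (l : I -> R) :
  (forall i, a n i @[n --> F] --> l i) ->
  \sum_(i <- s) a n i @[n --> F] --> \sum_(i <- s) l i.
Proof.
move=> H; elim: s => [|i s IH].
  rewrite big_nil (_ : (fun n => _) = fun _ => 0); first exact: cvg_cst.
  by apply/funext => n; rewrite big_nil.
rewrite big_cons (_ : (fun n => _) = fun n => a n i + \sum_(j <- s) a n j); first exact: cvgD.
by apply/funext => n; rewrite big_cons.
Qed.
End Ultra.

Section LinAlg.
Context {R : realType} {X : eqType} (T : seq X) (Ed : seq (X * X)).
Context (G : set_system nat) (UG : UltraFilter G) (Goo : \oo `<=` G).
Local Existing Instance G_proper.

Definition Mf (u v : X -> R) : R := 2^-1 * \sum_(x <- T) u x * v x.
Definition Ef (u v : X -> R) : R := \sum_(e <- Ed) (u e.1 - u e.2) * (v e.1 - v e.2).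

Lemma Mf_sym u v : Mf u v = Mf v u.
Proof. by congr (_ * _); apply: eq_bigr => x _; rewrite mulrC. Qed.

Lemma Ef_sym u v : Ef u v = Ef v u.
Proof. by apply: eq_bigr => x _; rewrite mulrC. Qed.

Lemma Mf_linl u u' v c : Mf (fun x => u x + c * u' x) v = Mf u v + c * Mf u' v.
Proof.
rewrite /Mf [c * _]mulrCA -mulrDr; congr (_ * _); rewrite mulr_sumr -big_split /=.
by apply: eq_bigr => x _; ring.
Qed.

Lemma Ef_linl u u' v c : Ef (fun x => u x + c * u' x) v = Ef u v + c * Ef u' v.
Proof. by rewrite /Ef mulr_sumr -big_split /=; apply: eq_bigr => x _; ring. Qed.

Lemma Mf_linr u u' v c : Mf v (fun x => u x + c * u' x) = Mf v u + c * Mf v u'.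
Proof. by rewrite Mf_sym Mf_linl !(Mf_sym v). Qed.

Lemma Ef_linr u u' v c : Ef v (fun x => u x + c * u' x) = Ef v u + c * Ef v u'.
Proof. by rewrite Ef_sym Ef_linl !(Ef_sym v). Qed.

Lemma Mf_ge0 u : 0 <= Mf u u.
Proof. by rewrite /Mf mulr_ge0 // sumr_ge0 // => x _; rewrite -expr2 sqr_ge0. Qed.

Lemma Ef_ge0 u : 0 <= Ef u u.
Proof. by rewrite /Ef sumr_ge0 // => x _; rewrite -expr2 sqr_ge0. Qed.

Lemma Mf_point u x : x \in T -> u x ^+ 2 <= 2 * Mf u u.
Proof.
move=> xT; rewrite /Mf mulrA divff ?mul1r // (big_rem x) //= -expr2 lerDl.
by apply: sumr_ge0 => y _; rewrite -expr2 sqr_ge0.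
Qed.

Lemma Mf_cvg (u v : nat -> X -> R) u' v' : (forall x, u n x @[n --> G] --> u' x) ->
  (forall x, v n x @[n --> G] --> v' x) -> Mf (u n) (v n) @[n --> G] --> Mf u' v'.
Proof.
move=> hu hv; apply: cvgM; first exact: cvg_cst.
by apply: cvg_bigsum => x; apply: cvgM.
Qed.

Lemma Ef_cvg (u v : nat -> X -> R) u' v' : (forall x, u n x @[n --> G] --> u' x) ->
  (forall x, v n x @[n --> G] --> v' x) -> Ef (u n) (v n) @[n --> G] --> Ef u' v'.
Proof.
by move=> hu hv; apply: cvg_bigsum => e; apply: cvgM; apply: cvgB.
Qed.

(** The support clause makes [Mf] definite on S although X may be infinite; closure under limits
    along G replaces finite dimension in the compactness argument. *)
Definition closed_subspace (S : (X -> R) -> Prop) : Prop :=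
  [/\ forall u x, S u -> x \notin T -> u x = 0,
     S (fun=> 0),
     forall u v c, S u -> S v -> S (fun x => u x + c * v x) &
     forall u v, (forall n, S (u n)) -> (forall x, u n x @[n --> G] --> v x) -> S v].

Lemma Mf_eq0 S u : closed_subspace S -> S u -> Mf u u = 0 -> forall x, u x = 0.
Proof.
move=> [h _ _ _] su M0 x; have [xT|] := boolP (x \in T); last exact: h.
have := Mf_point u xT; rewrite M0 mulr0 => h2.
by apply/eqP; rewrite -sqrf_eq0 eq_le h2 sqr_ge0.
Qed.

Lemma closed_scale S c u : closed_subspace S -> S u -> S (fun x => c * u x).
Proof.
move=> [_ h0 h _] su; have := h _ _ c h0 su.
by under eq_fun do rewrite add0r.
Qed.

Lemma Mf0l v : Mf (fun=> 0) v = 0.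
Proof. by rewrite /Mf big1 ?mulr0 // => x _; rewrite mul0r. Qed.

Lemma Ef0l v : Ef (fun=> 0) v = 0.
Proof. by rewrite /Ef big1 // => x _; rewrite subrr mul0r. Qed.

Lemma Mf_scale c u v : Mf (fun x => c * u x) v = c * Mf u v.
Proof.
have := Mf_linl (fun=> 0) u v c; rewrite Mf0l add0r => <-.
by congr (Mf _ v); apply/funext => x; rewrite add0r.
Qed.

Lemma Ef_scale c u v : Ef (fun x => c * u x) v = c * Ef u v.
Proof.
have := Ef_linl (fun=> 0) u v c; rewrite Ef0l add0r => <-.
by congr (Ef _ v); apply/funext => x; rewrite add0r.
Qed.

(* The minimiser of the Rayleigh quotient over [S] is an eigenvector. *)
Lemma min_eigen S u0 x0 : closed_subspace S -> S u0 -> u0 x0 != 0 ->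
  exists e p, [/\ S e, Mf e e = 1 & forall v, S v -> Ef e v = p * Mf e v].
Proof.
have aux (a b c d f g t : R) : g * (1 + t * c + t * (c + t * f)) <= a + t * b + t * (b + t * d) ->
    a <= g -> 0 <= 2 * t * (b - g * c) + t ^+ 2 * (d - g * f) by move=> *; lra.
move=> cS su0 nz; have [supp _ lin clo] := cS.
have M0 u x : S u -> u x != 0 -> 0 < Mf u u.
  move=> su ux; rewrite lt_neqAle Mf_ge0 andbT eq_sym; apply/eqP => h.
  by move: ux; rewrite (Mf_eq0 cS su h) eqxx.
pose Q := [set r | exists u, [/\ S u, Mf u u = 1 & r = Ef u u]].
have Qne : Q !=set0.
  pose c := (Num.sqrt (Mf u0 u0))^-1.
  exists (Ef (fun x => c * u0 x) (fun x => c * u0 x)).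
  exists (fun x => c * u0 x); split => //; first exact: closed_scale.
  rewrite Mf_scale Mf_sym Mf_scale mulrA -expr2 /c exprVn sqr_sqrtr ?Mf_ge0 //.
  by rewrite mulVf // gt_eqF // (M0 _ x0).
have Qlb : has_lbound Q by exists 0 => _ [u [_ _ ->]]; apply: Ef_ge0.
have Qinf : has_inf Q by split.
pose p := inf Q.
have /choice[u Hu] : forall n : nat, exists u, [/\ S u, Mf u u = 1 & Ef u u < p + n.+1%:R^-1].
  move=> n; have e0 : 0 < n.+1%:R^-1 :> R by rewrite invr_gt0 ltr0Sn.
  have [_ [u [su Mu ->]] lt] := inf_adherent e0 Qinf.
  by exists u.
have /choice[e He] : forall x, exists l : R, u n x @[n --> G] --> l.
  move=> x; apply: (@ultra_bounded_cvg _ _ UG _ 2); apply: nearW => n.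
  have [su Mu _] := Hu n.
  have [xT|xT] := boolP (x \in T); last by rewrite supp // normr0.
  have := Mf_point (u n) xT; rewrite Mu mulr1 => h.
  rewrite -(@ler_pXn2r _ 2) ?nnegrE // real_normK ?num_real //.
  by apply: le_trans h _; rewrite expr2; lra.
have Se : S e by apply: (clo u) => // n; have [] := Hu n.
have Me : Mf e e = 1.
  have h := Mf_cvg He He; apply: (cvg_unique _ h) => //.
  rewrite (_ : (fun n => _) = fun _ => 1); first exact: cvg_cst.
  by apply/funext => n; have [] := Hu n.
have Ee : Ef e e <= p.
  have h1 : p + n.+1%:R^-1 @[n --> G] --> p.
    rewrite -[X in _ --> X]addr0; apply: cvgD; first exact: cvg_cst.
    by apply: cvg_trans (@cvg_harmonic R); apply: cvg_app.
  apply: ler_cvg_to (Ef_cvg He He) h1 _.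
  by apply: nearW => n; have [_ _ /ltW] := Hu n.
have low v : S v -> p * Mf v v <= Ef v v.
  move=> sv; have [M00|Mn0] := eqVneq (Mf v v) 0; first by rewrite M00 mulr0 Ef_ge0.
  have M1 : 0 < Mf v v by rewrite lt_neqAle eq_sym Mn0 Mf_ge0.
  pose c := (Num.sqrt (Mf v v))^-1.
  have c2 : c ^+ 2 = (Mf v v)^-1 by rewrite /c exprVn sqr_sqrtr ?Mf_ge0.
  have : p <= Ef (fun x => c * v x) (fun x => c * v x).
    apply: inf_lbound => //; exists (fun x => c * v x); split => //; first exact: closed_scale.
    by rewrite Mf_scale Mf_sym Mf_scale mulrA -expr2 c2 mulVf.
  by rewrite Ef_scale Ef_sym Ef_scale mulrA -expr2 c2 mulrC ler_pdivlMr.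
exists e, p; split => // v sv.
have q1 t : 0 <= 2 * t * (Ef e v - p * Mf e v) + t ^+ 2 * (Ef v v - p * Mf v v).
  have := low _ (lin _ _ t Se sv).
  rewrite Mf_linl !Mf_linr Ef_linl !Ef_linr Me (Mf_sym v e) (Ef_sym v e).
  by move=> h; apply: aux h Ee.
have k0 : 0 <= Ef v v - p * Mf v v by rewrite subr_ge0 low.
apply/eqP; rewrite -subr_eq0; move: k0 q1.
move: (Ef v v - _) (Ef e v - _) => k b k0 q1; apply/eqP.
(* The quadratic 2 t b + t^2 k is minimal at t = - b / k. Dividing by k + 1 instead covers k = 0 and
   still gives a negative value unless b = 0. *)
have := q1 (- b / (k + 1)).
have k1 : 0 < k + 1 by lra.
have -> : 2 * (- b / (k + 1)) * b + (- b / (k + 1)) ^+ 2 * k = - (b ^+ 2 * (k + 2)) / (k + 1) ^+ 2.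
  by field; rewrite gt_eqF.
rewrite pmulr_lge0 ?invr_gt0 ?exprn_gt0 // oppr_ge0 pmulr_lle0; last by lra.
by rewrite le_eqVlt ltNge sqr_ge0 orbF sqrf_eq0 => /eqP.
Qed.

Section Basis.
Variable S : (X -> R) -> Prop.
Hypothesis cS : closed_subspace S.

Definition ortho (r : nat) (e : nat -> X -> R) (p : nat -> R) : Prop :=
  [/\ forall i, (i < r)%N -> S (e i),
     forall i j, (i < r)%N -> (j < r)%N -> Mf (e i) (e j) = (i == j)%:R &
     forall i v, (i < r)%N -> S v -> Ef (e i) v = p i * Mf (e i) v].

Lemma lin_sum r (c : nat -> R) (e : nat -> X -> R) : (forall i, (i < r)%N -> S (e i)) ->
  S (fun x => \sum_(i < r) c i * e i x).
Proof.
have [_ S0 lin _] := cS.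
elim: r => [|r IH] H.
  by under eq_fun do rewrite big_ord0.
under eq_fun do rewrite big_ord_recr /=.
by apply: lin; [apply: IH => i /ltnW ir; exact: H|exact: H].
Qed.

Lemma Mf_sum r (c : nat -> R) (e : nat -> X -> R) v :
  Mf (fun x => \sum_(i < r) c i * e i x) v = \sum_(i < r) c i * Mf (e i) v.
Proof.
elim: r => [|r IH].
  by rewrite big_ord0 -[RHS](Mf0l v); congr Mf; apply/funext => x; rewrite big_ord0.
rewrite big_ord_recr /= -IH -Mf_linl; congr Mf; apply/funext => x.
by rewrite big_ord_recr.
Qed.

Lemma Ef_sum r (c : nat -> R) (e : nat -> X -> R) v :
  Ef (fun x => \sum_(i < r) c i * e i x) v = \sum_(i < r) c i * Ef (e i) v.
Proof.
elim: r => [|r IH].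
  by rewrite big_ord0 -[RHS](Ef0l v); congr Ef; apply/funext => x; rewrite big_ord0.
rewrite big_ord_recr /= -IH -Ef_linl; congr Ef; apply/funext => x.
by rewrite big_ord_recr.
Qed.

Lemma ortho_coef r e p (c : nat -> R) (i : nat) : ortho r e p -> (i < r)%N ->
  \sum_(j < r) c j * Mf (e j) (e i) = c i.
Proof.
move=> [_ h _] ir; rewrite (bigD1 (Ordinal ir)) //= h // eqxx mulr1.
rewrite big1 ?addr0 // => j; rewrite -val_eqE /= => /negPf ji.
by rewrite h // ji mulr0.
Qed.

(* Bessel's inequality for evaluation at [x], summed over [x \in T]. *)
Lemma ortho_bound r e p : ortho r e p -> (r <= size T)%N.
Proof.
move=> oe; have [_ h _] := oe.
have key x : x \in T -> \sum_(i < r) e i x * e i x <= 2.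
  move=> xT; pose g y := \sum_(i < r) e i x * e i y.
  have gg : Mf g g = g x.
    rewrite {1}/g (Mf_sum _ (fun i => e i x)); apply: eq_bigr => i _.
    by rewrite Mf_sym /g (Mf_sum _ (fun i => e i x)) (ortho_coef (fun i => e i x) oe).
  have := Mf_point g xT; rewrite gg -[\sum_(i < r) _]/(g x).
  have : 0 <= g x by rewrite -gg Mf_ge0.
  by nra.
rewrite -(ler_nat R).
have -> : r%:R = \sum_(i < r) Mf (e i) (e i) :> R.
  rewrite (eq_bigr (fun=> 1)) ?sumr_const ?card_ord // => i _.
  by rewrite h // eqxx.
rewrite /Mf -mulr_sumr exchange_big /=.
rewrite mulrC ler_pdivrMr //.
have -> : (size T)%:R * 2 = \sum_(x <- T) 2 :> R.
  by rewrite big_const_seq count_predT iter_addr addr0 mulr_natl.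
by rewrite big_seq [leRHS]big_seq; apply: ler_sum.
Qed.

(** As long as an orthonormal family of eigenvectors does not span S, minimising on its orthogonal
    complement extends it; [ortho_bound] ends this. *)
Lemma eigenbasis : exists r e p, ortho r e p /\
  forall v, S v -> forall x, v x = \sum_(i < r) Mf v (e i) * e i x.
Proof.
apply: contrapT => no.
have step r : exists e p, ortho r e p.
  elim: r => [|r [e [p oe]]]; first by exists (fun _ _ => 0), (fun=> 0).
  have [h1 h2 h3] := oe; have [supp S0 lin clo] := cS.
  have [v [sv [x vx]]] : exists v, S v /\ exists x, v x != \sum_(i < r) Mf v (e i) * e i x.
    apply: contrapT => h; apply: no; exists r, e, p; split => // v sv x.
    by apply/eqP; apply: contrapT => /negP nx; apply: h; exists v; split => //; exists x.
  pose S' u := S u /\ forall i, (i < r)%N -> Mf u (e i) = 0.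
  have cS' : closed_subspace S'.
    split.
    - by move=> u y [su _]; exact: supp.
    - by split => // i _; rewrite Mf0l.
    - move=> u w c [su ou] [sw ow]; split; first exact: lin.
      by move=> i ir; rewrite Mf_linl ou // ow // mulr0 addr0.
    move=> u w H1 H2; split; first by apply: clo H2 => n; have [] := H1 n.
    move=> i ir; have h : Mf (u n) (e i) @[n --> G] --> Mf w (e i).
      by apply: Mf_cvg => // y; exact: cvg_cst.
    apply: (cvg_unique _ h) => //.
    rewrite (_ : (fun n => _) = fun _ => 0); first exact: cvg_cst.
    by apply/funext => n; have [_ ->] := H1 n.
  pose w y := v y + (-1) * \sum_(i < r) Mf v (e i) * e i y.
  have sw : S' w.
    split; first by apply: lin => //; exact: (lin_sum (fun j => Mf v (e j))).
    move=> i ir; rewrite /w Mf_linl (Mf_sum _ (fun j => Mf v (e j))).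
    by rewrite (ortho_coef (fun j => Mf v (e j)) oe) // mulN1r subrr.
  have wx : w x != 0 by rewrite /w mulN1r subr_eq0.
  have [f [a [[sf of_] Mff Ef_]]] := min_eigen cS' sw wx.
  exists (fun i => if i == r then f else e i), (fun i => if i == r then a else p i).
  split.
  - by move=> i; rewrite ltnS leq_eqVlt; case: eqP => //= _; exact: h1.
  - move=> i j; rewrite !ltnS (leq_eqVlt i) (leq_eqVlt j); case: (eqVneq i r) => [->|ni] /=; case: (eqVneq j r) => [->|nj] /=.
    + by rewrite ?eqxx Mff.
    + by move=> _ jr; rewrite of_ // eq_sym (negPf nj).
    + by move=> ir _; rewrite Mf_sym of_ // (negPf ni).
    + exact: h2.
  - move=> i z; rewrite ltnS leq_eqVlt; case: eqP => /= _; last exact: h3.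
    (* So far f is an eigenvector only against S'. Projecting z to S' changes neither form against
       f, because both vanish between f and the earlier e_i. *)
    move=> _ sz; pose z' y := z y + (-1) * \sum_(i < r) Mf z (e i) * e i y.
    have sz' : S' z'.
      split; first by apply: lin => //; exact: (lin_sum (fun j => Mf z (e j))).
      move=> j jr; rewrite /z' Mf_linl (Mf_sum _ (fun j => Mf z (e j))).
      by rewrite (ortho_coef (fun j => Mf z (e j)) oe) // mulN1r subrr.
    have := Ef_ _ sz'; rewrite /z' Ef_linr Mf_linr !mulN1r.
    have -> : Ef f (fun y => \sum_(i < r) Mf z (e i) * e i y) = 0.
      rewrite Ef_sym (Ef_sum _ (fun i => Mf z (e i))) big1 // => j _.
      by rewrite h3 // (Mf_sym (e j)) of_ // !mulr0.
    have -> : Mf f (fun y => \sum_(i < r) Mf z (e i) * e i y) = 0.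
      rewrite Mf_sym (Mf_sum _ (fun i => Mf z (e i))) big1 // => j _.
      by rewrite (Mf_sym (e j)) of_ // mulr0.
    by rewrite !subr0.
have [e [p oe]] := step (size T).+1.
by have := ortho_bound oe; rewrite ltnn.
Qed.
End Basis.
End LinAlg.

Lemma poly_root_between (R : rcfType) (p : {poly R}) (a b : R) : a < b ->
  p.[a] * p.[b] < 0 -> exists x, [/\ a < x, x < b & p.[x] = 0].
Proof.
move=> ab; wlog pa : p / p.[a] < 0.
  move=> H pp; have [pa|pa] := ltP p.[a] 0; first exact: H.
  have [||x [ax xb]] := H (- p); rewrite ?hornerN.
  - by rewrite oppr_lt0 lt_neqAle pa andbT; apply/eqP => h; rewrite -h mul0r ltxx in pp.
  - by rewrite mulrNN.
  by move=> /eqP; rewrite oppr_eq0 => /eqP; exists x.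
rewrite nmulr_rlt0 // => pb.
have [|x /andP[ax xb] /eqP px] := @poly_ivt R p a b (ltW ab); first by rewrite !ltW.
exists x; split => //; rewrite lt_neqAle ?ax ?xb andbT; apply/eqP => e.
  by rewrite e px ltxx in pa.
by rewrite -e px ltxx in pb.
Qed.

(** * Interlacing under a rank-one change of mass *)

Section SecularPoly.
Context {R : rcfType}.
Variables (s : seq R) (L : R -> R) (k0 k : R).
Hypotheses (ss : sorted <%R s) (Lpos : forall b, b \in s -> 0 < L b) (spos : forall b, b \in s -> 0 < b)
  (k00 : 0 < k0) (kpos : 0 < k).

(** The secular equation sum_b x k / (b - x) L_b = k0, multiplied by prod_b (b - x). The polynomial
    can be evaluated at the poles b themselves, where its sign is known. *)
Definition secular : {poly R} :=
  k0 *: \prod_(b <- s) (b%:P - 'X) -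
  k *: 'X * \sum_(b <- s) L b *: \prod_(c <- s | c != b) (c%:P - 'X).

Lemma secularE x : secular.[x] = k0 * \prod_(b <- s) (b - x) -
  k * x * \sum_(b <- s) L b * \prod_(c <- s | c != b) (c - x).
Proof.
rewrite /secular hornerD hornerN hornerM !hornerZ hornerX horner_prod horner_sum.
congr (_ * _ - _ * _); first by apply: eq_bigr => b _; rewrite !hornerE.
apply: eq_bigr => b _; rewrite hornerZ horner_prod; congr (_ * _).
by apply: eq_bigr => c _; rewrite !hornerE.
Qed.

Let us : uniq s := lt_sorted_uniq ss.

Lemma secular_at p : p \in s -> secular.[p] = - (k * p * L p * \prod_(c <- s | c != p) (c - p)).
Proof.
move=> ps; rewrite secularE (bigD1_seq p) //= subrr mul0r mulr0 sub0r; congr (- _).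
rewrite (bigD1_seq p) //= [X in _ + X]big1_seq ?addr0 ?mulrA // => b /andP[bp bs].
rewrite [X in _ * X](_ : _ = 0) ?mulr0 //; apply/eqP; rewrite prodf_seq_eq0.
by apply/hasP; exists p => //=; rewrite eq_sym bp subrr eqxx.
Qed.

Lemma secular_root x : 0 < x -> x \notin s -> secular.[x] = 0 ->
  \sum_(b <- s) x * k / (b - x) * L b = k0.
Proof.
move=> x0 xs; rewrite secularE => /eqP; rewrite subr_eq0 => /eqP e.
have P0 : \prod_(b <- s) (b - x) != 0.
  rewrite prodf_seq_neq0; apply/allP => b bs /=; rewrite subr_eq0.
  by apply: contraNneq xs => <-.
apply: (mulIf P0); rewrite e mulr_suml mulr_sumr.
rewrite big_seq [RHS]big_seq; apply: eq_bigr => b bs.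
rewrite (bigD1_seq b) //=.
have bx : b - x != 0 by rewrite subr_eq0; apply: contraNneq xs => <-.
by move: (\prod_(i <- s | _) _) => Q; field.
Qed.

Lemma secular_between p p' : p \in s -> p' \in s -> p < p' ->
  (forall b, b \in s -> b <= p \/ p' <= b) ->
  exists x, [/\ p < x, x < p' & secular.[x] = 0].
Proof.
move=> ps ps' pp' cons; apply: poly_root_between => //.
rewrite !secular_at // mulrNN.
have split1 a b : a \in s -> b \in s -> a != b ->
   \prod_(c <- s | c != a) (c - a) = (b - a) * \prod_(c <- s | (c != a) && (c != b)) (c - a).
  move=> as_ bs ab; rewrite -big_filter (bigD1_seq b) ?mem_filter ?filter_uniq // ?bs 1?eq_sym ?ab //=.
  by rewrite big_filter_cond.
have npp : p != p' by rewrite lt_eqF.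
rewrite (split1 p p') // (split1 p' p) 1?eq_sym //.
under [X in _ * (_ * (_ * X))]eq_bigl do rewrite andbC.
(* As s has no element strictly between p and p', the factors of A and B have pairwise equal signs;
   the sign change comes from p' - p and p - p' alone. *)
set A := \prod_(c <- s | _) (c - p); set B := \prod_(c <- s | _) (c - p').
have AB : 0 < A * B.
  rewrite /A /B -big_split /= big_seq_cond; apply: prodr_gt0 => c /andP[cs /andP[c1 c2]].
  have [h|h] := cons c cs.
    have h1 : c < p by rewrite lt_neqAle c1 h.
    by rewrite nmulr_rgt0 subr_lt0 // (lt_trans h1 pp').
  have h1 : p' < c by rewrite lt_neqAle eq_sym c2 h.
  by rewrite mulr_gt0 ?subr_gt0 // (lt_trans pp' h1).
have C0 : 0 < (k * p * L p) * (k * p' * L p') * (p' - p) ^+ 2.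
  have h1 := Lpos ps; have h2 := Lpos ps'; have h3 := spos ps; have h4 := spos ps'.
  have h5 : 0 < (p' - p) ^+ 2 by rewrite exprn_gt0 // subr_gt0.
  by move: ((p' - p) ^+ 2) h5 => z h5; rewrite !mulr_gt0.
have -> : k * p * L p * ((p' - p) * A) * (k * p' * L p' * ((p - p') * B)) =
  - ((k * p * L p) * (k * p' * L p') * (p' - p) ^+ 2 * (A * B)) by ring.
by rewrite oppr_lt0 mulr_gt0.
Qed.

Lemma secular_first p' : p' \in s -> (forall b, b \in s -> p' <= b) ->
  exists x, [/\ 0 < x, x < p' & secular.[x] = 0].
Proof.
move=> ps' min; apply: poly_root_between; first exact: spos.
rewrite (secular_at ps') secularE mulr0 mul0r subr0.
have A0 : 0 < \prod_(b <- s) (b - 0).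
  by rewrite big_seq; apply: prodr_gt0 => b bs; rewrite subr0 spos.
have B0 : 0 < \prod_(c <- s | c != p') (c - p').
  rewrite big_seq_cond; apply: prodr_gt0 => b /andP[bs bp].
  by rewrite subr_gt0 lt_neqAle eq_sym bp min.
rewrite pmulr_rlt0; last by rewrite mulr_gt0.
by rewrite oppr_lt0 !mulr_gt0 ?(spos ps') ?(Lpos ps').
Qed.
End SecularPoly.

Section Interlace.
Context {R : realType} {X : eqType} (T : seq X) (Ed : seq (X * X)).
Context (G : set_system nat) (UG : UltraFilter G) (Goo : \oo `<=` G).
Variable S : (X -> R) -> Prop.
Hypothesis cS : closed_subspace T G S.
Variables (x0 : X) (k : R).
Hypothesis k_gt0 : 0 < k.
Local Notation Mf := (Mf T).
Local Notation Ef := (Ef Ed).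

Definition eigP (l : R) (u : X -> R) : Prop :=
  [/\ S u, exists x, u x != 0 & forall v, S v -> Ef u v = l * Mf u v].

Definition eigQ (l : R) (u : X -> R) : Prop :=
  [/\ S u, exists x, u x != 0 & forall v, S v -> Ef u v = l * (Mf u v + k * u x0 * v x0)].

Lemma eigP_ge0 l u : eigP l u -> 0 <= l.
Proof.
move=> [su [x ux] e]; have := e _ su.
have := Ef_ge0 Ed u => + h; rewrite h.
suff M : 0 < Mf u u by rewrite pmulr_lge0.
rewrite lt_neqAle Mf_ge0 andbT eq_sym; apply/eqP => h0.
by move: ux; rewrite (Mf_eq0 cS su h0) eqxx.
Qed.

Lemma eigP_finite : exists s : seq R, forall l u, eigP l u -> l \in s.
Proof.
have [r [e [p [[h1 h2 h3] H]]]] := eigenbasis Ed UG Goo cS.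
exists [seq p i | i <- iota 0 r] => l u [su [x ux] eu].
have [i ir Mi] : exists2 i, (i < r)%N & Mf u (e i) != 0.
  apply: contrapT => no; move/eqP: ux; apply.
  rewrite (H _ su) big1 // => i _; rewrite (_ : Mf u (e i) = 0) ?mul0r //.
  by apply/eqP; apply: contrapT => /negP ni; apply: no; exists i.
have : l = p i.
  have := eu _ (h1 _ ir); rewrite Ef_sym h3 // (Mf_sym _ (e i)) => h.
  exact/esym/(mulIf Mi).
by move=> ->; apply: map_f; rewrite mem_iota.
Qed.

Definition BP (l : R) : Prop := exists2 u, eigP l u & u x0 != 0.
Definition BQ (l : R) : Prop := exists2 u, eigQ l u & u x0 != 0.

(* [x0]-evaluation is [Mf (\sum_b y b)], with [y b] in the eigenspace of [b]. *)
Lemma evaluation_decomposition : exists (s : seq R) (y : R -> X -> R),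
  [/\ sorted <%R s, forall l, l \in s <-> BP l,
     forall b, S (y b) /\ forall v, S v -> Ef (y b) v = b * Mf (y b) v,
     forall v, S v -> v x0 = \sum_(b <- s) Mf (y b) v &
     forall b, b \in s -> 0 < y b x0].
Proof.
have [r [e [p [oe H]]]] := eigenbasis Ed UG Goo cS; have [h1 h2 h3] := oe.
pose c b (i : nat) : R := if p i == b then e i x0 else 0.
pose y b x := \sum_(i < r) c b i * e i x.
have yS b : S (y b) by apply: (lin_sum cS (c b)).
have yE b v : S v -> Ef (y b) v = b * Mf (y b) v.
  move=> sv; rewrite /y (Ef_sum _ _ (c b)) (Mf_sum _ _ (c b)) mulr_sumr; apply: eq_bigr => i _.
  by rewrite h3 // /c; case: eqP => [->|_]; rewrite ?mul0r ?mulr0 // mulrCA.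
have yx0 b : y b x0 = \sum_(i < r | p i == b) e i x0 ^+ 2.
  rewrite /y [RHS]big_mkcond; apply: eq_bigr => i _.
  by rewrite /c; case: eqP; rewrite ?mul0r.
have y_pos b : 0 <= y b x0 by rewrite yx0 sumr_ge0 // => i _; apply: sqr_ge0.
pose s := sort <=%R (undup [seq p i | i <- iota 0 r & y (p i) x0 != 0]).
have ms b : (b \in s) = (y b x0 != 0).
  rewrite mem_sort mem_undup; apply/mapP/idP.
    by move=> [i]; rewrite mem_filter => /andP[yi _] ->.
  move=> yb; suff [i ir pi] : exists2 i, (i < r)%N & p i = b.
    by exists i => //; rewrite mem_filter pi yb mem_iota.
  apply: contrapT => no; move/eqP: yb; apply.
  rewrite yx0 big1 // => i /eqP pib; exfalso; apply: no.
  by exists i.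
have us : uniq s by rewrite sort_uniq undup_uniq.
exists s, y; split => //.
- by rewrite sort_lt_sorted undup_uniq.
- move=> l; rewrite ms; split.
    by move=> yl; exists (y l) => //; split => //; [by exists x0 | by move=> v; exact: yE].
  move=> [u [su _ eu] ux].
  rewrite yx0; apply/negP => /eqP h; move/eqP: ux; apply.
  rewrite (H _ su) big1 // => i _.
  case: (eqVneq (p i) l) => [pl|npl].
    have : e i x0 ^+ 2 = 0.
      apply/eqP; rewrite eq_le sqr_ge0 andbT -h (bigD1 i) /= ?pl ?eqxx // lerDl.
      by apply: sumr_ge0 => j _; apply: sqr_ge0.
    by move/eqP; rewrite sqrf_eq0 => /eqP ->; rewrite mulr0.
  suff -> : Mf u (e i) = 0 by rewrite mul0r.
  have := eu _ (h1 _ (ltn_ord i)); rewrite Ef_sym h3 // (Mf_sym _ (e i)) => /eqP.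
  by rewrite -subr_eq0 -mulrBl mulf_eq0 subr_eq0 (negPf npl) => /eqP.
- by move=> b; split => // v; exact: yE.
- move=> v sv; rewrite (H _ sv x0).
  have yM b : Mf (y b) v = \sum_(i < r) c b i * Mf (e i) v by rewrite /y (Mf_sum T _ (c b)).
  rewrite (eq_bigr _ (fun b _ => yM b)) exchange_big /=; apply: eq_bigr => i _.
  rewrite -mulr_suml Mf_sym mulrC; congr (_ * _).
  have [e0|ne0] := eqVneq (e i x0) 0.
    by rewrite big1 // => b _; rewrite /c e0; case: ifP.
  have pis : p i \in s.
    rewrite ms yx0 (bigD1 i) //=; apply: lt0r_neq0.
    rewrite ltr_wpDr ?sumr_ge0 // => [j _|]; first exact: sqr_ge0.
    by rewrite lt_neqAle sqr_ge0 andbT eq_sym sqrf_eq0.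
  rewrite (bigD1_seq (p i)) //= /c eqxx big1 ?addr0 // => b bp.
  by rewrite eq_sym (negPf bp).
- by move=> b; rewrite ms => yb; rewrite lt_neqAle y_pos andbT eq_sym.
Qed.

(** The new eigenvalues are 0 and one root of the secular polynomial in each interval between
    consecutive elements of s; the strict lower ends keep the list strictly increasing. *)
Lemma interlacing : BP 0 -> exists s t : seq R,
  [/\ sorted <%R s /\ (forall l, l \in s <-> BP l), sorted <%R t, size t = size s,
     forall l, l \in t -> 0 <= l /\ BQ l &
     forall i, (i < size s)%N -> nth 0 t i <= nth 0 s i].
Proof.
move=> B0; have [s [y [ss sB yE ydec ypos]]] := evaluation_decomposition.
have s0 : 0 \in s by apply/sB.
have sge b : b \in s -> 0 <= b by move=> /sB[u eu _]; exact: eigP_ge0 eu.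
case: s ss sB ydec ypos s0 sge => // a s ss sB ydec ypos s0 sge.
have a0 : a = 0.
  move: s0; rewrite inE => /orP[/eqP//|s0].
  have : a < 0 by apply: (allP (order_path_min lt_trans ss)).
  by rewrite ltNge sge ?inE ?eqxx.
subst a.
have spos b : b \in s -> 0 < b by apply: (allP (order_path_min lt_trans ss)).
have ss' : sorted <%R s := path_sorted ss.
have sl : sorted <=%R s by move: ss'; rewrite lt_sorted_uniq_le => /andP[].
have nle : {in [pred n | (n < size s)%N] &, {homo nth 0 s : i j / (i <= j)%N >-> i <= j}} := sorted_leq_nth le_trans lexx 0 sl.
have Lpos b : b \in s -> 0 < y b x0 by move=> bs; apply: ypos; rewrite inE bs orbT.
(* The term of the eigenvalue 0 in the secular equation is the constant - k (y 0 x0); moved to the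
   other side, it leaves only positive poles. *)
pose k0 := 1 + k * y 0 x0.
have k00 : 0 < k0 by rewrite /k0 ltr_wpDr // mulr_ge0 ?ltW // ypos // inE eqxx.
have rootBQ x : 0 < x -> x \notin s -> (secular s (y ^~ x0) k0 k).[x] = 0 -> 0 <= x /\ BQ x.
  move=> x_gt0 xs rx; split; first exact: ltW.
  have eqk := secular_root ss' x_gt0 xs rx.
  (* Normalise u(x0) = 1. The coefficient c of [y b] must satisfy b c = x c + x k, since v(x0) is
     the sum of the [Mf (y b) v]; so c = x k / (b - x). *)
  pose u z := \sum_(b <- 0 :: s) x * k / (b - x) * y b z.
  have xb b : b \in 0 :: s -> b - x != 0.
    rewrite inE => /orP[/eqP ->|bs]; first by rewrite sub0r oppr_eq0 gt_eqF.
    by rewrite subr_eq0; apply: contraNneq xs => <-.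
  have ux0 : u x0 = 1.
    rewrite /u big_cons eqk sub0r /k0.
    by rewrite invrN mulrN mulrAC divff ?gt_eqF // mul1r; ring.
  have uS : S u.
    rewrite /u; elim: (0 :: s) => [|b l IH].
      by under eq_fun do rewrite big_nil; case: cS.
    under eq_fun do rewrite big_cons addrC.
    by have [_ _ lin _] := cS; apply: lin => //; have [] := yE b.
  have uM v : Mf u v = \sum_(b <- 0 :: s) x * k / (b - x) * Mf (y b) v.
    rewrite /u; elim: (0 :: s) => [|b l IH].
      by rewrite big_nil -[RHS](Mf0l T v); congr Mf; apply/funext => z; rewrite big_nil.
    rewrite big_cons addrC -IH -Mf_linl; congr Mf.
    by apply/funext => z; rewrite big_cons addrC.
  have uE v : Ef u v = \sum_(b <- 0 :: s) x * k / (b - x) * Ef (y b) v.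
    rewrite /u; elim: (0 :: s) => [|b l IH].
      by rewrite big_nil -[RHS](Ef0l Ed v); congr Ef; apply/funext => z; rewrite big_nil.
    rewrite big_cons addrC -IH -Ef_linl; congr Ef.
    by apply/funext => z; rewrite big_cons addrC.
  exists u; last by rewrite ux0 oner_eq0.
  split => //; first by exists x0; rewrite ux0 oner_eq0.
  move=> v sv; rewrite ux0 mulr1 (ydec v sv) mulrDr uM uE !mulr_sumr -big_split /=.
  rewrite big_seq [RHS]big_seq; apply: eq_bigr => b bs.
  have [_ ->//] := yE b; have := xb b bs.
  by move: (Mf _ v) => A hb; field.
have tE i : exists t, (i < (size s).+1)%N ->
   [/\ 0 <= t, BQ t, t <= nth 0 (0 :: s) i & (0 < i)%N -> nth 0 (0 :: s) i.-1 < t].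
  case: (ltnP i (size s).+1) => [ii|_]; last by exists 0.
  case: i ii => [|i] ii.
    exists 0 => _; split => //; case: B0 => u [su nz eu] ux; exists u => //; split => // v sv.
    by rewrite eu // !mul0r.
  have sti : nth 0 s i \in s by rewrite mem_nth.
  have cut x : nth 0 (0 :: s) i < x -> x < nth 0 s i -> x \notin s.
    move=> h1 h2; apply/negP => /(nthP 0)[j js jx]; rewrite -jx in h1 h2.
    have [le|lt] := leqP i j.
      move: h2; rewrite ltNge => /negP; apply.
      by apply: nle; rewrite ?inE.
    case: i ii {sti h2} lt h1 => // i ii ji /=; rewrite ltNge => /negP; apply.
    by apply: nle; rewrite ?inE // ltnW.
  suff [x [h1 h2 h3]] : exists x, [/\ nth 0 (0 :: s) i < x, x < nth 0 s i & (secular s (y ^~ x0) k0 k).[x] = 0].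
    have x_gt0 : 0 < x.
      apply: le_lt_trans h1; case: i ii {sti cut h2} => //= i ii.
      by rewrite ltW // spos // mem_nth // ltnW.
    have [hx0 hB] := rootBQ x x_gt0 (cut x h1 h2) h3.
    by exists x => _; split => //; exact: ltW.
  case: i ii sti cut => [|i] ii sti cut.
    apply: secular_first => // b /(nthP 0)[j js <-].
    by apply: nle; rewrite ?inE.
  apply: secular_between => //=.
  - by rewrite mem_nth // ltnW.
  - by rewrite (sorted_ltn_nth lt_trans) ?inE // ltnW.
  - move=> b /(nthP 0)[j js <-]; have [le|lt] := leqP j i.
      by left; apply: nle; rewrite ?inE // ltnW.
    by right; apply: nle; rewrite ?inE.
have /choice[t Ht] := tE.
exists (0 :: s), (mkseq t (size s).+1); split => //.
- rewrite /mkseq; apply/(sortedP 0) => i; rewrite size_map size_iota => ii.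
  rewrite !(nth_map 0%N) ?size_iota ?nth_iota ?add0n //; try exact: ltnW.
  have [_ _ h _] := Ht i (ltnW ii); have [_ _ _ h'] := Ht i.+1 ii.
  by apply: le_lt_trans h _; exact: h'.
- by rewrite size_mkseq.
- move=> l /mapP[i]; rewrite mem_iota add0n => /andP[_ ii] ->.
  by have [] := Ht i ii.
- move=> i ii; rewrite nth_mkseq //.
  by have [] := Ht i ii.
Qed.

End Interlace.

(** * Spectral decimation *)

Section Space.
Context {R : realType}.
Variable q : 'I_3 -> plane R.
Hypothesis hq : equilateral q.
Local Notation pt := (@pt R q).
Local Notation ref := (@ref R q).
Local Notation symf := (@symf R q).

Lemma good_rep m x : (0 < m)%N -> VOmega q m x -> exists2 c, c \in gcorners m & pt c = x.
Proof.
move=> m0 vx; apply: contrapT => h.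
have [[_ e1]|[_ e1]] := mult_eq hq m0 vx; move: e1; rewrite /mult;
  by (rewrite (_ : count _ _ = 0%N) //; apply/eqP; rewrite -leqn0 leqNgt -has_count;
  apply/hasPn => c cg; apply/negP => /eqP cx; apply: h; exists c).
Qed.

Definition pts m : seq (plane R) := map pt (gcorners m).
Definition edges m : seq (plane R * plane R) :=
  [seq (pt (w, ij.1), pt (w, ij.2)) | w <- gwords m,
     ij <- [:: (0, 1); (0, 2); (1, 2)] : seq ('I_3 * 'I_3)].

Lemma MP_Mf m u v : MP q m u v = Mf (pts m) u v.
Proof. by rewrite /MP /Mf big_map. Qed.

Lemma EE_Ef m u v : EE q m u v = Ef (edges m) u v.
Proof. by rewrite /EE /Ef big_allpairs_dep. Qed.

Definition x0 m : plane R := ref (nseq m 1).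

Lemma ref_VOmega m w : size w = m -> VOmega q m (ref w).
Proof. by move=> sw; apply/(VOmegaP hq); exists w, 0; rewrite /onL eqxx andbF. Qed.

Lemma x0_VOmega m : VOmega q m (x0 m).
Proof. by apply: ref_VOmega; rewrite size_nseq. Qed.

Lemma symf_closed m G : (0 < m)%N -> ProperFilter G -> closed_subspace (pts m) G (symf m).
Proof.
move=> m0 FG; split.
- move=> u x [h _] xT; apply: h => /(good_rep m0)[c cg cx].
  by move/negP: xT; apply; rewrite -cx; apply: map_f.
- by split.
- move=> u v c [u1 u2] [v1 v2]; split; first by move=> x nx; rewrite u1 // v1 // mulr0 addr0.
  by move=> w z i bw sw nL; rewrite u2 // v2.
- move=> u v H lim; split.
    move=> x nx; apply: (cvg_unique _ (lim x)) => //.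
    rewrite (_ : (fun n => _) = fun _ => 0); first exact: cvg_cst.
    by apply/funext => n; have [->] := H n.
  move=> w z i bw sw nL; apply: (cvg_unique _ (lim _)) => //.
  rewrite (_ : (fun n => _) = fun n => u n (pt (w ++ z, i))); first exact: lim.
  by apply/funext => n; have [_ ->] := H n.
Qed.

(** Reflecting in the cell 1^n turns 1^n 2 v into 1^(n+1) followed by the mirror of v, so all
    letters become 1 from left to right. *)
Lemma symf_ref m u w : symf m u -> size w = m -> word12 w -> u (ref w) = u (x0 m).
Proof.
move=> [_ H] sw bw.
have key k v n : (size v <= k)%N -> word12 v -> size (nseq n (1 : 'I_3) ++ v) = m ->
    u (pt (nseq n 1 ++ v, 0)) = u (x0 m).
  elim: k v n => [|k IH] [|a v] n //= sv bv; rewrite ?cats0 ?size_nseq.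
  - by move=> ->.
  - by move=> ->.
  case/andP: (bv); case: (I3P a) bv => -> bv // _ bv' sm.
    have -> : nseq n 1 ++ 1 :: v = nseq n.+1 1 ++ v :> seq 'I_3.
      by rewrite nseqSr cat_rcons.
    by apply: IH => //; rewrite nseqSr cat_rcons.
  rewrite -H //=; last 2 first.
  - by rewrite word12_nseq orbT.
  - by rewrite /onL eqxx andbF.
  rewrite !swap12E.
  have -> : nseq n 1 ++ 1 :: map swap12 v = nseq n.+1 1 ++ map swap12 v :> seq 'I_3.
    by rewrite nseqSr cat_rcons.
  apply: IH; rewrite ?size_map ?word12_swap //.
  by rewrite nseqSr cat_rcons size_cat /= size_map -sm size_cat.
by apply: (key (size w) w 0%N).
Qed.

(* Half the number [2 ^ m] of bottom vertices. *)
Definition kap m : R := 2^-1 * (count word12 (words m))%:R.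

Lemma kap_gt0 m : 0 < kap m.
Proof.
rewrite /kap mulr_gt0 ?invr_gt0 // ltr0n -has_count; apply/hasP.
by exists (nseq m 1); rewrite ?mem_words ?size_nseq // word12_nseq orbT.
Qed.

(* Spectral decimation produces this mass: the bottom vertices [F_w q_0], which
   have one good cell instead of two, get the missing weight [1 / 2] back. *)
Definition MQ m u v : R :=
  MP q m u v + 2^-1 * \sum_(w <- words m | word12 w) u (ref w) * v (ref w).

Lemma MQ_symf m u v : symf m u -> symf m v ->
  MQ m u v = MP q m u v + kap m * u (x0 m) * v (x0 m).
Proof.
move=> su sv; rewrite /MQ /kap -!mulrA; congr (_ + _ * _).
rewrite big_seq_cond (eq_bigr (fun=> u (x0 m) * v (x0 m))); last first.
  move=> w /andP[]; rewrite mem_words => /eqP sw bw.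
  by rewrite (symf_ref su) // (symf_ref sv).
by rewrite -big_seq_cond big_const_seq iter_addr addr0 [RHS]mulr_natl.
Qed.

Definition restr m (v : plane R -> R) x : R := if `[< VOmega q m x >] then v x else 0.

Lemma restr_pt m v w i : size w = m -> ~~ onL w i -> restr m v (pt (w, i)) = v (pt (w, i)).
Proof. by move=> sw nL; rewrite /restr asboolT //; apply/(VOmegaP hq); exists w, i. Qed.

Lemma pt_rconsE w i : pt (rcons w i, i) = pt (w, i).
Proof.
rewrite /pt /= contrw_rcons; congr contrw.
by apply: (bary_inj hq) => j; rewrite (bary_contr hq) (bary_q hq); by field.
Qed.

Lemma pt_rconsC w i j : pt (rcons w i, j) = pt (rcons w j, i).
Proof. by have := pt_partner hq w i j 0; rewrite /= !cats1. Qed.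

Lemma VOmegaS m x : VOmega q m x -> VOmega q m.+1 x.
Proof.
move=> /(VOmegaP hq)[w [i [sw -> nL]]]; apply/(VOmegaP hq); exists (rcons w i), i.
split; first by rewrite size_rcons sw.
  exact/esym/pt_rconsE.
by move: nL; rewrite /onL /word12 all_rcons; case: (i != 0); rewrite ?andbF ?andbT.
Qed.

Lemma restr_symf m v : symf m.+1 v -> symf m (restr m v).
Proof.
move=> [h H]; split; first by move=> x nx; rewrite /restr asboolF.
move=> w z i bw sw nL; rewrite !restr_pt ?onL_swap //; last first.
  by rewrite -sw !size_cat size_map.
rewrite -pt_rconsE -[in RHS]pt_rconsE -!cats1 -!catA.
have -> : map swap12 z ++ [:: swap12 i] = map swap12 (z ++ [:: i]) by rewrite map_cat.
apply: H => //; first by rewrite catA size_cat sw addn1.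
move: nL; rewrite /onL catA cats1 /word12 all_rcons -/(word12 _).
by case: (i != 0); rewrite ?andbF ?andbT.
Qed.

Definition cE u v w : R := \sum_(ij <- [:: (0, 1); (0, 2); (1, 2)] : seq ('I_3 * 'I_3))
    ((u (pt (w, ij.1)) - u (pt (w, ij.2))) * (v (pt (w, ij.1)) - v (pt (w, ij.2)))).
Definition cM u v w : R := 2^-1 * \sum_i u (pt (w, i)) * v (pt (w, i)).

Lemma EE_cE m u v : EE q m u v = \sum_(w <- gwords m) cE u v w. Proof. by []. Qed.
Lemma MP_cM m u v : MP q m u v = \sum_(w <- gwords m) cM u v w.
Proof. by rewrite /MP big_gcorners mulr_sumr. Qed.

Lemma big_wordsS m (P : pred (seq 'I_3)) (F : seq 'I_3 -> R) :
  \sum_(w <- words m.+1 | P w) F w = \sum_(w <- words m) \sum_(k | P (rcons w k)) F (rcons w k).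
Proof.
rewrite wordsS big_mkcond big_allpairs_dep; apply: eq_bigr => w _.
by rewrite [RHS]big_mkcond big3 !big_cons big_nil /= addr0 addrA.
Qed.

(** All children of a good cell are good; of the children of a cell touching L, only the top one
    is. *)
Lemma big_gwordsS m (F : seq 'I_3 -> R) :
  \sum_(w <- gwords m.+1) F w = \sum_(w <- gwords m) \sum_k F (rcons w k) +
    \sum_(w <- words m | word12 w) F (rcons w 0).
Proof.
rewrite /gwords !big_filter big_wordsS [X in _ = X + _]big_mkcond [X in _ = _ + X]big_mkcond.
rewrite -big_split /=; apply: eq_bigr => w _.
rewrite big_mkcond /= !big3 /word12 !all_rcons /= -/(word12 w).
by case: (word12 w); rewrite /= ?addr0 ?add0r.
Qed.

(** The difference of the two sides is (a + b + c)^2 for the corner values a, b, c. This is the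
    origin of the bound 6 on eigenvalues. *)
Lemma cEM_le u w : cE u u w <= 6 * cM u u w.
Proof.
rewrite /cE /cM !big_cons !big_nil /= big3.
move: (u _) (u _) (u _) => a b c.
have := sqr_ge0 (a + b + c); lra.
Qed.

Lemma EE_le_MP m u : EE q m u u <= 6 * MP q m u u.
Proof. by rewrite EE_cE MP_cM mulr_sumr; apply: ler_sum => w _; apply: cEM_le. Qed.

Section Ext.
Variables (m : nat) (lam : R).
Hypotheses (l2 : lam != 2) (l5 : lam != 5).
(** The decimation polynomial. The extension has its poles at 2 and 5; [c0] is the factor in
    [decimation] and vanishes at the third exceptional value, 6. *)
Let mu := lam * (5 - lam).
Let c0 := (6 - lam) / ((2 - lam) * (5 - lam)).

(* Spectral decimation on a cell and, for bottom cells, on the two new edges. *)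
Definition extc (u : plane R -> R) (w : seq 'I_3) (k i : 'I_3) : R :=
  if k == i then u (pt (w, i)) else
  if word12 w then (if (k == 0) || (i == 0) then 2 * u (ref w) / (2 - lam) else 0)
  else ((4 - lam) * (u (pt (w, k)) + u (pt (w, i))) + 2 * u (pt (w, - (k + i)))) /
       ((2 - lam) * (5 - lam)).

Lemma extcC u w k i : extc u w k i = extc u w i k.
Proof.
rewrite /extc eq_sym; case: eqVneq => [->//|_].
by rewrite orbC (addrC k) (addrC (u (pt (w, k)))).
Qed.

Lemma I3_pair (k i k' i' : 'I_3) :
  (forall j : 'I_3, ((j == k) + (j == i))%N = ((j == k') + (j == i'))%N) ->
  (k = k' /\ i = i') \/ (k = i' /\ i = k').
Proof.
move=> H; have := H 0; have := H 1; have := H 2; clear H.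
by case: (I3P k) => ->; case: (I3P i) => ->; case: (I3P k') => ->; case: (I3P i') => -> //=;
  auto.
Qed.

(** The names of a new vertex have a common parent cell and differ by exchanging k and i. An old
    vertex may change its parent, but there the value is that of u. *)
Lemma extc_wd u w w' k k' i i' : size w = size w' ->
  pt (rcons w k, i) = pt (rcons w' k', i') -> extc u w k i = extc u w' k' i'.
Proof.
move=> sw; rewrite /pt /= !contrw_rcons => e.
have t j a : tri q (contr q j (q a)) by apply: (tri_contr hq); apply: tri_q.
have [[<- e1]|[z [a [a' [n [_ _ _ e1 e2]]]]]] := contrw_meet hq sw (t _ _) (t _ _) e.
  have [|[<- <-]//|[-> ->]] := @I3_pair k i k' i'; last exact: extcC.
  move=> j; have := congr1 (bary q j) e1; rewrite !(bary_contr hq) !(bary_q hq).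
  move=> /(mulIf _); rewrite invr_eq0 pnatr_eq0 => /(_ isT) /eqP.
  by rewrite -!natrD eqr_nat addnC => /eqP ->; rewrite addnC.
have corner_i k1 i1 a1 : contr q k1 (q i1) = q a1 -> k1 = i1.
  move=> h; have [[->] /(q_inj hq) ->//] := @contrw_eq_q _ q hq [:: k1] (q i1) a1 (tri_q hq _) h.
have ek := corner_i _ _ _ e1; have ek' := corner_i _ _ _ e2; subst k k'.
rewrite /extc !eqxx; congr u.
by rewrite -pt_rconsE -[RHS]pt_rconsE /pt /= !contrw_rcons.
Qed.

Definition ext (u : plane R -> R) (x : plane R) : R :=
  if pselect (exists t : seq 'I_3 * 'I_3 * 'I_3, size t.1.1 = m /\ x = pt (rcons t.1.1 t.1.2, t.2))
  is left H then let t := sval (cid H) in extc u t.1.1 t.1.2 t.2 else 0.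

Lemma ext_pt u w k i : size w = m -> ext u (pt (rcons w k, i)) = extc u w k i.
Proof.
move=> sw; rewrite /ext; case: pselect => [H|nH]; last by case: nH; exists (w, k, i).
case: cid => -[[w' k'] i'] /= [sw' e].
by apply: extc_wd; rewrite ?sw ?sw'.
Qed.

Lemma ext_corner u w i : size w = m -> ext u (pt (w, i)) = u (pt (w, i)).
Proof. by move=> sw; rewrite -[in LHS]pt_rconsE ext_pt // /extc eqxx. Qed.

Lemma ext_symf u : symf m u -> symf m.+1 (ext u).
Proof.
move=> [h H].
have uL w i : onL w i -> u (pt (w, i)) = 0.
  move=> oL; apply: h => -[_]; apply; exact/(segL_contrw hq).
split.
  move=> x nv; rewrite /ext; case: pselect => // Ht; case: cid => -[[w k] i] /= [sw e].
  have oL : onL (rcons w k) i.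
    apply: contrapT => /negP oL; apply: nv; apply/(VOmegaP hq).
    by exists (rcons w k), i; rewrite size_rcons sw.
  move: oL; rewrite /onL /word12 all_rcons => /andP[/andP[k0 bw] i0].
  rewrite /extc -/(word12 w) in bw *.
  case: eqP => _; first by apply: uL; rewrite /onL bw.
  by rewrite bw (negPf k0) (negPf i0).
move=> w; case/lastP => [|v k] i bw sv nL.
  have -> : i = 0 by move: nL; rewrite /onL cats0 bw /= negbK => /eqP.
  by rewrite swap12E.
rewrite map_rcons -!rcons_cat !ext_pt; last 2 first.
- by move: sv; rewrite size_cat size_rcons addnS => -[]; rewrite size_cat.
- by move: sv; rewrite size_cat size_rcons addnS => -[]; rewrite size_cat size_map.
have sv' : size (w ++ v) = m by move: sv; rewrite size_cat size_rcons addnS => -[]; rewrite size_cat.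
have Hj j : u (pt (w ++ map swap12 v, swap12 j)) = u (pt (w ++ v, j)).
  have [oL|nL'] := boolP (onL (w ++ v) j); last exact: H.
  by rewrite !uL // onL_swap.
have es : - (swap12 k + swap12 i) = swap12 (- (k + i)) by rewrite /swap12 opprD !opprK.
have := Hj 0; rewrite swap12E => e0.
rewrite /extc es !word12_cat word12_swap (inj_eq (inv_inj swap12K)) !swap12_eq0.
by rewrite /ref e0 !Hj.
Qed.

Let lam_neq : (2 - lam != 0) /\ (5 - lam != 0).
Proof. by rewrite !subr_eq0 !(eq_sym _ lam). Qed.

(** The values of [extc] at the midpoints solve the eigenvalue equation there, so the values of v at
    the midpoints drop out for every v, and a multiple of the form on the parent cell remains. *)
Lemma cell_good u v w : size w = m -> ~~ word12 w ->
  \sum_k (cE (ext u) v (rcons w k) - lam * cM (ext u) v (rcons w k)) =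
  c0 * (cE u v w - mu * cM u v w).
Proof.
move=> sw gw; rewrite big3 /cE /cM !big_cons !big_nil /= !big3.
rewrite !pt_rconsE !(pt_rconsC w 1 0) !(pt_rconsC w 2 0) !(pt_rconsC w 2 1).
rewrite !(ext_corner _ _ sw) !(ext_pt _ _ _ sw) /extc (negPf gw) /=.
have e01 : - (0 + 1) = 2 :> 'I_3 by apply/val_inj.
have e02 : - (0 + 2) = 1 :> 'I_3 by apply/val_inj.
have e12 : - (1 + 2) = 0 :> 'I_3 by apply/val_inj.
rewrite e01 e02 e12 /mu /c0; have [h2 h5] := lam_neq.
move: (u (pt (w, 0))) (u (pt (w, 1))) (u (pt (w, 2))) (v (pt (w, 0))) (v (pt (w, 1))) (v (pt (w, 2))).
move: (v (pt (rcons w 0, 1))) (v (pt (rcons w 0, 2))) (v (pt (rcons w 1, 2))).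
move=> v01 v02 v12 a b c d e f.
by field; rewrite h2 h5.
Qed.

(** The two new vertices are boundary vertices with a common value x, and 2 (x - a) = lam x gives x
    = 2 a / (2 - lam). What remains is mass at F_w q_0 without any energy: the extra term of
    [MQ]. *)
Lemma cell_bad u v w : size w = m -> word12 w ->
  cE (ext u) v (rcons w 0) - lam * cM (ext u) v (rcons w 0) =
  c0 * (- mu * (2^-1 * (u (ref w) * v (ref w)))).
Proof.
move=> sw bw; rewrite /cE /cM !big_cons !big_nil /= !big3.
rewrite !pt_rconsE !(ext_corner _ _ sw) !(ext_pt _ _ _ sw) /extc bw /= /ref /mu /c0; have [h2 h5] := lam_neq.
move: (u (pt (w, 0))) (v (pt (w, 0))) (v (pt (rcons w 0, 1))) (v (pt (rcons w 0, 2))).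
by move=> a b c d; field; rewrite h2 h5.
Qed.

Lemma decimation u v : EE q m.+1 (ext u) v - lam * MP q m.+1 (ext u) v =
  c0 * (EE q m u v - mu * MQ m u v).
Proof.
rewrite EE_cE MP_cM mulr_sumr -sumrB big_gwordsS.
have -> : \sum_(w <- gwords m) \sum_k (cE (ext u) v (rcons w k) - lam * cM (ext u) v (rcons w k)) =
    \sum_(w <- gwords m) c0 * (cE u v w - mu * cM u v w).
  rewrite big_seq [RHS]big_seq; apply: eq_bigr => w.
  by rewrite mem_gwords => /andP[gw /eqP sw]; apply: cell_good.
have -> : \sum_(w <- words m | word12 w) (cE (ext u) v (rcons w 0) - lam * cM (ext u) v (rcons w 0)) =
    \sum_(w <- words m | word12 w) c0 * (- mu * (2^-1 * (u (ref w) * v (ref w)))).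
  rewrite big_seq_cond [RHS]big_seq_cond; apply: eq_bigr => w /andP[].
  by rewrite mem_words => /eqP sw bw; apply: cell_bad.
rewrite -!mulr_sumr -mulrDr sumrB -mulr_sumr /MQ EE_cE MP_cM.
by congr (_ * _); ring.
Qed.

End Ext.

Lemma MQ_restr m u v : MQ m u v = MQ m u (restr m v).
Proof.
rewrite /MQ /MP; congr (_ * _ + _ * _).
  rewrite big_seq [RHS]big_seq; apply: eq_bigr => -[w i]; rewrite mem_gcorners => /andP[gw /eqP sw].
  by rewrite restr_pt //; apply: onL_good.
rewrite big_seq_cond [RHS]big_seq_cond; apply: eq_bigr => w; rewrite mem_words => /andP[/eqP sw bw].
by rewrite restr_pt // /onL eqxx andbF.
Qed.

Lemma EE_restr m u v : EE q m u v = EE q m u (restr m v).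
Proof.
rewrite /EE big_seq [RHS]big_seq; apply: eq_bigr => w; rewrite mem_gwords => /andP[gw /eqP sw].
by apply: eq_bigr => ij _; rewrite !restr_pt //; apply: onL_good.
Qed.

Lemma symf_onL m u w i : symf m u -> onL w i -> u (pt (w, i)) = 0.
Proof. move=> [h _] oL; apply: h => -[_]; apply; exact/(segL_contrw hq). Qed.

(** On each parent cell the difference of the sides is a sum of squares of differences between
    midpoint values. Equality for equal midpoint values shows that 2 is sharp. *)
Lemma dirichlet_bound m d : (forall w i, size w = m -> d (pt (w, i)) = 0) ->
  2 * MP q m.+1 d d <= EE q m.+1 d d.
Proof.
move=> d0; rewrite EE_cE MP_cM mulr_sumr -subr_ge0 -sumrB big_gwordsS addr_ge0 //.
  rewrite big_seq; apply: sumr_ge0 => w; rewrite mem_gwords => /andP[gw /eqP sw].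
  rewrite big3 /cE /cM !big_cons !big_nil /= !big3.
  rewrite !pt_rconsE !(pt_rconsC w 1 0) !(pt_rconsC w 2 0) !(pt_rconsC w 2 1) !(d0 _ _ sw).
  move: (d _) (d _) (d _) => a b c.
  have := sqr_ge0 (a - b); have := sqr_ge0 (a - c); have := sqr_ge0 (b - c); lra.
rewrite big_seq_cond; apply: sumr_ge0 => w; rewrite mem_words => /andP[/eqP sw bw].
rewrite /cE /cM !big_cons !big_nil /= !big3 pt_rconsE (d0 _ _ sw).
move: (d _) (d _) => a b.
have := sqr_ge0 (a - b); lra.
Qed.

End Space.

(** * The spectrum of one level *)

Section Phi.
Context {R : realType}.
Definition phim (x : R) : R := (5 - Num.sqrt (25 - 4 * x)) / 2.
Definition phip (x : R) : R := (5 + Num.sqrt (25 - 4 * x)) / 2.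

Lemma phi_sqrt x : 0 <= x -> x < 6 -> exists s : R,
  [/\ s = Num.sqrt (25 - 4 * x), s ^+ 2 = 25 - 4 * x, 1 < s & s <= 5].
Proof.
move=> x_ge0 x6; exists (Num.sqrt (25 - 4 * x)).
have h : 0 <= 25 - 4 * x by lra.
have s0 := sqrtr_ge0 (25 - 4 * x).
have s2 := sqr_sqrtr h.
split => //; move: s0 s2; move: (Num.sqrt _) => s s0 s2; nra.
Qed.

Lemma phimP x : 0 <= x -> x < 6 -> [/\ 0 <= phim x, phim x < 2 & phim x * (5 - phim x) = x].
Proof.
move=> x_ge0 x6; have [s [e s2 s1 s5]] := phi_sqrt x_ge0 x6; rewrite /phim -e.
by split; nra.
Qed.

(** [0 < x] keeps the value below 5 = phip 0, which is a pole of the extension. *)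
Lemma phipP x : 0 < x -> x < 6 -> [/\ 3 < phip x, phip x < 5 & phip x * (5 - phip x) = x].
Proof.
move=> x_gt0 x6; have [s [e s2 s1 s5]] := phi_sqrt (ltW x_gt0) x6; rewrite /phip -e.
by split; nra.
Qed.

Lemma phim_lt x y : x < y -> 0 <= x -> y < 6 -> phim x < phim y.
Proof.
move=> xy x_ge0 y6.
have [a1 a2 a3] := phimP x_ge0 (lt_trans xy y6).
have [b1 b2 b3] := phimP (le_trans x_ge0 (ltW xy)) y6.
nra.
Qed.

Lemma phim_le x y : x <= y -> 0 <= x -> y < 6 -> phim x <= phim y.
Proof. by rewrite le_eqVlt => /orP[/eqP -> //|xy] h1 h2; apply/ltW/phim_lt. Qed.

Lemma phip_inj x y : 0 < x -> x < 6 -> 0 < y -> y < 6 -> phip x = phip y -> x = y.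
Proof.
move=> h1 h2 h3 h4 e; have [_ _ <-] := phipP h1 h2; have [_ _ <-] := phipP h3 h4.
by rewrite e.
Qed.

Lemma phimK y : 0 <= y -> y < 2 -> phim (y * (5 - y)) = y.
Proof.
move=> y0 y2; rewrite /phim.
have -> : 25 - 4 * (y * (5 - y)) = (5 - 2 * y) ^+ 2 by ring.
by rewrite sqrtr_sqr ger0_norm; lra.
Qed.
End Phi.

Section SortedLists.
Context {R : realType}.
Implicit Types s r : seq R.

(** Only j elements of s lie below its j-th entry, so j + 1 elements of r cannot all lie there. *)
Lemma sorted_sub_nth s r j : sorted <%R s -> sorted <%R r -> {subset r <= s} ->
  (j < size r)%N -> nth 0 s j <= nth 0 r j.
Proof.
move=> ss sr rs jr; rewrite leNgt; apply/negP => lt.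
have us := lt_sorted_uniq ss; have ur := lt_sorted_uniq sr.
have sub : {subset take j.+1 r <= take j s}.
  move=> x /(nthP 0)[i]; rewrite size_take_min => ii; rewrite nth_take => [xi|]; last first.
    by apply: leq_trans ii (geq_minl _ _).
  have ij : (i <= j)%N by have := leq_trans ii (geq_minl _ _).
  have ir : (i < size r)%N by apply: leq_ltn_trans ij jr.
  have xs : x \in s by apply: rs; rewrite -xi mem_nth.
  have xj : x < nth 0 s j.
    apply: le_lt_trans lt; rewrite -xi.
    move: ij; rewrite leq_eqVlt => /orP[/eqP -> //|ij].
    by apply/ltW/(sorted_ltn_nth lt_trans).
  move: xs xj => /(nthP 0)[k ks <-] h.
  have kj : (k < j)%N.
    rewrite ltnNge; apply/negP; rewrite leq_eqVlt => /orP[/eqP e|jk]; first by rewrite e ltxx in h.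
    have h' := sorted_ltn_nth lt_trans 0 ss j k (ltn_trans jk ks) ks jk.
    by have := lt_trans h h'; rewrite ltxx.
  by rewrite -(nth_take 0 kj) mem_nth // size_take_min leq_min kj ks.
have := uniq_leq_size (take_uniq _ ur) sub.
rewrite !size_take_min (minn_idPl jr) => h.
by have := leq_trans h (geq_minl _ _); rewrite ltnn.
Qed.
End SortedLists.

Section Spectrum.
Context {R : realType}.
Variable q : 'I_3 -> plane R.
Hypothesis hq : equilateral q.
Variable SG : set (plane R).
Hypothesis hSG : is_attractor q SG.
Local Notation pt := (@pt R q).
Local Notation ref := (@ref R q).
Local Notation symf := (@symf R q).
Local Notation x0 := (@x0 R q).
Local Notation MQ := (@MQ R q).

Definition EP m (l : R) (u : plane R -> R) : Prop :=
  [/\ symf m u, exists x, u x != 0 & forall v, symf m v -> EE q m u v = l * MP q m u v].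
Definition EQ m (l : R) (u : plane R -> R) : Prop :=
  [/\ symf m u, exists x, u x != 0 & forall v, symf m v -> EE q m u v = l * MQ m u v].
(* Eigenvalues with a symmetric eigenfunction which vanishes, respectively does not
   vanish, at the bottom vertices. The two sets may overlap. *)
Definition Aspec m l : Prop := exists2 u, EP m l u & u (x0 m) = 0.
Definition Bspec m l : Prop := exists2 u, EP m l u & u (x0 m) != 0.
Definition BQspec m l : Prop := exists2 u, EQ m l u & u (x0 m) != 0.

Lemma PNm_AB m l : (0 < m)%N -> PNm q SG m l <-> Aspec m l \/ Bspec m l.
Proof.
move=> m0; rewrite (PNm_weak hq l m0 hSG); split.
  by move=> [u eu]; have [e|e] := eqVneq (u (x0 m)) 0; [left|right]; exists u.
by move=> [[u eu _]|[u eu _]]; exists u.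
Qed.

Let ultra : exists G : set_system nat, UltraFilter G /\ \oo `<=` G.
Proof. exact: ultraFilterLemma. Qed.

Lemma EP_eigP m l u : EP m l u <-> eigP (pts q m) (edges q m) (symf m) l u.
Proof.
split=> -[su nz e]; split => // v sv.
  by rewrite -EE_Ef -MP_Mf e.
by rewrite EE_Ef MP_Mf e.
Qed.

Lemma EP_ge0 m l u : (0 < m)%N -> EP m l u -> 0 <= l.
Proof.
move=> m0 /EP_eigP eu; have [G [UG Goo]] := ultra.
exact: (eigP_ge0 (symf_closed hq m0 (@ultra_proper _ _ UG)) eu).
Qed.

Lemma EP_finite m : (0 < m)%N -> exists s : seq R, forall l u, EP m l u -> l \in s.
Proof.
move=> m0; have [G [UG Goo]] := ultra.
have [s Hs] := eigP_finite (edges q m) UG Goo (symf_closed hq m0 (@ultra_proper _ _ UG)).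
by exists s => l u /EP_eigP; apply: Hs.
Qed.

Lemma Bspec0 m : (0 < m)%N -> Bspec m 0.
Proof.
move=> m0; pose u := restr q m (fun=> 1).
have u1 x : VOmega q m x -> u x = 1 by move=> vx; rewrite /u /restr asboolT.
have ux : u (x0 m) = 1 by apply/u1/(x0_VOmega hq).
exists u; last by rewrite ux oner_eq0.
split; last first.
- move=> v _; rewrite mul0r /EE big1_seq // => w /andP[_]; rewrite mem_gwords => /andP[gw /eqP sw].
  rewrite big1 // => ij _; rewrite !u1 ?subrr ?mul0r //; apply/(VOmegaP hq).
    by exists w, ij.2; split => //; apply: onL_good.
  by exists w, ij.1; split => //; apply: onL_good.
- by exists (x0 m); rewrite ux oner_eq0.
split; first by move=> x nx; rewrite /u /restr asboolF.
move=> w v i bw sv nL; rewrite !u1 //; apply/(VOmegaP hq).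
  by exists (w ++ v), i.
by exists (w ++ map swap12 v), (swap12 i); rewrite onL_swap nL -sv !size_cat size_map.
Qed.

Lemma interlacing_level m : (0 < m)%N -> exists s t : seq R,
  [/\ sorted <%R s /\ (forall l, l \in s <-> Bspec m l), sorted <%R t, size t = size s,
     forall l, l \in t -> 0 <= l /\ BQspec m l &
     forall i, (i < size s)%N -> nth 0 t i <= nth 0 s i].
Proof.
move=> m0; have [G [UG Goo]] := ultra.
have cS := symf_closed hq m0 (@ultra_proper _ _ UG).
have BE l : Bspec m l <-> BP (pts q m) (edges q m) (symf m) (x0 m) l.
  by split=> -[u /EP_eigP eu ux]; exists u => //; apply/EP_eigP.
have B0 : BP (pts q m) (edges q m) (symf m) (x0 m) 0 by apply/BE/Bspec0.
have [s [t [[ss sB] st szt tB le]]] := interlacing UG Goo cS (kap_gt0 m) B0.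
exists s, t; split => //; first by split => // l; rewrite sB BE.
move=> l /tB[l0 [u [su nz eu] ux]]; split => //; exists u => //; split => // v sv.
by rewrite (MQ_symf su sv) EE_Ef MP_Mf eu.
Qed.

(** The energy is at most 6 MP, and MQ is strictly larger than MP when u(x0) <> 0. *)
Lemma BQ_lt6 m l : BQspec m l -> l < 6.
Proof.
move=> [u [su _ e] ux]; rewrite ltNge; apply/negP => l6.
have := e _ su; rewrite (MQ_symf su su).
have h1 := EE_le_MP q m u.
have h2 : 0 < kap m * u (x0 m) * u (x0 m).
  by rewrite -mulrA mulr_gt0 ?kap_gt0 // lt_neqAle -expr2 sqr_ge0 andbT eq_sym sqrf_eq0.
have h3 : 0 <= MP q m u u by rewrite MP_Mf Mf_ge0.
move: h1 h2 h3; move: (EE _ _ _ _) (MP _ _ _ _) (kap _ * _ * _) => a b c h1 h2 h3 h4.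
nra.
Qed.

Lemma x0S m : x0 m.+1 = pt (rcons (nseq m 1) 1, 0).
Proof. by rewrite -nseqSr. Qed.

Lemma ext_x0 m lam u : ext q m lam u (x0 m.+1) = 2 * u (x0 m) / (2 - lam).
Proof.
rewrite x0S (ext_pt hq) ?size_nseq // /extc.
by rewrite /= word12_nseq orbT.
Qed.

Lemma ext_nz m lam u : symf m u -> (exists x, u x != 0) -> exists x, ext q m lam u x != 0.
Proof.
move=> [h _] [x ux]; exists x.
have /(VOmegaP hq)[w [i [sw xw nL]]] : VOmega q m x.
  by apply: contrapT => nx; move: ux; rewrite h ?eqxx.
by rewrite xw -[contrw _ _ _]/(pt (w, i)) (ext_corner hq) // /pt /= -xw.
Qed.

Lemma EQ_up m lam u : lam != 2 -> lam != 5 -> EQ m (lam * (5 - lam)) u -> EP m.+1 lam (ext q m lam u).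
Proof.
move=> l2 l5 [su nz e]; split.
- exact: ext_symf.
- exact: ext_nz.
move=> v sv; apply/eqP; rewrite -subr_eq0; apply/eqP.
rewrite (decimation hq) // (MQ_restr hq) (EE_restr hq) e ?subrr ?mulr0 //.
exact: restr_symf.
Qed.

Lemma BQ_up m lam : lam != 2 -> lam != 5 -> BQspec m (lam * (5 - lam)) -> Bspec m.+1 lam.
Proof.
move=> l2 l5 [u eu ux]; exists (ext q m lam u); first exact: EQ_up.
by rewrite ext_x0 !mulf_neq0 ?invr_eq0 ?pnatr_eq0 // subr_eq0 eq_sym.
Qed.

Lemma EP_EQ0 m l u : u (x0 m) = 0 -> EP m l u <-> EQ m l u.
Proof.
move=> u0; split=> -[su nz e]; split => // v sv.
  by rewrite (MQ_symf su sv) u0 mulr0 mul0r addr0 e.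
by rewrite e // (MQ_symf su sv) u0 mulr0 mul0r addr0.
Qed.

Lemma A_up m lam : lam != 2 -> lam != 5 -> Aspec m (lam * (5 - lam)) -> Aspec m.+1 lam.
Proof.
move=> l2 l5 [u eu ux]; exists (ext q m lam u); first by apply: EQ_up => //; apply/EP_EQ0.
by rewrite ext_x0 ux mulr0 mul0r.
Qed.

(** Let d be the difference of u' and the extension of its restriction. It vanishes at the old
    vertices and E(d, d) = lam M(d, d), so [dirichlet_bound] and lam < 2 give d = 0. The identity
    [decimation] can then be divided by its nonzero factor. *)
Lemma A_down m lam : lam < 2 -> Aspec m.+1 lam -> Aspec m (lam * (5 - lam)).
Proof.
move=> l2 [u' [su' nz' e'] u'0].
have l2' : lam != 2 by rewrite lt_eqF.
have l5' : lam != 5 by rewrite lt_eqF // (lt_trans l2) // ltr_nat.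
pose u := restr q m u'.
have su : symf m u by exact: restr_symf.
have [_ _ lin _] := symf_closed hq (ltn0Sn m) (eventually_filter : ProperFilter \oo).
pose d := fun x => u' x + (-1) * ext q m lam u x.
have sd : symf m.+1 d by apply: lin => //; exact: ext_symf.
have d0 w i : size w = m -> d (pt (w, i)) = 0.
  move=> sw; rewrite /d (ext_corner hq) // mulN1r.
  have [oL|nL] := boolP (onL w i); last by rewrite /u (restr_pt hq) // subrr.
  rewrite (symf_onL hq su oL) subr0 -(pt_rconsE hq) (symf_onL hq su') //.
  by move: oL; rewrite /onL /word12 all_rcons => /andP[-> ->].
have dd : EE q m.+1 d d = lam * MP q m.+1 d d.
  have h1 := e' _ sd.
  (* By [decimation] the two sides differ by a form that sees d only at the old vertices. *)
  have h2 : EE q m.+1 (ext q m lam u) d = lam * MP q m.+1 (ext q m lam u) d.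
    apply/eqP; rewrite -subr_eq0 (decimation hq) //.
    have -> : EE q m u d = 0.
      rewrite /EE big1_seq // => w /andP[_]; rewrite mem_gwords => /andP[gw /eqP sw].
      by rewrite big1 // => ij _; rewrite !d0 // subrr mulr0.
    have -> : MQ m u d = 0.
      rewrite /MQ /MP !big1_seq ?mulr0 ?addr0 //.
        by move=> w /andP[bw]; rewrite mem_words => /eqP sw; rewrite /ref d0 // mulr0.
      by move=> [w i] /andP[_]; rewrite mem_gcorners => /andP[gw /eqP sw]; rewrite d0 // mulr0.
    by rewrite mulr0 subrr mulr0.
  have e1 : EE q m.+1 d d = EE q m.+1 u' d + (-1) * EE q m.+1 (ext q m lam u) d.
    by rewrite !EE_Ef; exact: Ef_linl.
  have e2 : MP q m.+1 d d = MP q m.+1 u' d + (-1) * MP q m.+1 (ext q m lam u) d.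
    by rewrite !MP_Mf; exact: Mf_linl.
  by rewrite e1 e2 h1 h2; ring.
have M0 : MP q m.+1 d d = 0.
  have := dirichlet_bound hq d0; rewrite dd.
  have : 0 <= MP q m.+1 d d by rewrite MP_Mf Mf_ge0.
  move: (MP _ _ _ _) => M; nra.
have dz x : d x = 0.
  by move: M0; rewrite MP_Mf => M0;
    exact: (Mf_eq0 (symf_closed hq (ltn0Sn m) (eventually_filter : ProperFilter \oo)) sd M0).
have u'E : u' = ext q m lam u.
  by apply/funext => x; apply/eqP; rewrite -subr_eq0 -mulN1r -/(d x) dz.
have ext0 : ~ (exists x, u x != 0) -> forall x, ext q m lam u x = 0.
  move=> no x; have uz y : u y = 0 by apply/eqP; apply: contrapT => /negP h; apply: no; exists y.
  rewrite /ext; case: pselect => // H; case: cid => -[[w k] i] /= _.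
  rewrite /extc !uz !(mulr0, addr0, mul0r).
  by case: (k == i) => //; case: (word12 w) => //; case: (_ || _).
have u0 : u (x0 m) = 0.
  have h : 2 - lam != 0 by rewrite gt_eqF // subr_gt0.
  move: u'0; rewrite u'E ext_x0 => /eqP; rewrite mulf_eq0 invr_eq0 (negPf h) orbF.
  by rewrite mulf_eq0 pnatr_eq0 => /eqP.
exists u => //; apply/EP_EQ0 => //; split => //.
  apply: contrapT => no; have [x] := nz'.
  by rewrite u'E ext0 // eqxx.
move=> v sv.
(* Every test function of level m is the restriction of its own extension. *)
have sv' : symf m.+1 (ext q m lam v) by exact: ext_symf.
have := @decimation R q hq m lam l2' l5' u (ext q m lam v).
rewrite -u'E e' // subrr => /esym/eqP; rewrite mulf_eq0.
have -> : ((6 - lam) / ((2 - lam) * (5 - lam)) == 0) = false.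
  apply/negbTE; rewrite mulf_neq0 ?invr_eq0 ?mulf_neq0 // subr_eq0 eq_sym //.
  by rewrite lt_eqF // (lt_trans l2) // ltr_nat.
rewrite /= subr_eq0 => /eqP.
have extv : restr q m (ext q m lam v) = v.
  apply/funext => x; rewrite /restr; case: asboolP => [/(VOmegaP hq)[w [i [sw -> nL]]]|nv].
    exact: (ext_corner hq).
  by case: sv => -> .
by rewrite (EE_restr hq) (MQ_restr hq) extv.
Qed.

(** An eigenvalue t_j for the mass MQ has the preimages phim t_j and, for j > 0, phip t_j in the
    next spectrum. Interlacing gives t_j <= s_j, so the j-th entry there is at most phim t_j <= phim
    s_j; additional entries could only lower it. *)
Lemma Blists : exists Bs : nat -> seq R, forall m, (0 < m)%N ->
  [/\ sorted <%R (Bs m), forall l, l \in Bs m <-> Bspec m l,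
     (2 * size (Bs m) <= (size (Bs m.+1)).+1)%N,
     forall j, (j < size (Bs m))%N -> nth 0 (Bs m.+1) j < 2 &
     forall j, (j < size (Bs m))%N -> nth 0 (Bs m) j < 6 ->
        nth 0 (Bs m.+1) j <= phim (nth 0 (Bs m) j)].
Proof.
have /choice[st Hst] : forall m, exists st : seq R * seq R, (0 < m)%N ->
  [/\ sorted <%R st.1 /\ (forall l, l \in st.1 <-> Bspec m l), sorted <%R st.2, size st.2 = size st.1,
     forall l, l \in st.2 -> 0 <= l /\ BQspec m l &
     forall i, (i < size st.1)%N -> nth 0 st.2 i <= nth 0 st.1 i].
  case=> [|m]; first by exists ([::], [::]).
  by have [s [t H]] := @interlacing_level m.+1 isT; exists (s, t).
exists (fun m => (st m).1) => m m0.
have [[ss sB] st_sorted szt tB le] := Hst m m0.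
have [[ss' sB'] _ _ _ _] := Hst m.+1 isT.
set t := (st m).2 in st_sorted szt tB le *.
have t6 l : l \in t -> 0 <= l /\ l < 6 by move=> /tB[l0 /BQ_lt6].
have pm_in : {subset map phim t <= (st m.+1).1}.
  move=> _ /mapP[l lt ->]; apply/sB'; have [l0 l6] := t6 l lt.
  have [h1 h2 h3] := phimP l0 l6.
  by apply: BQ_up; rewrite ?h3 ?lt_eqF //; [apply: lt_trans h2 _; rewrite ltr_nat|have [] := tB l lt].
have pm_sorted : sorted <%R (map phim t).
  apply/(sortedP 0) => i; rewrite size_map => ii; rewrite !(nth_map 0) ?(ltnW ii) //.
  have [h1 _] := t6 _ (mem_nth 0 (ltnW ii)); have [_ h2] := t6 _ (mem_nth 0 ii).
  by apply: phim_lt => //; apply: (sortedP 0 st_sorted).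
have nth_phim j : (j < size (st m).1)%N -> nth 0 (st m.+1).1 j <= phim (nth 0 t j).
  move=> js; rewrite -(nth_map 0 0) ?szt //; apply: sorted_sub_nth => //.
  by rewrite size_map szt.
have tj j : (j < size (st m).1)%N -> 0 <= nth 0 t j /\ nth 0 t j < 6.
  by move=> js; apply: t6; rewrite mem_nth // szt.
split => //.
(* The first entry of t may be 0, which phip would send to the pole 5. Dropping it costs the 1 in
   the size bound. *)
- have sub : {subset map phim t ++ map phip (behead t) <= (st m.+1).1}.
    move=> x; rewrite mem_cat => /orP[/pm_in //|/mapP[l lt ->]]; apply/sB'.
    have lt' : l \in t by apply: mem_behead.
    have [l0 l6] := t6 l lt'.
    have l_gt0 : 0 < l.
      move: st_sorted lt t6; case: (t) => //= a t' pt lt2 t6'.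
      have /allP/(_ _ lt2) := order_path_min lt_trans pt.
      by apply: le_lt_trans; have [] := t6' a; rewrite ?inE ?eqxx.
    have [h1 h2 h3] := phipP l_gt0 l6.
    apply: BQ_up; rewrite ?h3; [rewrite gt_eqF //| by rewrite lt_eqF|by have [] := tB l lt'].
    by apply: lt_trans h1; rewrite ltr_nat.
  have un : uniq (map phim t ++ map phip (behead t)).
    have bt_gt0 l : l \in behead t -> 0 < l /\ l < 6.
      move=> lt; have lt' : l \in t by apply: mem_behead.
      split; last by have [] := t6 l lt'.
      move: st_sorted lt t6; case: (t) => //= a t' pt lt2 t6'.
      have /allP/(_ _ lt2) := order_path_min lt_trans pt.
      by apply: le_lt_trans; have [] := t6' a; rewrite ?inE ?eqxx.
    rewrite cat_uniq (lt_sorted_uniq pm_sorted) /=; apply/andP; split.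
      apply/hasPn => _ /mapP[l /bt_gt0[l0 l6] ->]; apply/negP => /mapP[l' /t6[h1 h2] e].
      have [a1 a2 _] := phipP l0 l6; have [b1 b2 _] := phimP h1 h2.
      by rewrite e in a1; have := lt_trans a1 b2; rewrite ltr_nat.
    rewrite map_inj_in_uniq.
      by have := lt_sorted_uniq st_sorted; case: (t) => //= a l /andP[].
    by move=> x y /bt_gt0[a1 a2] /bt_gt0[b1 b2]; apply: phip_inj.
  have := uniq_leq_size un sub; rewrite size_cat !size_map size_behead szt.
  by move: (size (st m).1) (size (st m.+1).1) => a b h; lia.
- move=> j js; have [t0 t6'] := tj j js; apply: le_lt_trans (nth_phim j js) _.
  by have [] := phimP t0 t6'.
- move=> j js b6; apply: le_trans (nth_phim j js) _.
  by have [t0 t6'] := tj j js; apply: phim_le => //; apply: le.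
Qed.

End Spectrum.

(** * Stabilisation of the k-th eigenvalue *)

Lemma eventually_constant (P : nat -> bool) : (forall n, P n -> P n.+1) ->
  \forall n \near \oo, P n = P n.+1.
Proof.
move=> H; have [[n0 p0]|no] := pselect (exists n, P n).
  exists n0 => // n /= le; have : forall d, P (n0 + d)%N.
    by elim=> [|d IH]; rewrite ?addn0 // addnS; apply: H.
  by move=> /(_ (n - n0)%N); rewrite subnKC // => pn; rewrite pn H.
have Pf n : P n = false by apply/negP => pn; apply: no; exists n.
by apply: nearW => n; rewrite !Pf.
Qed.

Lemma size_undup_map (T U V : eqType) (s : seq T) (f : T -> U) (g : T -> V) :
  (forall x y, (f x == f y) = (g x == g y)) ->
  size (undup (map f s)) = size (undup (map g s)).
Proof.
move=> H; elim: s => //= x s IH.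
have -> : (f x \in map f s) = (g x \in map g s).
  apply/mapP/mapP => -[y ys e]; exists y => //; apply/eqP; move/eqP: e; by rewrite H.
by case: ifP => _ //=; rewrite IH.
Qed.

Section Rank.
Context {R : realType}.
Implicit Type s : seq R.

Lemma rank_nth s k : sorted <%R s -> (k < size s)%N -> count (< nth 0 s k) s = k.
Proof.
move=> ss ks; have us := lt_sorted_uniq ss.
rewrite -{2}(cat_take_drop k s) count_cat.
have -> : count (< nth 0 s k) (take k s) = k.
  rewrite -[RHS](size_takel (ltnW ks)); apply/eqP; rewrite -all_count.
  apply/allP => x /(nthP 0)[i]; rewrite size_takel ?(ltnW ks) // => ik <- /=.
  by rewrite nth_take //; apply: (sorted_ltn_nth lt_trans) => //; rewrite inE (ltn_trans ik).
suff -> : count (< nth 0 s k) (drop k s) = 0%N by rewrite addn0.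
apply/eqP; rewrite -leqn0 leqNgt -has_count; apply/hasPn => x /(nthP 0)[i].
rewrite size_drop nth_drop => ik <- /=; rewrite -leNgt.
have [->|i0] := posnP i; first by rewrite addn0.
apply/ltW/(sorted_ltn_nth lt_trans) => //; rewrite ?inE; last by rewrite -[ltnLHS]addn0 ltn_add2l.
by rewrite -ltn_subRL.
Qed.

Lemma nth_rank s y : sorted <%R s -> y \in s -> nth 0 s (count (< y) s) = y.
Proof. by move=> ss /(nthP 0)[k ks <-]; rewrite rank_nth. Qed.
End Rank.

Section Stabilisation.
Context {R : realType}.
Variables (A : nat -> R -> Prop) (Bs Ps : nat -> seq R).
Hypothesis Psorted : forall m, (0 < m)%N -> sorted <%R (Ps m).
Hypothesis PsE : forall m, (0 < m)%N -> forall l, l \in Ps m <-> A m l \/ l \in Bs m.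
Hypothesis Ps_ge0 : forall m, (0 < m)%N -> forall l, l \in Ps m -> 0 <= l.
Hypothesis Bsorted : forall m, (0 < m)%N -> sorted <%R (Bs m).
Hypothesis Bsize : forall m, (0 < m)%N -> (2 * size (Bs m) <= (size (Bs m.+1)).+1)%N.
Hypothesis Bsize1 : (1 < size (Bs 1))%N.
Hypothesis Blt2 : forall m, (0 < m)%N -> forall j, (j < size (Bs m))%N -> nth 0 (Bs m.+1) j < 2.
Hypothesis Bstep : forall m, (0 < m)%N -> forall j, (j < size (Bs m))%N ->
  nth 0 (Bs m) j < 6 -> nth 0 (Bs m.+1) j <= phim (nth 0 (Bs m) j).
Hypothesis Aup : forall m, (0 < m)%N -> forall l, 0 <= l -> l < 6 -> A m l -> A m.+1 (phim l).
Hypothesis Adown : forall m, (0 < m)%N -> forall l, l < 2 -> A m.+1 l -> A m (l * (5 - l)).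

Lemma Bsub m : (0 < m)%N -> {subset Bs m <= Ps m}.
Proof. by move=> m0 l lB; apply/PsE => //; right. Qed.

(** Two values at level 1 and the recursion s' >= 2 s - 1 give at least 2^m + 1 values at level m +
    1. *)
Lemma Bs_size m : (2 ^ m < size (Bs m.+1))%N.
Proof.
elim: m => [|m IH] //; have := @Bsize m.+1 isT; rewrite expnS.
by move: (size _) (size _) (2 ^ m)%N IH => a b c; lia.
Qed.

Lemma Ps_size m : (2 ^ m < size (Ps m.+1))%N.
Proof.
apply: leq_trans (Bs_size m) _; apply: uniq_leq_size.
  exact/lt_sorted_uniq/Bsorted.
exact: Bsub.
Qed.

Lemma lt_size_Bs k m : (k < m)%N -> (k < size (Bs m))%N.
Proof.
case: m => // m; rewrite ltnS => km; apply: ltn_trans (Bs_size m).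
exact: leq_ltn_trans km (ltn_expl _ _).
Qed.

Lemma iter_phim n (x : R) : 0 <= x -> x < 2 -> 0 <= iter n phim x /\ iter n phim x < 2.
Proof.
move=> x0 x2; elim: n => //= n [h1 h2].
by have [] := phimP h1 (lt_trans h2 (_ : 2 < 6)); first by rewrite ltr_nat.
Qed.

(** Labels are the A-orbits ([inl]) and the B-indices up to k ([inr]); the value of a label at the
    next level is at most its image under phim. Once the order of the labels is frozen, one label
    has rank k at both of two consecutive levels. *)
Lemma stabilisation k : exists M, (0 < M)%N /\ forall m, (M <= m)%N ->
  [/\ nth 0 (Ps m.+1) k <= phim (nth 0 (Ps m) k), 0 <= nth 0 (Ps m) k & nth 0 (Ps m) k < 2].
Proof.
have aux (p y : R) : 0 <= p -> p < 2 -> 0 <= y -> y < 2 -> p <= y -> p * (5 - p) <= y * (5 - y).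
  by move=> *; nra.
(* Level k + 1 has more than k B-values, and [Blt2] looks one level back: from level k + 2 on, the
   first k + 1 of them are below 2. *)
pose M := k.+2.
have lt26 : 2 < 6 :> R by rewrite ltr_nat.
pose b n j := nth 0 (Bs (M + n)) j.
have M0 n : (0 < M + n)%N by [].
have kB n : (k < size (Bs (M + n)))%N by apply: lt_size_Bs; rewrite /M addSn ltnS leqW // leq_addr.
have jB n j : (j <= k)%N -> (j < size (Bs (M + n)))%N by move=> jk; apply: leq_ltn_trans jk (kB n).
have b2 n j : (j <= k)%N -> b n j < 2.
  move=> jk; rewrite /b /M addSn; apply: Blt2 => //.
  by apply: leq_ltn_trans jk _; apply: lt_size_Bs; rewrite addSn ltnS leq_addr.
have b0 n j : (j <= k)%N -> 0 <= b n j.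
  by move=> jk; apply: (Ps_ge0 (M0 n)); apply: Bsub => //; rewrite mem_nth // jB.
have bS n j : (j <= k)%N -> b n.+1 j <= phim (b n j).
  by move=> jk; rewrite /b addnS; apply: Bstep; rewrite ?jB //; apply: lt_trans (b2 _ _ jk) _.
have bmono n i j : (i <= k)%N -> (j <= k)%N -> (b n i < b n j) = (i < j)%N.
  move=> ik jk; apply/idP/idP; last first.
    by move=> ij; apply: (sorted_ltn_nth lt_trans) => //; rewrite ?inE ?jB //; apply: Bsorted.
  move=> h; rewrite ltnNge; apply/negP; rewrite leq_eqVlt => /orP[/eqP e|ji].
    by rewrite e ltxx in h.
  have h' : b n j < b n i.
    by apply: (sorted_ltn_nth lt_trans) => //; rewrite ?inE ?jB //; apply: Bsorted.
  by have := lt_trans h h'; rewrite ltxx.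
pose aL := [seq x <- Ps M | `[< A M x >] & x <= b 0 k].
have aLP x : x \in aL -> [/\ A M x, 0 <= x & x < 2].
  rewrite mem_filter => /andP[/andP[/asboolP Ax xb] xP]; split => //.
    by apply: (@Ps_ge0 M).
  by apply: le_lt_trans xb (b2 _ _ _).
pose I := ('I_(size aL) + 'I_k.+1)%type.
pose val n (x : I) := match x with inl i => iter n phim (nth 0 aL i) | inr j => b n j end.
have val02 n x : 0 <= val n x /\ val n x < 2.
  case: x => [i|j] /=; last by split; [apply: b0|apply: b2]; rewrite -ltnS.
  by have [_ h1 h2] := aLP _ (mem_nth 0 (ltn_ord i)); apply: iter_phim.
have val6 n x : val n x < 6 by have [_ h] := val02 n x; apply: lt_trans h _.
have valS n x : val n.+1 x <= phim (val n x).
  by case: x => [i|j] //=; apply: bS; rewrite -ltnS.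
(* An A-value at most [b n.+1 k] <= phim (b n k) comes from one at most [b n k], so every relevant
   A-value descends to level M. *)
have A_orbit n p : A (M + n) p -> p <= b n k -> exists i, p = val n (inl i).
  elim: n p => [|n IH] p.
    rewrite addn0 => Ap pb; have : p \in aL.
      by rewrite mem_filter asboolT //= pb; apply/PsE => //; left.
    by move=> /(nthP 0)[i ii <-]; exists (Ordinal ii).
  rewrite addnS => Ap pb.
  have p0 : 0 <= p by apply: (@Ps_ge0 (M + n).+1) => //; apply/PsE => //; left.
  have p2 : p < 2 by apply: le_lt_trans pb (b2 _ _ _).
  have [|i e] := IH (p * (5 - p)) (Adown (M0 n) p2 Ap).
    have pb' := le_trans pb (bS n k (leqnn k)).
    have [h1 h2 h3] := phimP (b0 n k (leqnn k)) (lt_trans (b2 n k (leqnn k)) lt26).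
    by rewrite -h3; apply: aux.
  by exists i; rewrite /= -/(val n (inl i)) -e phimK.
have A_val n i : A (M + n) (val n (inl i)).
  elim: n => [|n IH]; first by rewrite addn0 /=; have [] := aLP _ (mem_nth 0 (ltn_ord i)).
  by rewrite addnS /=; apply: Aup => //; [have [] := val02 n (inl i)|apply: (val6 n (inl i))].
have val_in n x : val n x \in Ps (M + n).
  case: x => [i|j]; first by apply/PsE => //; left; apply: A_val.
  by apply: Bsub => //; rewrite /= /b mem_nth // jB // -ltnS.
have val_all n p : p \in Ps (M + n) -> p <= b n k -> exists x, p = val n x.
  move=> /PsE[//|Ap|Bp] pb; first by have [i ->] := A_orbit n p Ap pb; exists (inl i).
  move: Bp => /(nthP 0)[j js pj]; have jk : (j < k.+1)%N.
    rewrite ltnS leqNgt; apply/negP => kj; move: pb; rewrite leNgt => /negP; apply.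
    by rewrite -pj; apply: (sorted_ltn_nth lt_trans) => //; rewrite ?inE //; apply: Bsorted.
  by exists (inr (Ordinal jk)); rewrite /= -pj.
(* Two A-orbits keep their order because phim is increasing, two B-values by sortedness. In a mixed
   pair, a B-value that is below an A-orbit stays below it, so the comparison switches at most
   once. *)
have patt : \forall n \near \oo, forall x : I, forall y : I, (val n x < val n y) = (val n.+1 x < val n.+1 y).
  apply: (@filter_forall _ _ (fun (x : I) n => forall y : I, (val n x < val n y) = (val n.+1 x < val n.+1 y)) \oo _) => x.
  apply: (@filter_forall _ _ (fun (y : I) n => (val n x < val n y) = (val n.+1 x < val n.+1 y)) \oo _) => y.
  have inlS n i : val n.+1 (inl i) = phim (val n (inl i)) by [].
  have phim_mono (u v : R) : 0 <= u -> u < 6 -> 0 <= v -> v < 6 -> (u < v) = (phim u < phim v).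
    move=> h1 h2 h3 h4; apply/idP/idP => h; first exact: phim_lt.
    by rewrite ltNge; apply/negP => h'; move: h; rewrite ltNge phim_le.
  case: x => [i|i]; case: y => [j|j].
  - by apply: nearW => n; rewrite !inlS; apply: phim_mono; rewrite ?val6 //; have [] := val02 n (inl i); have [] := val02 n (inl j).
  - have := @eventually_constant (fun n => val n (inr j) <= val n (inl i)).
    have h n : val n (inr j) <= val n (inl i) -> val n.+1 (inr j) <= val n.+1 (inl i).
      move=> h; apply: le_trans (valS n (inr j)) _; rewrite inlS; apply: phim_le => //.
      by have [] := val02 n (inr j).
    by move=> /(_ h); apply: filterS => n e; rewrite !ltNge e.
  - apply: (@eventually_constant (fun n => val n (inr i) < val n (inl j))) => n h.
    apply: le_lt_trans (valS n (inr i)) _; rewrite inlS; apply: phim_lt => //.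
    by have [] := val02 n (inr i).
  - by apply: nearW => n; rewrite /= !bmono // -ltnS.
case: patt => N _ HN; exists (M + N)%N; split => // m Mm.
pose n := (m - M)%N.
have mE : m = (M + n)%N by rewrite /n subnKC // (leq_trans _ Mm) // leq_addr.
have Nn : (N <= n)%N by rewrite /n leq_subRL // (leq_trans _ Mm) // leq_addr.
have pat := HN n Nn; rewrite mE -addnS.
have kP i : (k < size (Ps (M + i)))%N.
  apply: leq_trans (kB i) _; apply: uniq_leq_size; last exact: Bsub.
  exact/lt_sorted_uniq/Bsorted.
set p := nth 0 (Ps (M + n)) k.
have pP : p \in Ps (M + n) by rewrite mem_nth.
have pb : p <= b n k.
  by apply: sorted_sub_nth => //; [exact: Psorted|exact: Bsorted|exact: Bsub].
have [x px] := val_all n p pP pb.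
(* An A-value and a B-value may coincide, so the rank counts distinct values, not labels. *)
have rankE i : val i x <= b i k -> count (< val i x) (Ps (M + i)) =
    size (undup [seq val i y | y <- enum {: 'I_(size aL) + 'I_k.+1} & val i y < val i x]).
  move=> xb; rewrite -size_filter; apply: perm_size; apply: uniq_perm.
  - exact/filter_uniq/lt_sorted_uniq/Psorted.
  - exact: undup_uniq.
  move=> y; rewrite mem_filter mem_undup; apply/andP/mapP.
    move=> [/= yx yP]; have [z yz] := val_all i y yP (le_trans (ltW yx) xb).
    by exists z => //; rewrite mem_filter -yz yx mem_enum.
  by move=> [z]; rewrite mem_filter => /andP[zx _] ->; split.
have xb : val n x <= b n k by rewrite -px.
have xb' : val n.+1 x <= b n.+1 k.
  move: xb; rewrite leNgt [in X in _ -> X]leNgt.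
  have := pat (inr ord_max) x; rewrite /= => ->.
  by [].
have r1 := rankE n xb; have r2 := rankE n.+1 xb'.
have eqpat y z : (val n y == val n z) = (val n.+1 y == val n.+1 z).
  by rewrite !eq_le !leNgt !pat.
have -> : nth 0 (Ps (M + n.+1)) k = val n.+1 x.
  rewrite -[RHS](nth_rank (Psorted (M0 n.+1)) (val_in n.+1 x)); congr nth.
  rewrite r2 (eq_filter (a2 := fun y => val n y < val n x)) => [|y]; last by rewrite /= pat.
  rewrite -(size_undup_map _ eqpat) -r1 -px.
  by apply/esym/rank_nth; [exact: Psorted|exact: kP].
by rewrite px; have [h1 h2] := val02 n x; split.
Qed.

End Stabilisation.

(** * Convergence of the renormalised sequence *)

Section Renormalised.
Context {R : realType}.

(** For p = phim x, p < 2 and p (5 - p) = x give 3 p <= x; then 5 p = x + p^2. *)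
Lemma phim_bounds (x : R) : 0 <= x -> x < 6 -> phim x <= x / 3 /\ 5 * phim x <= x + x ^+ 2 / 9.
Proof.
move=> x_ge0 x6; have [h1 h2 h3] := phimP x_ge0 x6.
have h4 : phim x <= x / 3 by nra.
split => //; nra.
Qed.

Lemma renormalised_cvg (t : nat -> R) M :
  (forall m, (M <= m)%N -> [/\ t m.+1 <= phim (t m), 0 <= t m & t m < 2]) ->
  cvgn (fun m => 5 ^+ m * t m).
Proof.
move=> H.
have H' n : [/\ t (n + M).+1 <= phim (t (n + M)%N), 0 <= t (n + M)%N & t (n + M)%N < 2].
  by apply: H; rewrite leq_addl.
have lt26 : 2 < 6 :> R by rewrite ltr_nat.
have tb n : t (n + M)%N <= 2 / 3 ^+ n.
  elim: n => [|n IH]; first by have [_ _ /ltW] := H' 0%N; rewrite expr0 divr1.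
  have [h1 h2 h3] := H' n; rewrite addSn.
  have [h4 _] := phim_bounds h2 (lt_trans h3 lt26).
  apply: le_trans h1 _; apply: le_trans h4 _; rewrite exprS invfM.
  by rewrite mulrCA mulrC ler_pM2l ?invr_gt0.
pose D : R := 5 ^+ M.
(* For m = n + M and t_m <= 2 / 3^n, the sequence 5^m t_m grows by at most 5^m t_m^2 / 9 <= (4/9) D
   (5/9)^n. The added term decreases by exactly this amount, so w is nonincreasing. *)
pose w n := 5 ^+ (n + M) * t (n + M)%N + D * (5 / 9) ^+ n.
have w_ge0 n : 0 <= w n.
  have [_ h _] := H' n.
  have D0 : 0 <= D by rewrite /D exprn_ge0.
  have r0 : 0 <= (5 / 9) ^+ n :> R by rewrite exprn_ge0 // divr_ge0.
  by rewrite /w addr_ge0 // mulr_ge0 // exprn_ge0.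
have w_dec n : w n.+1 <= w n.
  have [h1 h2 h3] := H' n.
  have [_ h5] := phim_bounds h2 (lt_trans h3 lt26).
  have h6 := tb n; rewrite /w addSn [in leLHS]exprS [(5 / 9) ^+ n.+1]exprS.
  have P0 : 0 < 5 ^+ (n + M) :> R by rewrite exprn_gt0.
  have sq : t (n + M)%N ^+ 2 <= 4 / 9 ^+ n.
    have -> : 4 / 9 ^+ n = (2 / 3 ^+ n) ^+ 2 :> R.
      rewrite exprMn exprVn -exprM mulnC exprM; congr (_ / (_ ^+ _)); ring.
    by rewrite ler_pXn2r ?nnegrE // divr_ge0 // exprn_ge0.
  have e1 : 5 ^+ (n + M) * (4 / 9 ^+ n) = 4 * (D * (5 / 9) ^+ n) :> R.
    by rewrite /D exprD expr_div_n; ring.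
  have h7 : 5 ^+ (n + M) * t (n + M)%N ^+ 2 <= 4 * (D * (5 / 9) ^+ n).
    by rewrite -e1 ler_pM2l.
  have h8 : 5 * t (n + M).+1 <= t (n + M)%N + t (n + M)%N ^+ 2 / 9.
    by apply: le_trans h5; rewrite ler_pM2l.
  have h9 : 5 ^+ (n + M) * (5 * t (n + M).+1) <= 5 ^+ (n + M) * (t (n + M)%N + t (n + M)%N ^+ 2 / 9).
    by rewrite ler_pM2l.
  have e2 : 5 * 5 ^+ (n + M) * t (n + M).+1 = 5 ^+ (n + M) * (5 * t (n + M).+1) by ring.
  have e3 : D * (5 / 9 * (5 / 9) ^+ n) = 5 / 9 * (D * (5 / 9) ^+ n) by ring.
  have e4 : 5 ^+ (n + M) * (t (n + M)%N + t (n + M)%N ^+ 2 / 9) =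
    5 ^+ (n + M) * t (n + M)%N + (5 ^+ (n + M) * t (n + M)%N ^+ 2) / 9 by ring.
  rewrite e2 e3; rewrite e4 in h9; move: h7 h9.
  set a := _ * (5 * _); set b := _ * t (n + M)%N; set c := _ * _ ^+ 2; set d := D * _.
  move: a b c d => a b c d; clear; lra.
have w_cvg : cvgn w.
  apply: nonincreasing_is_cvgn; first by apply/nonincreasing_seqP.
  by exists 0 => _ [n _ <-].
have r_cvg : (fun n => D * (5 / 9) ^+ n : R) @ \oo --> (0 : R).
  rewrite -(mulr0 D); apply: cvgM; first exact: cvg_cst.
  rewrite [X in X @ _ --> _](_ : _ = geometric 1 (5 / 9)).
    by apply: cvg_geometric; rewrite ger0_norm ?divr_ge0 // ltr_pdivrMr // mul1r ltr_nat.
  by apply/funext => n; rewrite /geometric /= mul1r.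
have : cvgn (fun n => 5 ^+ (n + M) * t (n + M)%N).
  rewrite [X in cvgn X](_ : _ = fun n => w n - D * (5 / 9) ^+ n); last first.
    by apply/funext => n; rewrite /w addrK.
  by apply: is_cvgB => //; apply/cvg_ex; exists 0.
move=> /cvg_ex[l hl]; apply/cvg_ex; exists l.
by rewrite -(cvg_shiftn M).
Qed.
End Renormalised.

(** * Hoelder estimates *)

Section Energy.
Context {R : realType}.
Variable q : 'I_3 -> plane R.
Hypothesis hq : equilateral q.
Local Notation pt := (@pt R q).
Local Notation ref := (@ref R q).
Local Notation energym := (@energym R q).

Lemma energym_sym m u v : energym m u v = energym m v u.
Proof. by rewrite !(energymE hq) !EE_Ef Ef_sym. Qed.

Lemma energym_linl m u u' v c :
  energym m (fun x => u x + c * u' x) v = energym m u v + c * energym m u' v.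
Proof. by rewrite !(energymE hq) !EE_Ef Ef_linl; ring. Qed.

Lemma energym_linr m u u' v c :
  energym m v (fun x => u x + c * u' x) = energym m v u + c * energym m v u'.
Proof. by rewrite energym_sym energym_linl !(energym_sym m v). Qed.

Lemma energym_ge0 m u : 0 <= energym m u u.
Proof. by rewrite (energymE hq) EE_Ef mulr_ge0 ?Ef_ge0 // exprn_ge0 // divr_ge0. Qed.

(** The least energy of an extension to the midpoints of a cell is 3/5 of the energy of the cell,
    attained at the harmonic values (2 a + 2 b + c) / 5. [dx], [dy], [dz] are the deviations from
    these. *)
Lemma energymS m u : energym m u u <= energym m.+1 u u.
Proof.
rewrite !(energymE hq) exprSr -mulrA ler_pM2l ?exprn_gt0 ?divr_gt0 //.
rewrite !EE_cE big_gwordsS mulrDr -[leLHS]addr0; apply: lerD; last first.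
  rewrite mulr_ge0 ?divr_ge0 // sumr_ge0 // => w _.
  by rewrite /cE !big_cons !big_nil /= !addr_ge0 // -expr2 sqr_ge0.
rewrite mulr_sumr; apply: ler_sum => w _.
rewrite big3 /cE !big_cons !big_nil /= !(pt_rconsE hq).
rewrite !(pt_rconsC hq w 1 0) !(pt_rconsC hq w 2 0) !(pt_rconsC hq w 2 1).
move: (u (pt (w, 0))) (u (pt (w, 1))) (u (pt (w, 2))).
move: (u (pt (rcons w 0, 1))) (u (pt (rcons w 0, 2))) (u (pt (rcons w 1, 2))).
move=> x y z a b c.
pose dx := x - (2 * a + 2 * b + c) / 5; pose dy := y - (2 * a + b + 2 * c) / 5.
pose dz := z - (a + 2 * b + 2 * c) / 5.
have h1 := sqr_ge0 (dx - dy); have h2 := sqr_ge0 (dx - dz); have h3 := sqr_ge0 (dy - dz).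
have h4 := sqr_ge0 dx; have h5 := sqr_ge0 dy; have h6 := sqr_ge0 dz.
move: h1 h2 h3 h4 h5 h6; rewrite /dx /dy /dz; clear; lra.
Qed.

Lemma energym_le n m u : (n <= m)%N -> energym n u u <= energym m u u.
Proof.
move=> /subnK <-; elim: (m - n)%N => // d IH.
by rewrite addSn; apply: le_trans IH (energymS _ _).
Qed.

Lemma discriminant (a b c : R) : 0 <= c ->
  (forall t, 0 <= a + 2 * t * b + t ^+ 2 * c) -> b ^+ 2 <= a * c.
Proof.
move=> c_ge0 H.
have a0 : 0 <= a by have := H 0; rewrite mulr0 mul0r expr0n mul0r !addr0.
have [c0|c0] := ltP 0 c.
  have := H (- b / c); have -> : a + 2 * (- b / c) * b + (- b / c) ^+ 2 * c = (a * c - b ^+ 2) / c.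
    by field; rewrite gt_eqF.
  by rewrite pmulr_lge0 ?invr_gt0 // subr_ge0.
have c00 : c = 0 by apply/eqP; rewrite eq_le c0.
have b0 t : 0 <= a + 2 * t * b by have := H t; rewrite c00 mulr0 addr0.
rewrite c00 mulr0; have [->|nb] := eqVneq b 0; first by rewrite expr0n.
have := b0 (- (a + 1) / (2 * b)).
have -> : a + 2 * (- (a + 1) / (2 * b)) * b = - 1 by field.
by rewrite lerNr oppr0 ler10.
Qed.

Lemma increment_CS n m u v : (n <= m)%N ->
  (energym m u v - energym n u v) ^+ 2 <=
  (energym m u u - energym n u u) * (energym m v v - energym n v v).
Proof.
move=> nm; apply: discriminant => [|t]; first by rewrite subr_ge0 energym_le.
have := energym_le (fun x => u x + t * v x) nm; rewrite -subr_ge0 !energym_linl !energym_linr.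
rewrite !(energym_sym _ v u).
move: (energym m u u) (energym m u v) (energym m v v) (energym n u u) (energym n u v) (energym n v v).
by move=> a b c d e f h; lra.
Qed.

(* A rational upper bound of [sqrt (3 / 5)], the decay rate of the oscillation of a
   function of finite energy. *)
Definition rho45 : R := 4 / 5.

Lemma rho_gt0 n : 0 < rho45 ^+ n. Proof. by rewrite exprn_gt0 // divr_gt0. Qed.

Lemma rho_cvg0 (c : R) : (fun n => c * rho45 ^+ n) @ \oo --> (0 : R).
Proof.
rewrite -(mulr0 c); apply: cvgM; first exact: cvg_cst.
rewrite [X in X @ _ --> _](_ : _ = geometric 1 rho45).
  by apply: cvg_geometric; rewrite ger0_norm ?divr_ge0 // ltr_pdivrMr // mul1r ltr_nat.
by apply/funext => n; rewrite /geometric /= mul1r.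
Qed.

Lemma edge_osc C j u w a b : 0 <= C -> energym j u u <= C ^+ 2 -> size w = j -> ~~ word12 w ->
  `|u (pt (w, a)) - u (pt (w, b))| <= C * rho45 ^+ j.
Proof.
move=> C0 eC sw gw.
have h1 : (u (pt (w, a)) - u (pt (w, b))) ^+ 2 <= cE q u u w.
  rewrite /cE !big_cons !big_nil /= addr0 -!expr2.
  have s1 := sqr_ge0 (u (pt (w, 0)) - u (pt (w, 1))).
  have s2 := sqr_ge0 (u (pt (w, 0)) - u (pt (w, 2))).
  have s3 := sqr_ge0 (u (pt (w, 1)) - u (pt (w, 2))).
  by case: (I3P a) => ->; case: (I3P b) => ->; move: s1 s2 s3;
    move: (u _) (u _) (u _) => x y z; clear; lra.
have h2 : cE q u u w <= EE q j u u.
  rewrite EE_cE (bigD1_seq w) ?gwords_uniq //=; last by rewrite mem_gwords gw sw eqxx.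
  rewrite lerDl sumr_ge0 // => v _.
  by rewrite /cE !big_cons !big_nil /= !addr_ge0 // -expr2 sqr_ge0.
have h3 : EE q j u u <= C ^+ 2 * (3 / 5) ^+ j.
  move: eC; rewrite (energymE hq) => eC.
  have -> : EE q j u u = ((5 / 3) ^+ j * EE q j u u) * (3 / 5) ^+ j.
    rewrite mulrAC -exprMn (_ : 5 / 3 * (3 / 5) = 1) ?expr1n ?mul1r //.
    by field.
  by apply: ler_wpM2r => //; rewrite exprn_ge0 // divr_ge0.
have h4 : (3 / 5) ^+ j <= (rho45 ^+ j) ^+ 2.
  rewrite -exprM mulnC exprM lerXn2r ?nnegrE ?sqr_ge0 ?divr_ge0 //.
  by rewrite /rho45; lra.
have r0 := ltW (rho_gt0 j).
rewrite -(@ler_pXn2r R 2) // ?nnegrE ?normr_ge0 ?mulr_ge0 // real_normK ?num_real // exprMn.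
apply: le_trans h1 _; apply: le_trans h2 _; apply: le_trans h3 _.
by apply: ler_wpM2l => //; exact: sqr_ge0.
Qed.

Section Osc.
Variables (m : nat) (C : R) (u : plane R -> R).
Hypotheses (C0 : 0 <= C) (eC : energym m u u <= C ^+ 2).

Let eCj j : (j <= m)%N -> energym j u u <= C ^+ 2.
Proof. by move=> jm; apply: le_trans eC; exact: energym_le. Qed.

Lemma ref_rcons0 w : ref (rcons w 0) = ref w. Proof. exact: pt_rconsE. Qed.

(** F_w F_k q_0 = F_w F_0 q_k, so the step runs along an edge of the cell w0, which is good even if
    the cell w touches L. *)
Lemma ref_step w k : (size w < m)%N ->
  `|u (ref (rcons w k)) - u (ref w)| <= C * rho45 ^+ (size w).+1.
Proof.
move=> sm; rewrite -(ref_rcons0 w) /ref (pt_rconsC hq w k 0).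
apply: edge_osc => //; first exact: eCj.
  by rewrite size_rcons.
by rewrite /word12 all_rcons.
Qed.

(** For r = 4/5, C r^(n+1) = 4 C (r^n - r^(n+1)), so the bounds of the steps telescope. *)
Lemma ref_chain w v : (size (w ++ v) <= m)%N ->
  `|u (ref (w ++ v)) - u (ref w)| <= 4 * C * (rho45 ^+ size w - rho45 ^+ size (w ++ v)).
Proof.
elim/last_ind: v => [|v k IH] sm; first by rewrite cats0 !subrr normr0 mulr0.
rewrite -rcons_cat size_rcons in sm *; rewrite -(subrK (u (ref (w ++ v))) (u (ref (rcons _ _)))) -addrA.
apply: le_trans (ler_normD _ _) _.
have h1 := ref_step k sm; have h2 := IH (ltnW sm).
apply: le_trans (lerD h1 h2) _; rewrite ![rho45 ^+ (size (w ++ v)).+1]exprS.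
move: (rho45 ^+ size w) (rho45 ^+ size (w ++ v)) => x y; rewrite /rho45.
by rewrite le_eqVlt; apply/orP; left; apply/eqP; field.
Qed.

Lemma corner_osc w i : (size w <= m)%N -> ~~ onL w i ->
  `|u (pt (w, i)) - u (ref w)| <= C * rho45 ^+ size w.
Proof.
move=> sm; have [->|i0] := eqVneq i 0.
  by move=> _; rewrite subrr normr0 mulr_ge0 // ltW // rho_gt0.
rewrite /onL i0 andbT => gw.
by apply: edge_osc => //; exact: eCj.
Qed.

Lemma osc w v i : (size (w ++ v) <= m)%N -> ~~ onL (w ++ v) i ->
  `|u (pt (w ++ v, i)) - u (ref w)| <= 5 * C * rho45 ^+ size w.
Proof.
move=> sm nL; rewrite -(subrK (u (ref (w ++ v))) (u (pt _))) -addrA.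
apply: le_trans (ler_normD _ _) _.
apply: le_trans (lerD (corner_osc sm nL) (ref_chain sm)) _.
have le : rho45 ^+ size (w ++ v) <= rho45 ^+ size w.
  rewrite size_cat exprD ler_piMr ?(ltW (rho_gt0 _)) // exprn_ile1 ?divr_ge0 //.
  by rewrite /rho45; lra.
have := ltW (rho_gt0 (size (w ++ v))).
move: le; move: (rho45 ^+ size w) (rho45 ^+ size (w ++ v)) => x y h1 h2.
have : 0 <= C * y by apply: mulr_ge0.
move: C C0 => D D0; nra.
Qed.
End Osc.

Section StarOsc.
Variable SG : set (plane R).
Hypothesis hSG : is_attractor q SG.
Local Notation cell := (@cell R q SG).
Variables (C : R) (u : plane R -> R).
Hypotheses (C0 : 0 <= C) (eC : forall m, energym m u u <= C ^+ 2).

Lemma VOmega_le n m x : (n <= m)%N -> VOmega q n x -> VOmega q m x.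
Proof.
move=> /subnK <-; elim: (m - n)%N => // d IH vx; rewrite addSn.
by apply: VOmegaS => //; apply: IH.
Qed.

Lemma VOmegaStar_rep N y : VOmegaStar q y ->
  exists w i, [/\ (N <= size w)%N, ~~ onL w i & y = pt (w, i)].
Proof.
move=> [n _ vn].
have /(VOmegaP hq)[w [i [sw yw nL]]] := VOmega_le (leq_addr N n) vn.
by exists w, i; split => //; rewrite sw leq_addl.
Qed.

(** A point of the cell w whose chosen fine name lies outside w is a corner of w. *)
Lemma cell_osc w y : VOmegaStar q y -> cell w y ->
  `|u y - u (ref w)| <= 5 * C * rho45 ^+ size w.
Proof.
move=> vy [z sz zy]; have [w1 [i [sw nL yw]]] := VOmegaStar_rep (size w) vy.
move: (yw); rewrite -{1}zy -(cat_take_drop (size w) w1) /pt /= contrw_cat => e.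
have ss : size w = size (take (size w) w1) by rewrite size_take_min (minn_idPl sw).
have [[ww _]|[x [a [a' [n [_ _ _ za _]]]]]] :=
  contrw_meet hq ss (SG_tri hq hSG sz) (tri_contrw hq _ (tri_q hq i)) e.
  rewrite yw; move: nL; rewrite -{1 2}(cat_take_drop (size w) w1) -ww => nL.
  exact: (osc C0 (eC _) (leqnn _)).
have yE : y = pt (w, a') by rewrite -zy za.
have nL' : ~~ onL w a'.
  have := pt_onL hq (w1, i); have := pt_onL hq (w, a'); rewrite /= -yE -yw => h1 h2.
  by apply/negP => /h1/h2; apply/negP.
rewrite yE; apply: le_trans (corner_osc C0 (eC _) (leqnn _) nL') _.
by rewrite -mulrA ler_peMl ?mulr_ge0 ?(ltW (rho_gt0 _)) // ler1n.
Qed.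

(** Distinct cells of one level meet in a common corner, whose value is close to both reference
    values. At a dyadic point of L this breaks down, as its two sides are different points of the
    completion. *)
Lemma cells_close w w' x : size w = size w' -> cell w x -> cell w' x -> ~ segL q x ->
  `|u (ref w) - u (ref w')| <= 2 * C * rho45 ^+ size w.
Proof.
move=> ss cw cw' nx; have [->|[a [a' [xa xa']]]] := cell_meet hq hSG ss cw cw'.
  by rewrite subrr normr0 !mulr_ge0 // ltW // rho_gt0.
have nL : ~~ onL w a by apply/negP => /(segL_contrw hq); rewrite -xa.
have nL' : ~~ onL w' a' by apply/negP => /(segL_contrw hq); rewrite -xa'.
rewrite -(subrK (u x) (u (ref w))) -addrA; apply: le_trans (ler_normD _ _) _.
rewrite distrC -mulrA mulrDl mul1r; apply: lerD.
  by rewrite xa; apply: (corner_osc C0 (eC _) (leqnn _) nL).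
by rewrite xa' ss; apply: (corner_osc C0 (eC _) (leqnn _) nL').
Qed.

End StarOsc.
End Energy.

(** * The completion in the resistance metric *)

Section Completion.
Context {R : realType}.
Variable q : 'I_3 -> plane R.
Hypothesis hq : equilateral q.
Variable SG : set (plane R).
Hypothesis hSG : is_attractor q SG.
Local Notation pt := (@pt R q).
Local Notation ref := (@ref R q).
Local Notation energym := (@energym R q).
Local Notation cell := (@cell R q SG).
Local Notation resistance := (@resistance R q).
Local Notation Star := (VOmegaStar q).

Definition bndE (u : plane R -> R) (C : R) : Prop := 0 <= C /\ forall m, energym m u u <= C ^+ 2.

Lemma energy_nd u : nondecreasing_seq (fun m => energym m u u).
Proof. by apply/nondecreasing_seqP => m; exact: energymS. Qed.

(** The energies increase with m, so the extended limit is their supremum. The bound is written as a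
    square because oscillations scale like the root of the energy. *)
Lemma FOmegaP u : FOmega q u <-> exists C, bndE u C.
Proof.
have nd : nondecreasing_seq (fun m => (energym m u u)%:E).
  by move=> a b ab; rewrite lee_fin; apply: energy_nd.
have cv := ereal_nondecreasing_cvgn nd.
rewrite /FOmega /= (cvg_lim _ cv) //; split.
  move=> lt; set S := ereal_sup _ in lt.
  have up m : ((energym m u u)%:E <= S)%E by apply: ereal_sup_ubound; exists m.
  exists (Num.sqrt (fine S)); split; first exact: sqrtr_ge0.
  have S0 : (0 <= S)%E by apply: le_trans (up 0%N); rewrite lee_fin; apply: energym_ge0.
  have Sfin : S \is a fin_num by rewrite ge0_fin_numE.
  move=> m; rewrite sqr_sqrtr ?fine_ge0 //.
  by rewrite -lee_fin fineK.
move=> [C [C0 H]]; apply: (@le_lt_trans _ _ (C ^+ 2)%:E); last exact: ltry.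
by apply: ge_ereal_sup => _ [m _ <-]; rewrite lee_fin.
Qed.

Lemma EOmega_cvg u : FOmega q u -> energym m u u @[m --> \oo] --> EOmega q u u.
Proof.
move=> /FOmegaP[C [C0 H]]; apply: nondecreasing_is_cvgn; first exact: energy_nd.
by exists (C ^+ 2) => _ [m _ <-].
Qed.

Lemma energym_le_EOmega u m : FOmega q u -> energym m u u <= EOmega q u u.
Proof. by move=> Fu; apply: nondecreasing_cvgn_le; [exact: energy_nd|apply/cvg_ex; exists (EOmega q u u); exact: EOmega_cvg]. Qed.

Lemma EOmega_ge0 u : FOmega q u -> 0 <= EOmega q u u.
Proof. by move=> Fu; apply: le_trans (energym_le_EOmega 0 Fu); apply: energym_ge0. Qed.

Lemma bndE_sqrt u : FOmega q u -> bndE u (Num.sqrt (EOmega q u u)).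
Proof.
move=> Fu; split; first exact: sqrtr_ge0.
by move=> m; rewrite sqr_sqrtr ?EOmega_ge0 // energym_le_EOmega.
Qed.

Lemma FOmega_lin u v c : FOmega q u -> FOmega q v -> FOmega q (fun x => u x + c * v x).
Proof.
move=> /FOmegaP[C [C0 HC]] /FOmegaP[D [D0 HD]]; apply/FOmegaP.
exists (Num.sqrt (2 * C ^+ 2 + 2 * c ^+ 2 * D ^+ 2)); split; first exact: sqrtr_ge0.
have p0 : 0 <= 2 * C ^+ 2 + 2 * c ^+ 2 * D ^+ 2
  by apply: addr_ge0; apply: mulr_ge0 => //; rewrite ?sqr_ge0 // pmulr_rge0 // sqr_ge0.
move=> m; rewrite sqr_sqrtr //.
have h := energym_ge0 hq m (fun x => u x + (- c) * v x).
move: h (HC m) (HD m); rewrite !(energym_linl hq) !(energym_linr hq) (energym_sym hq m v u).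
move: (energym m u u) (energym m u v) (energym m v v) => a b d h1 h2 h3.
have h4 : c ^+ 2 * d <= c ^+ 2 * D ^+ 2 by apply: ler_wpM2l => //; exact: sqr_ge0.
lra.
Qed.

Lemma EOmega_cvg2 u v : FOmega q u -> FOmega q v ->
  energym m u v @[m --> \oo] --> EOmega q u v.
Proof.
move=> Fu Fv; have Fp := FOmega_lin 1 Fu Fv.
pose p x := u x + 1 * v x.
suff : (energym m p p - energym m u u - energym m v v) / 2 @[m --> \oo] -->
    (EOmega q p p - EOmega q u u - EOmega q v v) / 2.
  move=> h; suff e : (fun m => energym m u v) = fun m => (energym m p p - energym m u u - energym m v v) / 2.
    by apply: cvgP; rewrite e; exact: h.
  apply/funext => m; rewrite !(energym_linl hq) !(energym_linr hq) (energym_sym hq m v u).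
  by field.
by apply: cvgM; [apply: cvgB; [apply: cvgB|]; exact: EOmega_cvg|exact: cvg_cst].
Qed.

Lemma star_SG x : Star x -> SG x.
Proof. by move=> [m _ /(VOmegaP hq)[w [i [_ -> _]]]]; exact: SG_point. Qed.

Lemma ref_star w : Star (ref w).
Proof. by exists (size w) => //; apply: ref_VOmega. Qed.

Lemma cell_nil : cell [::] = SG.
Proof. by rewrite /cell; apply/seteqP; split => [_ [x sx <-] //|x sx]; exists x. Qed.

Lemma star_osc u C w x y : bndE u C -> Star x -> Star y -> cell w x -> cell w y ->
  `|u x - u y| <= 10 * C * rho45 ^+ size w.
Proof.
move=> [C0 HC] vx vy cx cy.
have h1 := cell_osc hq hSG C0 HC vx cx; have h2 := cell_osc hq hSG C0 HC vy cy.
rewrite -(subrK (u (ref w)) (u x)) -addrA; apply: le_trans (ler_normD _ _) _.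
apply: le_trans (lerD h1 _) _; first by rewrite distrC; exact: h2.
by rewrite le_eqVlt; apply/orP; left; apply/eqP; ring.
Qed.

Definition res_set x y : set R :=
  [set (u x - u y) ^+ 2 / EOmega q u u | u in [set u | FOmega q u /\ 0 < EOmega q u u]].

Lemma res_ub w x y : Star x -> Star y -> cell w x -> cell w y ->
  ubound (res_set x y) (100 * (rho45 ^+ size w) ^+ 2).
Proof.
move=> vx vy cx cy _ [u [Fu Eu] <-].
have := star_osc (bndE_sqrt Fu) vx vy cx cy => h.
rewrite ler_pdivrMr // -real_normK ?num_real //.
have -> : 100 * (rho45 ^+ size w) ^+ 2 * EOmega q u u =
   (10 * Num.sqrt (EOmega q u u) * rho45 ^+ size w) ^+ 2.
  by rewrite !exprMn sqr_sqrtr ?EOmega_ge0 //; ring.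
rewrite ler_pXn2r ?nnegrE // !mulr_ge0 ?sqrtr_ge0 //.
exact/ltW/rho_gt0.
Qed.

Lemma res_has_ub x y : Star x -> Star y -> has_ubound (res_set x y).
Proof.
move=> vx vy; exists (100 * (rho45 ^+ size ([::] : seq 'I_3)) ^+ 2).
by apply: res_ub => //; rewrite cell_nil; apply: star_SG.
Qed.

Lemma res_ge0 x y : Star x -> Star y -> 0 <= resistance x y.
Proof.
move=> vx vy; rewrite /Defs.resistance -/(res_set x y).
(* The supremum of an empty set is 0 by convention. *)
have [[r [u [Fu Eu] _]]|/set0P/negP] := pselect (res_set x y !=set0); last first.
  by rewrite negbK => /eqP ->; rewrite sup0.
apply: (@le_trans _ _ ((u x - u y) ^+ 2 / EOmega q u u)); last first.
  by apply: ub_le_sup; [exact: res_has_ub|exists u].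
by rewrite mulr_ge0 ?sqr_ge0 // invr_ge0 ltW.
Qed.

Lemma res_le_ub x y (b : R) : 0 <= b -> ubound (res_set x y) b -> resistance x y <= b.
Proof.
move=> b0 ub; rewrite /Defs.resistance -/(res_set x y).
have [ne|/set0P/negP] := pselect (res_set x y !=set0); first exact: ge_sup.
by rewrite negbK => /eqP ->; rewrite sup0.
Qed.

(** The supremum ranges over positive energies only; a function of energy 0 is constant on Omega_*
    by [star_osc]. *)
Lemma res_bound u x y : FOmega q u -> Star x -> Star y ->
  (u x - u y) ^+ 2 <= resistance x y * EOmega q u u.
Proof.
move=> Fu vx vy; have [E0|E0] := ltP 0 (EOmega q u u).
  rewrite -ler_pdivrMr //; apply: ub_le_sup; first exact: res_has_ub.
  by exists u.
have E00 : EOmega q u u = 0 by apply/eqP; rewrite eq_le E0 EOmega_ge0.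
have := star_osc (w := [::]) (bndE_sqrt Fu) vx vy.
rewrite cell_nil E00 sqrtr0 mulr0 mul0r mulr0 => /(_ (star_SG vx) (star_SG vy)).
by rewrite normr_le0 => /eqP ->; rewrite expr0n.
Qed.

Lemma res_bound_norm u x y : FOmega q u -> Star x -> Star y ->
  `|u x - u y| <= Num.sqrt (resistance x y) * Num.sqrt (EOmega q u u).
Proof.
move=> Fu vx vy; rewrite -sqrtrM ?res_ge0 // -sqrtr_sqr; apply: ler_wsqrtr.
exact: res_bound.
Qed.

(** Up to scaling, the root of the resistance is the supremum of |u x - u y| over functions of
    energy 1, so it inherits the triangle inequality of the absolute value. *)
Lemma sqrt_res_triangle x y z : Star x -> Star y -> Star z ->
  Num.sqrt (resistance x z) <= Num.sqrt (resistance x y) + Num.sqrt (resistance y z).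
Proof.
move=> vx vy vz; set a := Num.sqrt (resistance x y); set b := Num.sqrt (resistance y z).
have a0 : 0 <= a by exact: sqrtr_ge0. have b0 : 0 <= b by exact: sqrtr_ge0.
have -> : a + b = Num.sqrt ((a + b) ^+ 2) by rewrite sqrtr_sqr ger0_norm // addr_ge0.
apply: ler_wsqrtr; apply: res_le_ub; first exact: sqr_ge0.
move=> _ [u [Fu Eu] <-]; rewrite ler_pdivrMr // -real_normK ?num_real //.
have -> : (a + b) ^+ 2 * EOmega q u u = ((a + b) * Num.sqrt (EOmega q u u)) ^+ 2.
  by rewrite exprMn sqr_sqrtr // EOmega_ge0.
rewrite ler_pXn2r ?nnegrE ?mulr_ge0 ?addr_ge0 ?sqrtr_ge0 //.
rewrite -(subrK (u y) (u x)) -addrA; apply: le_trans (ler_normD _ _) _.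
by rewrite mulrDl; apply: lerD; apply: res_bound_norm.
Qed.

Lemma res_sym x y : resistance x y = resistance y x.
Proof.
rewrite /Defs.resistance; congr sup; apply/seteqP; split => _ [u Fu <-]; exists u => //;
  by rewrite -sqrrN opprB.
Qed.

Lemma res_xx x : Star x -> resistance x x = 0.
Proof.
move=> vx; apply/eqP; rewrite eq_le res_ge0 // andbT; apply: res_le_ub => //.
by move=> _ [u _ <-]; rewrite subrr expr0n mul0r.
Qed.

Lemma Otilde_star s n : Otilde q s -> Star (s n).
Proof. by case. Qed.

Lemma Otilde_cst x : Star x -> Otilde q (cst x).
Proof. by move=> vx; split => // e e0; exists 0%N => i j _ _; rewrite res_xx. Qed.

Lemma sqrt_lt (x e : R) : 0 < e -> x < e ^+ 2 -> Num.sqrt x < e.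
Proof.
move=> e0 h; have [x0|x0] := leP 0 x; last by rewrite ltr0_sqrtr.
by rewrite -(@ltr_pXn2r R 2) ?nnegrE ?sqrtr_ge0 ?ltW // sqr_sqrtr.
Qed.

Lemma cauchy_cvgn (a : nat -> R) : (forall e : R, 0 < e -> exists N, forall i j,
  (N <= i)%N -> (N <= j)%N -> `|a i - a j| < e) -> cvgn a.
Proof.
move=> H; apply: cauchy_cvg; apply/cauchyP => e e0.
have [N HN] := H e e0; exists (a N); exists N => // n /= Nn.
by rewrite /ball /=; apply: HN.
Qed.

Lemma dtilde_cvg s t : Otilde q s -> Otilde q t ->
  resistance (s n) (t n) @[n --> \oo] --> dtilde q s t.
Proof.
move=> [vs cs] [vt ct]; pose a n := Num.sqrt (resistance (s n) (t n)).
have a_cvg : cvgn a.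
  apply: cauchy_cvgn => e e0.
  have e2 : 0 < (e / 2) ^+ 2 by rewrite exprn_gt0 // divr_gt0.
  have [N1 H1] := cs _ e2; have [N2 H2] := ct _ e2.
  exists (maxn N1 N2) => i j; rewrite !geq_max => /andP[i1 i2] /andP[j1 j2].
  have e20 : 0 < e / 2 by rewrite divr_gt0.
  have key k l : (N1 <= k)%N -> (N1 <= l)%N -> (N2 <= k)%N -> (N2 <= l)%N -> a k < a l + e.
    move=> k1 l1 k2 l2.
    have r1 := sqrt_lt e20 (H1 k l k1 l1); have r2 := sqrt_lt e20 (H2 l k l2 k2).
    have t1 := sqrt_res_triangle (vs k) (vs l) (vt k).
    have t2 := sqrt_res_triangle (vs l) (vt l) (vt k).
    rewrite /a; move: r1 r2 t1 t2; clear; lra.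
  have := key i j i1 j1 i2 j2; have := key j i j1 i1 j2 i2.
  by move=> *; rewrite ltr_norml; apply/andP; split; lra.
suff : cvgn (fun n => resistance (s n) (t n)) by [].
rewrite (_ : (fun n => _) = fun n => a n * a n); first exact: is_cvgM.
by apply/funext => n; rewrite /a -expr2 sqr_sqrtr // res_ge0.
Qed.

Definition Uext (u : plane R -> R) (s : nat -> plane R) : R := limn (fun n => u (s n)).

Lemma Uext_cvg u s : FOmega q u -> Otilde q s -> u (s n) @[n --> \oo] --> Uext u s.
Proof.
move=> Fu [vs cs]; apply: cauchy_cvgn => e e0.
pose E := EOmega q u u.
have E0 : 0 <= E by exact: EOmega_ge0.
have E1 : 0 < E + 1 by rewrite ltr_wpDl.
have e2 : 0 < e ^+ 2 / (E + 1) by apply: divr_gt0 => //; apply: exprn_gt0.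
have [N HN] := cs _ e2; exists N => i j Ni Nj.
rewrite -(@ltr_pXn2r R 2) ?nnegrE ?normr_ge0 ?(ltW e0) // real_normK ?num_real //.
apply: le_lt_trans (res_bound Fu (vs i) (vs j)) _.
have := HN i j Ni Nj; rewrite ltr_pdivlMr //; apply: le_lt_trans.
by rewrite -/E ler_wpM2l ?res_ge0 // lerDl.
Qed.

Lemma Uext_cst u x : Uext u (cst x) = u x.
Proof. by rewrite /Uext; apply: cvg_lim => //; exact: (@cvg_cst _ (u x)). Qed.

Lemma on_star_Uext u : on_star (Uext u) = u.
Proof. by apply/funext => x; rewrite /on_star Uext_cst. Qed.

Lemma Uext_dist u s t : FOmega q u -> Otilde q s -> Otilde q t ->
  (Uext u s - Uext u t) ^+ 2 <= dtilde q s t * EOmega q u u.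
Proof.
move=> Fu os ot.
have h1 : (u (s n) - u (t n)) ^+ 2 @[n --> \oo] --> (Uext u s - Uext u t) ^+ 2.
  by apply: cvgM; apply: cvgB; exact: Uext_cvg.
have h2 : resistance (s n) (t n) * EOmega q u u @[n --> \oo] --> dtilde q s t * EOmega q u u.
  by apply: cvgM; [exact: dtilde_cvg|exact: cvg_cst].
apply: ler_cvg_to h1 h2 _; apply: nearW => n.
by apply: res_bound => //; exact: Otilde_star.
Qed.

Lemma Uext_Ftilde u : FOmega q u -> Ftilde q (Uext u).
Proof.
move=> Fu; split; last by rewrite on_star_Uext.
move=> s os e e0; pose E := EOmega q u u.
have E0 : 0 <= E by exact: EOmega_ge0.
have E1 : 0 < E + 1 by rewrite ltr_wpDl.
exists (e ^+ 2 / (E + 1)) => [|t ot]; first by apply: divr_gt0 => //; apply: exprn_gt0.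
rewrite ltr_pdivlMr // => d.
rewrite -(@ltr_pXn2r R 2) ?nnegrE ?normr_ge0 ?(ltW e0) // real_normK ?num_real //.
apply: le_lt_trans (Uext_dist Fu os ot) _; apply: le_lt_trans d; rewrite -/E.
have d0 : 0 <= dtilde q s t.
  have h := dtilde_cvg os ot; apply: (@cvgr_to_ge _ \oo _ _ _ _ 0 h).
  by apply: nearW => n; apply: res_ge0; exact: Otilde_star.
by rewrite ler_wpM2l // lerDl.
Qed.

(** In the completion, the constant sequences at s n converge to the class of s. *)
Lemma Ftilde_lim V s : Ftilde q V -> Otilde q s -> on_star V (s n) @[n --> \oo] --> V s.
Proof.
move=> [cV _] os; apply/cvgrPdist_lt => e e0.
have [d d0 H] := cV s os e e0.
have [vs cs] := os.
have d2 : 0 < d / 2 by rewrite divr_gt0.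
have [N HN] := cs _ d2; exists N => // n /= Nn.
apply: H; first exact/Otilde_cst/vs.
apply: (@le_lt_trans _ _ (d / 2)); last by rewrite ltr_pdivrMr // ltr_pMr // ltr1n.
have h := dtilde_cvg os (Otilde_cst (vs n)).
apply: (@cvgr_to_le _ \oo _ _ _ _ _ h).
by exists N => // k /= Nk; apply/ltW/HN.
Qed.

Lemma Omega_SG x : Omega q SG x -> SG x.
Proof. by case. Qed.

Lemma Omega_segL x : Omega q SG x -> ~ segL q x.
Proof. by move=> [_ nx] lx; apply: nx; right. Qed.

Lemma address x n : SG x -> exists w, size w = n /\ cell w x.
Proof. by move=> sx; have [w [y [sw sy ->]]] := SG_dec hSG n sx; exists w; split => //; exists y. Qed.

(** Cut w' to the length of w: 2 C accounts for two cells of one level that share x, 5 C for the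
    oscillation inside the shortened cell. *)
Lemma cells_comparable u C w w' x : bndE u C -> (size w <= size w')%N -> cell w x -> cell w' x ->
  ~ segL q x -> `|u (ref w) - u (ref w')| <= 7 * C * rho45 ^+ size w.
Proof.
move=> [C0 HC] ss cx [y' sy' yx'] nx.
have ss' : size w = size (take (size w) w') by rewrite size_take_min (minn_idPl ss).
have cx' : cell (take (size w) w') x.
  exists (contrw q (drop (size w) w') y'); first exact: SG_contrw.
  by rewrite -contrw_cat cat_take_drop.
have h1 := cells_close hq hSG C0 HC ss' cx cx' nx.
have h2 : `|u (ref w') - u (ref (take (size w) w'))| <= 5 * C * rho45 ^+ size (take (size w) w').
  apply: (cell_osc hq hSG C0 HC (ref_star w')).
  by rewrite -{2}(cat_take_drop (size w) w'); exact: cell_point.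
rewrite -ss' in h2; rewrite -(subrK (u (ref (take (size w) w'))) (u (ref w))) -addrA.
apply: le_trans (ler_normD _ _) _.
apply: le_trans (lerD h1 _) _; first by rewrite distrC; exact: h2.
by rewrite le_eqVlt; apply/orP; left; apply/eqP; ring.
Qed.

(** The words chosen at different levels need not extend one another; since x is off L,
    [cells_comparable] still makes their reference points Cauchy. *)
Lemma address_seq x : SG x -> ~ segL q x -> exists2 s, Otilde q s & s @ \oo --> x.
Proof.
move=> sx nx.
have /choice[w Hw] : forall n, exists w, size w = n /\ cell w x by move=> n; exact: address.
exists (fun n => ref (w n)); last first.
  apply: (cell_cvg hq hSG (w := w)) => n; have [sw cw] := Hw n => //.
  by have := cell_point hq hSG (w n) [::] 0; rewrite cats0.
split; first by move=> n; exact: ref_star.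
move=> e e0.
have [N _ HN] : \forall N \near \oo, 49 * (rho45 ^+ N) ^+ 2 < e.
  have h : (fun N => 49 * rho45 ^+ N * rho45 ^+ N) @ \oo --> (0 : R).
    by rewrite -(mulr0 0); apply: cvgM; [exact: rho_cvg0|have := @rho_cvg0 R 1; under eq_fun do rewrite mul1r].
  have /cvgrPdist_lt/(_ e e0) := h; apply: filterS => N.
  by rewrite sub0r normrN expr2 mulrA => /(le_lt_trans (ler_norm _)).
exists N => i j Ni Nj.
wlog ij : i j Ni Nj / (i <= j)%N.
  move=> H; have [ij|/ltnW ji] := leqP i j; first exact: H.
  by rewrite res_sym; apply: H.
apply: le_lt_trans (HN i Ni); apply: res_le_ub; first by rewrite mulr_ge0 // sqr_ge0.
move=> _ [u [Fu Eu] <-]; rewrite ler_pdivrMr // -real_normK ?num_real //.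
have [si ci] := Hw i; have [sj cj] := Hw j.
have := cells_comparable (w := w i) (w' := w j) (bndE_sqrt Fu) _ ci cj nx.
rewrite si sj => /(_ ij) h.
have -> : 49 * (rho45 ^+ i) ^+ 2 * EOmega q u u = (7 * Num.sqrt (EOmega q u u) * rho45 ^+ i) ^+ 2.
  by rewrite !exprMn sqr_sqrtr ?EOmega_ge0 //; ring.
rewrite ler_pXn2r ?nnegrE // !mulr_ge0 ?sqrtr_ge0 //.
exact/ltW/rho_gt0.
Qed.

Lemma to_OtildeP x : Omega q SG x -> Otilde q (to_Otilde q x) /\ to_Otilde q x @ \oo --> x.
Proof.
move=> ox; have [s os sx] := address_seq (Omega_SG ox) (Omega_segL ox).
by apply: (@xgetPex _ (cst x) [set s | Otilde q s /\ s @ \oo --> x]); exists s.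
Qed.

(** [to_Otilde] picks some Cauchy sequence tending to x in the plane. Its late members lie in cells
    of the level of w that contain x, and [cells_close] relates these to w. *)
Lemma on_Omega_cell V C w x : Ftilde q V -> bndE (on_star V) C -> Omega q SG x -> cell w x ->
  `|on_Omega q V x - on_star V (ref w)| <= 7 * C * rho45 ^+ size w.
Proof.
move=> FV [C0 HC] ox cx; have [os sx] := to_OtildeP ox.
have h := Ftilde_lim FV os.
have h' : `|on_star V (to_Otilde q x n) - on_star V (ref w)| @[n --> \oo] -->
   `|on_Omega q V x - on_star V (ref w)|.
  by apply: cvg_norm; apply: cvgB => //; exact: cvg_cst.
apply: (@cvgr_to_le _ \oo _ _ _ _ _ h').
have hn : \forall n \near \oo, SG (to_Otilde q x n) ->
    exists w', [/\ size w' = size w, cell w' x & cell w' (to_Otilde q x n)].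
  exact: (sx _ (near_cell hSG x (size w))).
apply: filterS hn => n H; have vs := Otilde_star n os.
have [w' [sw' cx' cs']] := H (star_SG vs).
have h1 := cell_osc hq hSG C0 HC vs cs'.
have h2 := cells_close hq hSG C0 HC (esym sw') cx cx' (Omega_segL ox).
rewrite -(subrK (on_star V (ref w')) (on_star V (to_Otilde q x n))) -addrA.
apply: le_trans (ler_normD _ _) _; apply: le_trans (lerD h1 _) _; first by rewrite distrC; exact: h2.
by rewrite sw' le_eqVlt; apply/orP; left; apply/eqP; ring.
Qed.

End Completion.

(** * Riemann sums *)

Section Measure.
Context {R : realType}.
Variable q : 'I_3 -> plane R.
Hypothesis hq : equilateral q.
Variable SG : set (plane R).
Hypothesis hSG : is_attractor q SG.
Variable mu : probability (plane R) R.
Local Notation cell := (@cell R q SG).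
Hypothesis hmu : forall w : seq 'I_3, mu (cell w) = (3 ^- size w)%:E.

Lemma bary_measurable i : measurable_fun setT (bary q i : plane R -> R).
Proof.
have [a [b [c H]]] := bary_affine hq i.
rewrite (_ : bary q i = fun x => a * x.1 + b * x.2 + c); last by apply/funext.
apply: measurable_funD; last exact: measurable_cst.
apply: measurable_funD; apply: measurable_funM; try exact: measurable_cst.
  exact: measurable_fst.
exact: measurable_snd.
Qed.

(** The closed triangle spanned by the corners of the cell, as an intersection of half-planes: on
    it, the i-th coordinate is least where that of the preimage under F_w vanishes. *)
Definition hull (w : seq 'I_3) : set (plane R) :=
  [set x | forall i, bary q i (contrw q w (q 0)) - 2 ^- size w * (i == 0)%:R <= bary q i x].

Lemma hull_measurable w : measurable (hull w).
Proof.
have -> : hull w = \bigcap_(i in [set: 'I_3])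
    (bary q i @^-1` `[bary q i (contrw q w (q 0)) - 2 ^- size w * (i == 0)%:R, +oo[).
  apply/seteqP; split => x; first by move=> h i _; rewrite /= in_itv /= h.
  by move=> h i; have := h i I; rewrite /= in_itv /= andbT.
apply: fin_bigcap_measurable => // i _.
rewrite -[X in measurable X]setTI; apply: bary_measurable => //.
Qed.

Lemma cell_hull w x : cell w x -> hull w x.
Proof.
move=> [y sy <-] i; have := bary_contrwB hq i w y (q 0); rewrite (bary_q hq) mulrBr => e.
have h : 0 <= 2 ^- size w * bary q i y.
  by rewrite mulr_ge0 ?invr_ge0 ?exprn_ge0 //; exact: (SG_tri hq hSG sy).
move: e h; move: (bary q i (contrw q w y)) (bary q i (contrw q w (q 0))) (_ * bary q i y) (_ * _%:R).
by move=> a b c d e h; lra.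
Qed.

Lemma hull_dist w x : hull w x -> `|x - contrw q w (q 0)| <= 2 ^- size w * diam q.
Proof.
move=> hx; apply: le_trans (plane_dist hq _ _) _.
rewrite /diam mulr_sumr; apply: ler_sum => i _.
apply: ler_wpM2r; first by rewrite addr_ge0.
have := bary_sum hq x; have := bary_sum hq (contrw q w (q 0)).
have := hx 0; have := hx 1; have := hx 2; rewrite /= mulr1 !mulr0 !subr0.
have : 0 <= 2 ^- size w :> R by rewrite invr_ge0 exprn_ge0.
rewrite ler_norml.
case: (I3P i) => ->; move: (2 ^- size w) (bary q 0 x) (bary q 1 x) (bary q 2 x)
  (bary q 0 _) (bary q 1 _) (bary q 2 _) => e x0 x1 x2 y0 y1 y2 e0 h2 h1 h0 sy sx;
  by apply/andP; split; lra.
Qed.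

(** A point in hulls of all levels is a limit of vertices F_(w v_n) q_0 in the closed cell w; the
    v_n need not be nested. *)
Lemma cell_bigcap w : cell w = \bigcap_n \bigcup_(v in [set` words n]) hull (w ++ v).
Proof.
apply/seteqP; split => [x [y sy <-] n _|x H].
  have [v [z [sv sz ->]]] := SG_dec hSG n sy.
  exists v; first by rewrite /= mem_words sv.
  by rewrite -contrw_cat; apply: cell_hull; exists z.
have /choice[v Hv] : forall n, exists v, size v = n /\ hull (w ++ v) x.
  by move=> n; have [v] := H n I; rewrite /= mem_words => /eqP sv hv; exists v.
have lim : (fun n => contrw q (w ++ v n) (q 0)) @ \oo --> x.
  apply: (plane_cvg (cvg_half (diam q))) => n; have [sv hv] := Hv n.
  rewrite distrC; apply: le_trans (hull_dist hv) _.
  apply: ler_wpM2r; first exact: diam_ge0.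
  rewrite size_cat sv lef_pV2 ?posrE ?exprn_gt0 //.
  by rewrite ler_weXn2l // ?ler1n // leq_addl.
have ev : \forall n \near \oo, cell w (contrw q (w ++ v n) (q 0)).
  by apply: nearW => n; exact: cell_point.
exact: (@closed_cvg _ _ _ _ _ (cell w) (@cell_closed R q SG hSG w) ev _ lim).
Qed.

Lemma cell_measurable w : measurable (cell w).
Proof.
rewrite cell_bigcap; apply: bigcapT_measurable => n.
by apply: fin_bigcup_measurable => // v _; exact: hull_measurable.
Qed.

(** Inside SG, this set and the next are {q_0} and the part on L, presented through covers by cells
    of total mass 3^-n and at most (2/3)^n. *)
Definition top_null : set (plane R) := \bigcap_n cell (nseq n 0).
Definition bottom_null : set (plane R) :=
  \bigcap_n \bigcup_(v in [set` [seq v <- words n | word12 v]]) cell v.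

Lemma Omega_nullE : Omega q SG = SG `\` (top_null `|` bottom_null).
Proof.
have half (a : R) : 0 <= a -> (forall n, a <= 2 ^- n * (1 + diam q)) -> a = 0.
  move=> a0 H; apply/eqP; rewrite eq_le a0 andbT.
  by apply: (@cvgr_to_ge _ \oo _ _ _ _ _ (cvg_half (1 + diam q))); apply: nearW.
have d0 := diam_ge0 q.
apply/seteqP; split => x [sx nx]; split => //.
  move=> [tx|bx]; apply: nx; [left|right].
    have : x - q 0 = 0.
      apply/normr0_eq0; apply: half => // n.
      have [y sy <-] := tx n I.
      have -> : contrw q (nseq n 0) y - q 0 = contrw q (nseq n 0) y - contrw q (nseq n 0) (q 0).
        by rewrite contrw_nseq.
      apply: le_trans (contrw_dist hq _ _ _) _.
      - exact: (SG_tri hq hSG sy).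
      - exact: tri_q.
      by rewrite size_nseq ler_wpM2l ?invr_ge0 ?exprn_ge0 // lerDr.
    by move=> /eqP; rewrite subr_eq0 => /eqP.
  apply/(segLE hq (SG_tri hq hSG sx)); apply: half; first exact: (SG_tri hq hSG sx).
  move=> n; have [v] := bx n I; rewrite /= mem_filter mem_words => /andP[bv /eqP sv] [y sy <-].
  have := bary_contrwB hq 0 v y (q 1).
  have /eqP -> : bary q 0 (contrw q v (q 1)) == 0 by rewrite (bary0_contrw hq) ?bv ?(bary_q hq) //=; exact: tri_q.
  rewrite (bary_q hq) /= !subr0 => ->; rewrite sv ler_wpM2l ?invr_ge0 ?exprn_ge0 //.
  by apply: le_trans (bary_le1 hq 0 (SG_tri hq hSG sy)) _; rewrite lerDl.
move=> [xq|lx]; apply: nx; [left|right] => n _.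
  by exists (q 0); [exact: (SG_q hq hSG)|rewrite xq contrw_nseq].
have [v [y [sv sy xy]]] := SG_dec hSG n sx.
exists v; last by rewrite xy; exists y.
rewrite /= mem_filter mem_words sv eqxx andbT.
have : bary q 0 x == 0 by have /(segLE hq (SG_tri hq hSG sx)) -> := lx.
by rewrite xy (bary0_contrw hq) => [/andP[]//|]; exact: (SG_tri hq hSG sy).
Qed.

Lemma top_measurable : measurable top_null.
Proof. by apply: bigcapT_measurable => n; exact: cell_measurable. Qed.

Lemma bottom_measurable : measurable bottom_null.
Proof.
apply: bigcapT_measurable => n; apply: fin_bigcup_measurable => // v _; exact: cell_measurable.
Qed.

Lemma Omega_measurable : measurable (Omega q SG).
Proof.
rewrite Omega_nullE; apply: measurableD; first by rewrite -(cell_nil q SG); exact: cell_measurable.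
by apply: measurableU; [exact: top_measurable|exact: bottom_measurable].
Qed.

Lemma null_of_bound (A : set (plane R)) (e : nat -> R) :
  e @ \oo --> 0 -> (forall n, (mu A <= (e n)%:E)%E) -> mu A = 0%E.
Proof.
move=> e0 H; apply/eqP; rewrite eq_le measure_ge0 andbT.
have fA : mu A \is a fin_num.
  by rewrite ge0_fin_numE //; apply: le_lt_trans (H 0%N) _; exact: ltry.
rewrite -(fineK fA) lee_fin.
apply: (@cvgr_to_ge _ \oo _ _ _ _ _ e0); apply: nearW => n.
by rewrite -lee_fin fineK.
Qed.

Lemma cvg_ratio (r : R) : 0 <= r -> r < 1 -> (fun n => r ^+ n) @ \oo --> (0 : R).
Proof.
move=> r0 r1; rewrite [X in X @ _ --> _](_ : _ = geometric 1 r).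
  by apply: cvg_geometric; rewrite ger0_norm.
by apply/funext => n; rewrite /geometric /= mul1r.
Qed.

Lemma top_mu0 : mu top_null = 0%E.
Proof.
apply: (@null_of_bound _ (fun n => 3^-1 ^+ n)).
  by apply: cvg_ratio; rewrite ?invr_ge0 // invf_lt1 // ltr1n.
move=> n; apply: (@le_trans _ _ (mu (cell (nseq n 0)))).
  by apply: le_measure; rewrite ?inE; [exact: top_measurable|exact: cell_measurable|move=> x; apply].
by rewrite hmu size_nseq exprVn.
Qed.

Lemma bad_count n : size [seq v <- words n | word12 v] = (2 ^ n)%N.
Proof.
elim: n => // n IH; rewrite wordsS size_filter.
rewrite -sum1_count big_mkcond big_allpairs_dep expnS -IH size_filter -sum1_count big_distrr /=.
rewrite [RHS]big_mkcond; apply: eq_bigr => w _.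
rewrite !big_cons big_nil /word12 !all_rcons /= -/(word12 w).
by case: (word12 w).
Qed.

Lemma mu_seq_le (s : seq (seq 'I_3)) n : all (fun w => size w == n) s ->
  (mu (\bigcup_(v in [set` s]) cell v) <= ((size s)%:R * 3 ^- n)%:E)%E.
Proof.
elim: s => [|w s IH] /=.
  by move=> _; rewrite set_nil bigcup_set0 measure0 mul0r.
move=> /andP[/eqP sw /IH h].
have ms : measurable (\bigcup_(v in [set` s]) cell v).
  by apply: fin_bigcup_measurable => // v _; exact: cell_measurable.
have -> : \bigcup_(v in [set` w :: s]) cell v = cell w `|` \bigcup_(v in [set` s]) cell v.
  apply/seteqP; split => x.
    by move=> [v]; rewrite /= inE => /orP[/eqP -> cx|vs cx]; [left|right; exists v].
  by move=> [cx|[v vs cx]]; [exists w|exists v] => //=; rewrite inE ?eqxx // [v \in s]vs orbT.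
apply: le_trans (measureU2 mu (cell_measurable w) ms) _.
have -> : (size s).+1%:R * 3 ^- n = 3 ^- n + (size s)%:R * 3 ^- n :> R.
  by rewrite -natr1 mulrDl mul1r addrC.
rewrite EFinD; apply: leeD => //.
by rewrite -sw -(hmu w).
Qed.

Lemma bottom_mu0 : mu bottom_null = 0%E.
Proof.
apply: (@null_of_bound _ (fun n => (2 / 3) ^+ n)).
  by apply: cvg_ratio; rewrite ?divr_ge0 // ltr_pdivrMr // mul1r ltr_nat.
move=> n; set s := [seq v <- words n | word12 v].
apply: (@le_trans _ _ (mu (\bigcup_(v in [set` s]) cell v))).
  apply: le_measure; rewrite ?inE; [exact: bottom_measurable| |by move=> x; apply].
  by apply: fin_bigcup_measurable => // v _; exact: cell_measurable.
apply: le_trans (mu_seq_le (n := n) _) _.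
  by apply/allP => v; rewrite mem_filter mem_words => /andP[].
by rewrite bad_count lee_fin natrX expr_div_n.
Qed.

Lemma Omega_mu : mu (Omega q SG) = 1%E.
Proof.
have mSG : measurable SG by rewrite -(cell_nil q SG); exact: cell_measurable.
have mN : measurable (top_null `|` bottom_null).
  by apply: measurableU; [exact: top_measurable|exact: bottom_measurable].
have N0 : mu (top_null `|` bottom_null) = 0%E.
  apply/eqP; rewrite eq_le measure_ge0 andbT.
  apply: (@le_trans _ _ (mu top_null + mu bottom_null)%E).
    exact: (measureU2 mu top_measurable bottom_measurable).
  by rewrite top_mu0 bottom_mu0 adde0.
have SG1 : mu SG = 1%E by rewrite -(cell_nil q SG) hmu /= expr0 invr1.
have h : (mu SG <= mu (Omega q SG) + mu (top_null `|` bottom_null))%E.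
  apply: (@le_trans _ _ (mu (Omega q SG `|` (top_null `|` bottom_null)))).
    apply: le_measure; rewrite ?inE //; first by apply: measurableU => //; exact: Omega_measurable.
    rewrite Omega_nullE => x sx; have [nx|nx] := pselect ((top_null `|` bottom_null) x).
      by right.
    by left.
  exact: (measureU2 mu Omega_measurable mN).
apply/eqP; rewrite eq_le; apply/andP; split.
  by rewrite -SG1; apply: le_measure; rewrite ?inE //; [exact: Omega_measurable|move=> x []].
by move: h; rewrite N0 adde0 SG1.
Qed.

Lemma Omega_mu_fin : (mu (Omega q SG) < +oo)%E.
Proof. by rewrite Omega_mu ltry. Qed.

Section Riemann.
Variable n : nat.
Let N := size (words n).
Let F i := cell (nth [::] (words n) i).
(** Cells overlap at junctions; removing the earlier ones partitions SG. *)
Let D := seqDU F.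

Let mD i : measurable (D i).
Proof. by apply: seqDU_measurable => j; exact: cell_measurable. Qed.

Lemma piece_exists x : SG x -> exists2 i, (i < N)%N & D i x.
Proof.
move=> sx; have [w [sw cw]] := address hSG n sx.
have ex : exists i, `[< (i < N)%N /\ F i x >].
  have wi : w \in words n by rewrite mem_words sw.
  by exists (index w (words n)); apply/asboolP; rewrite index_mem wi; split => //; rewrite /F nth_index.
case: (ex_minnP ex) => i /asboolP[iN Fx] min; exists i => //; split => //.
rewrite -bigcup_mkord => -[k /= ki Fk].
have hk : `[< (k < N)%N /\ F k x >].
  by apply/asboolP; split => //; apply: ltn_trans ki iN.
by have := min k hk; rewrite leqNgt ki.
Qed.

Definition simple (g : nat -> R) (x : plane R) : R := \sum_(i < N) g i * \1_(D i) x.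

Lemma simpleE g i x : (i < N)%N -> D i x -> simple g x = g i.
Proof.
move=> iN Dx; rewrite /simple (bigD1 (Ordinal iN)) //= indicE mem_set // mulr1.
rewrite big1 ?addr0 // => j ji; rewrite indicE; case: (boolP (x \in D j)); rewrite ?mulr0 // => /set_mem Dj.
exfalso; move/eqP: ji; apply; apply/val_inj => /=.
by apply: (@trivIset_seqDU _ F j i I I); exists x.
Qed.

Let O := Omega q SG.
Let mO : measurable O := Omega_measurable.

Lemma indic_integrable i (c : R) : mu.-integrable O (EFin \o (fun x => c * \1_(D i) x)).
Proof.
apply: measurable_bounded_integrable => //.
- exact: Omega_mu_fin.
- by apply: measurable_funM; [exact: measurable_cst|exact: measurable_indic].
exists `|c|; split; first exact: num_real.
move=> M cM x _ /=; apply: le_trans (ltW cM); rewrite normrM indicE.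
by case: (x \in _); rewrite ?normr1 ?normr0 ?mulr1 ?mulr0.
Qed.

Lemma simple_integrable g : mu.-integrable O (EFin \o simple g).
Proof.
rewrite /simple; elim: N => [|k IH].
  rewrite (_ : _ \o _ = EFin \o (fun x => 0 * \1_(D 0) x)); first exact: indic_integrable.
  by apply/funext => x /=; rewrite big_ord0 mul0r.
rewrite (_ : _ \o _ = ((EFin \o (fun x => \sum_(i < k) g i * \1_(D i) x)%R) \+
   (EFin \o (fun x => g k * \1_(D k) x)%R))%E).
  by apply: integrableD => //; exact: indic_integrable.
by apply/funext => x /=; rewrite big_ord_recr /= EFinD.
Qed.

Lemma simple_integral g : \int[mu]_(x in O) simple g x = \sum_(i < N) g i * fine (mu (D i `&` O)).
Proof.
rewrite /simple; elim: N => [|k IH].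
  rewrite big_ord0 -[RHS](mul0r (fine (mu O))) -(Rintegral_cst mu mO).
  by apply: eq_Rintegral => x _; rewrite big_ord0.
rewrite big_ord_recr /= -IH.
transitivity (\int[mu]_(x in O) (\sum_(i < k) g i * \1_(D i) x + g k * \1_(D k) x)).
  by apply: eq_Rintegral => x _; rewrite big_ord_recr.
have ik : mu.-integrable O (EFin \o (fun x => \sum_(i < k) g i * \1_(D i) x)).
  elim: k {IH} => [|k IHk].
    rewrite (_ : _ \o _ = EFin \o (fun x => 0 * \1_(D 0) x)); first exact: indic_integrable.
    by apply/funext => x /=; rewrite big_ord0 mul0r.
  rewrite (_ : _ \o _ = ((EFin \o (fun x => \sum_(i < k) g i * \1_(D i) x)%R) \+
     (EFin \o (fun x => g k * \1_(D k) x)%R))%E).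
    by apply: integrableD => //; exact: indic_integrable.
  by apply/funext => x /=; rewrite big_ord_recr /= EFinD.
rewrite (RintegralD mO ik (indic_integrable k (g k))); congr (_ + _).
rewrite RintegralZl //; last first.
  have := indic_integrable k 1; congr (mu.-integrable O _).
  by apply/funext => x /=; rewrite mul1r.
by rewrite /Rintegral integral_indic.
Qed.

(** Each of the 3^n disjoint pieces has mass at most 3^-n and together they have mass 1, so every
    bound is an equality. *)
Lemma piece_mu i : (i < N)%N -> fine (mu (D i `&` O)) = 3 ^- n.
Proof.
have le j : (j < N)%N -> fine (mu (D j `&` O)) <= 3 ^- n.
  move=> jN; rewrite -lee_fin fineK; last first.
    by apply: fin_num_measure; apply: measurableI.
  have sj : size (nth [::] (words n) j) = n by apply/eqP; rewrite -mem_words mem_nth.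
  rewrite -[in leRHS]sj -hmu; apply: le_measure; rewrite ?inE.
  - exact: measurableI.
  - exact: cell_measurable.
  - by move=> x [[]].
have s1 : \sum_(j < N) fine (mu (D j `&` O)) = 1.
  have e1 : \int[mu]_(x in O) simple (fun=> 1) x = \int[mu]_(x in O) 1.
    apply: eq_Rintegral => x /set_mem ox.
    by have [j jN Dj] := piece_exists (Omega_SG ox); rewrite (simpleE _ jN Dj).
  have e2 : \int[mu]_(x in O) 1 = 1.
    by rewrite (Rintegral_cst mu mO) mul1r; exact: (congr1 fine Omega_mu).
  rewrite -[RHS]e2 -e1 simple_integral; apply: eq_bigr => j _.
  by rewrite mul1r.
have sz : N%:R * 3 ^- n = 1 :> R.
  have -> : N = (3 ^ n)%N.
    rewrite /N; elim: (n) => // k IH; rewrite wordsS size_allpairs IH /= expnSr //.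
  by rewrite natrX divff // expf_neq0.
move=> iN; apply/eqP; rewrite eq_le le //=.
have : \sum_(j < N) (3 ^- n - fine (mu (D j `&` O))) = 0.
  by rewrite sumrB s1 sumr_const card_ord -[X in X - _]mulr_natl sz subrr.
move=> /eqP; rewrite psumr_eq0 => [/allP/(_ (Ordinal iN))|j _]; last by rewrite subr_ge0 le.
by rewrite mem_index_enum => /(_ isT) /=; rewrite subr_eq0 => /eqP ->.
Qed.

Lemma simple_integral_words (g : seq 'I_3 -> R) :
  \int[mu]_(x in O) simple (fun i => g (nth [::] (words n) i)) x = \sum_(w <- words n) 3 ^- n * g w.
Proof.
rewrite simple_integral (big_nth [::]) big_mkord; apply: eq_bigr => i _.
by rewrite piece_mu // mulrC.
Qed.

Lemma simple_cell g x : SG x -> exists2 w, size w = n /\ cell w x &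
  simple (fun i => g (nth [::] (words n) i)) x = g w.
Proof.
move=> sx; have [i iN Dx] := piece_exists sx; exists (nth [::] (words n) i).
  by split; [apply/eqP; rewrite -mem_words mem_nth|case: Dx].
exact: simpleE.
Qed.

End Riemann.

(** f is a uniform limit of simple functions on Omega, which gives measurability, integrability and
    the error bound together. *)
Lemma Riemann_sum (f : plane R -> R) (g : seq 'I_3 -> R) (e : nat -> R) :
  e @ \oo --> 0 ->
  (forall w x, Omega q SG x -> cell w x -> `|f x - g w| <= e (size w)) ->
  forall n, `|\int[mu]_(x in Omega q SG) f x - \sum_(w <- words n) 3 ^- n * g w| <= e n.
Proof.
move=> e0 H n; have mO := Omega_measurable.
pose h k := simple k (fun i => g (nth [::] (words k) i)).
have hf k x : Omega q SG x -> `|f x - h k x| <= e k.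
  move=> ox; have [w [<- cw] hw] := simple_cell k g (Omega_SG ox).
  by rewrite /h hw; exact: H.
have h_int k : mu.-integrable (Omega q SG) (EFin \o h k) by exact: simple_integrable.
have mf : measurable_fun (Omega q SG) f.
  apply: (measurable_fun_cvg (h := h)) => [k|x ox].
    by have /integrableP[/measurable_EFinP] := h_int k.
  apply/cvgrPdist_le => d d0; have /cvgrPdist_le/(_ d d0) := e0; apply: filterS => k.
  rewrite sub0r normrN => ek; apply: le_trans (hf k x ox) _.
  exact: le_trans (ler_norm _) ek.
have d_int k : mu.-integrable (Omega q SG) (EFin \o (fun x => f x - h k x)).
  apply: measurable_bounded_integrable => //; first exact: Omega_mu_fin.
    apply: measurable_funB => //.
    by have /integrableP[/measurable_EFinP] := h_int k.
  exists (e k); split; first exact: num_real.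
  by move=> M eM x ox /=; apply: le_trans (hf k x ox) (ltW eM).
have f_int : mu.-integrable (Omega q SG) (EFin \o f).
  rewrite (_ : EFin \o f = ((EFin \o (fun x => f x - h n x)%R) \+ (EFin \o h n))%E).
    exact: integrableD.
  by apply/funext => x /=; rewrite -EFinD subrK.
rewrite -simple_integral_words -/(h n) -(RintegralB mO f_int (h_int n)).
apply: le_trans (le_normr_Rintegral mO (d_int n)) _.
have n_int : mu.-integrable (Omega q SG) (EFin \o (fun x => `|f x - h n x|)).
  by have := integrable_norm (d_int n).
have c_int : mu.-integrable (Omega q SG) (EFin \o (fun=> e n)).
  apply: measurable_bounded_integrable => //; first exact: Omega_mu_fin.
  exact: bounded_cst.
apply: le_trans (le_Rintegral mO n_int c_int (hf n)) _.
rewrite (Rintegral_cst mu mO) -[leRHS]mulr1; rewrite le_eqVlt; apply/orP; left; apply/eqP; congr (_ * _).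
exact: (congr1 fine Omega_mu).
Qed.

End Measure.

(** * Passage to the limit *)

Lemma seq_max (R : realDomainType) (T : eqType) (s : seq T) (f : T -> R) x0 : x0 \in s ->
  exists2 x, x \in s & forall y, y \in s -> f y <= f x.
Proof.
elim: s x0 => // a s IH x0 _; have [->|[b bs]] : s = [::] \/ exists b, b \in s.
- by case: (s) => [|b l]; [left|right; exists b; rewrite inE eqxx].
- by exists a; rewrite ?inE ?eqxx // => y; rewrite inE => /eqP ->.
have [x xs H] := IH b bs; have [ax|xa] := leP (f a) (f x).
  by exists x; rewrite ?inE ?xs ?orbT // => y; rewrite inE => /orP[/eqP -> //|/H].
exists a; rewrite ?inE ?eqxx // => y; rewrite inE => /orP[/eqP -> //|/H h].
by apply: le_trans h (ltW xa).
Qed.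

Section DiscreteEigenfunctions.
Context {R : realType}.
Variable q : 'I_3 -> plane R.
Hypothesis hq : equilateral q.
Variable SG : set (plane R).
Hypothesis hSG : is_attractor q SG.
Local Notation cell := (@cell R q SG).
Local Notation pt := (@pt R q).
Local Notation ref := (@ref R q).
Local Notation energym := (@energym R q).
Local Notation Star := (VOmegaStar q).

Lemma size_words n : size (words n) = (3 ^ n)%N.
Proof. by elim: n => // n IH; rewrite wordsS size_allpairs IH /= expnSr. Qed.

Lemma sum_words_le n (h : seq 'I_3 -> R) B : (forall w, size w = n -> `|h w| <= B) ->
  `|\sum_(w <- words n) 3 ^- n * h w| <= B.
Proof.
move=> H; apply: le_trans (ler_norm_sum _ _ _) _.
have -> : B = \sum_(w <- words n) 3 ^- n * B.
  rewrite big_const_seq count_predT iter_addr addr0 -mulrnAl -[3 ^- n *+ _]mulr_natl size_words.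
  by rewrite natrX divff ?mul1r // expf_neq0.
rewrite big_seq [leRHS]big_seq; apply: ler_sum => w; rewrite mem_words => /eqP sw.
rewrite normrM ger0_norm ?invr_ge0 ?exprn_ge0 // ler_wpM2l ?invr_ge0 ?exprn_ge0 //.
exact: H.
Qed.

Lemma gcorners_star m c : c \in gcorners m -> Star (pt c).
Proof.
rewrite mem_gcorners => /andP[gc /eqP sc]; exists m => //; apply/(VOmegaP hq).
by exists c.1, c.2; split => //; apply: onL_good.
Qed.

Lemma star_ext (u v w : plane R -> R) m : (forall x, Star x -> u x = v x) ->
  EE q m u w = EE q m v w /\ MP q m u w = MP q m v w.
Proof.
move=> H; split.
  rewrite /EE big_seq [RHS]big_seq; apply: eq_bigr => z zg; apply: eq_bigr => ij _.
  by rewrite !H //; apply: (@gcorners_star m); rewrite mem_gcorners -mem_gwords.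
rewrite /MP; congr (_ * _); rewrite big_seq [RHS]big_seq; apply: eq_bigr => c cg.
by rewrite H //; apply: gcorners_star cg.
Qed.

Lemma MP_le m u : (forall x, VOmega q m x -> `|u x| <= 1) ->
  0 <= 3 ^- m * MP q m u u /\ 3 ^- m * MP q m u u <= 3 / 2.
Proof.
move=> H; split; first by rewrite MP_Mf mulr_ge0 ?Mf_ge0 // invr_ge0 exprn_ge0.
have le1 : \sum_(c <- gcorners m) u (pt c) * u (pt c) <= (size (gcorners m))%:R.
  rewrite -sum1_size natr_sum big_seq [leRHS]big_seq; apply: ler_sum => c cg.
  rewrite -expr2 -real_normK ?num_real // exprn_ile1 //.
  move: cg; rewrite mem_gcorners => /andP[gc /eqP sc]; apply: H; apply/(VOmegaP hq).
  by exists c.1, c.2; split => //; apply: onL_good.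
have sz : (size (gcorners m) <= 3 * 3 ^ m)%N.
  rewrite size_allpairs mulnC leq_mul2l /= /gwords size_filter.
  by rewrite -size_words count_size.
have sz' : (size (gcorners m))%:R <= 3 * 3 ^+ m :> R by rewrite -natrX -natrM ler_nat.
have e : 3 / 2 = 3 ^- m * (2^-1 * (3 * 3 ^+ m)) :> R.
  have : (3 : R) ^+ m != 0 by rewrite expf_neq0.
  by move: (3 ^+ m) => z z0; field.
rewrite e ler_wpM2l ?invr_ge0 ?exprn_ge0 // /MP ler_wpM2l //.
exact: le_trans le1 sz'.
Qed.

(** Setting the function to 0 off Omega_* makes the sequence of these eigenfunctions eventually
    bounded at every point of the plane, so that ultralimits exist everywhere. *)
Lemma normalised_eigenfunction m l : (0 < m)%N -> PNm q SG m l -> exists v : plane R -> R,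
  [/\ forall x, ~ Star x -> v x = 0,
     forall x, VOmega q m x -> `|v x| <= 1,
     exists2 x, VOmega q m x & `|v x| = 1,
     forall w, EE q m v w = l * MP q m v w &
     forall w, word12 w -> forall x, cell w x -> VOmega q m x -> v (cellrefl q w x) = v x].
Proof.
move=> m0 [u [nu Hu]].
have [[y vy uy] _ _] := nu.
have [c cg cy] := good_rep hq m0 vy.
have [d dg dmax] := seq_max (fun c => `|u (pt c)|) cg.
have M0 : 0 < `|u (pt d)| by apply: lt_le_trans (dmax c cg); rewrite cy normr_gt0.
have st x : VOmega q m x -> Star x by move=> vx; exists m.
have vd : VOmega q m (pt d).
  apply/(VOmegaP hq); move: dg; rewrite mem_gcorners => /andP[gd /eqP sd].
  by exists d.1, d.2; split => //; apply: onL_good.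
pose v x := if `[< Star x >] then `|u (pt d)|^-1 * u x else 0.
have vE x : Star x -> v x = `|u (pt d)|^-1 * u x by move=> sx; rewrite /v asboolT.
exists v; split.
- by move=> x nx; rewrite /v asboolF.
- move=> x vx; rewrite (vE _ (st _ vx)) normrM normfV normr_id.
  have [c' cg' <-] := good_rep hq m0 vx.
  by rewrite mulrC ler_pdivrMr // mul1r; exact: dmax.
- exists (pt d) => //; rewrite (vE _ (st _ vd)) normrM normfV normr_id mulVf //.
  by rewrite gt_eqF.
- move=> w; have [-> ->] := @star_ext v (fun x => `|u (pt d)|^-1 * u x) w m vE.
  rewrite EE_Ef Ef_scale MP_Mf Mf_scale -EE_Ef -MP_Mf.
  by rewrite (neumann_weak hq w m0 nu) mulrCA.
move=> w bw x cx vx.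
have vx' : VOmega q m (cellrefl q w x).
  move: cx vx => [z sz zx] /(VOmegaP hq)[w1 [i [sw1 xw nL]]].
  have [/prefixP[z' /= ez]|e] := prefix_rep hq (c := (w1, i)) bw (SG_tri hq hSG sz) (etrans (esym xw) (esym zx)) nL.
    apply/(VOmegaP hq); exists (w ++ map swap12 z'), (swap12 i).
    rewrite onL_swap -ez nL; split => //.
      by rewrite -sw1 ez !size_cat size_map.
    have /= := pt_rho hq w z' i; rewrite /pt /= => ->.
    by rewrite -ez xw.
  have xr : x = ref w by rewrite -e xw.
  rewrite xr (cellrefl_ref hq) -xr; apply/(VOmegaP hq).
  by exists w1, i.
by rewrite (vE _ (st _ vx')) (vE _ (st _ vx)) Hu.
Qed.

Lemma product_diff (a b c d : R) : `|a * b - c * d| <= `|a - c| * `|b| + `|c| * `|b - d|.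
Proof.
have -> : a * b - c * d = (a - c) * b + c * (b - d) by ring.
by apply: le_trans (ler_normD _ _) _; rewrite !normrM.
Qed.

Lemma star_bounded u C : bndE q u C -> exists2 W, 0 <= W & forall x, Star x -> `|u x| <= W.
Proof.
move=> bC; exists (`|u (ref [::])| + 10 * C); first by case: bC => C0 _; rewrite addr_ge0 // mulr_ge0.
move=> x sx; rewrite -(subrK (u (ref [::])) (u x)) addrC; apply: le_trans (ler_normD _ _) _.
rewrite lerD2l; have := star_osc hq hSG (w := [::]) bC sx (ref_star hq [::]).
by rewrite cell_nil expr0 mulr1; apply; [exact: star_SG sx|exact: star_SG (ref_star hq _)].
Qed.

Section Averages.
Variables (m : nat) (C D W : R) (v w : plane R -> R).
Hypotheses (C0 : 0 <= C) (D0 : 0 <= D) (W0 : 0 <= W).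
Hypotheses (eC : energym m v v <= C ^+ 2) (eD : energym m w w <= D ^+ 2).
Hypotheses (v1 : forall x, VOmega q m x -> `|v x| <= 1) (wW : forall x, Star x -> `|w x| <= W).

Let K := C * W + D.
Let K0 : 0 <= K. Proof. by rewrite addr_ge0 // mulr_ge0. Qed.

(** A Riemann sum sampled at the top vertices of the cells: these lie in Omega_* even if the cell
    touches L. *)
Definition avg n (f : plane R -> R) : R := \sum_(z <- words n) 3 ^- n * f (ref z).

Lemma avg_step k : (k < m)%N ->
  `|avg k.+1 (fun x => v x * w x) - avg k (fun x => v x * w x)| <= K * rho45 ^+ k.+1.
Proof.
move=> km.
have -> : avg k.+1 (fun x => v x * w x) - avg k (fun x => v x * w x) =
   \sum_(z <- words k.+1) 3 ^- k.+1 * (v (ref z) * w (ref z) - v (ref (take k z)) * w (ref (take k z))).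
  under [RHS]eq_bigr do rewrite mulrBr.
  rewrite sumrB; congr (_ - _).
  rewrite [RHS]big_wordsS /avg; apply: eq_big_seq => z.
  rewrite mem_words => /eqP sz.
  have tk i : take k (rcons z i) = z by rewrite -sz -cats1 take_size_cat.
  rewrite big3 !tk exprS invfM.
  by field.
apply: sum_words_le => z sz.
have [z' [i ez]] : exists z' i, z = rcons z' i by case/lastP: z sz => // z' i _; exists z', i.
have sz' : size z' = k by move: sz; rewrite ez size_rcons => -[].
rewrite ez -sz' -cats1 take_size_cat // cats1; apply: le_trans (product_diff _ _ _ _) _.
rewrite /K mulrDl; apply: lerD.
  rewrite mulrAC; apply: ler_pM => //; last by apply: wW; exact: (ref_star hq).
  by apply: (ref_step hq C0 eC); rewrite sz'.
rewrite -[leRHS]mul1r; apply: ler_pM => //.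
  by apply: v1; apply: (VOmega_le hq (ltnW km)); exact: (ref_VOmega hq).
by apply: (ref_step hq D0 eD); rewrite sz'.
Qed.

Lemma avg_chain k : (k <= m)%N ->
  `|avg m (fun x => v x * w x) - avg k (fun x => v x * w x)| <= 4 * K * rho45 ^+ k.
Proof.
have r0 := @rho_gt0 R.
pose A n := avg n (fun x => v x * w x); rewrite -!/(A _).
suff H d : (d <= m)%N -> forall k, (k <= d)%N -> `|A d - A k| <= 4 * K * (rho45 ^+ k - rho45 ^+ d).
  move=> km; apply: le_trans (H m _ _ km) _ => //.
  by rewrite ler_wpM2l ?mulr_ge0 // gerBl ltW.
elim: d => [|d IH] dm k'.
  by rewrite leqn0 => /eqP ->; rewrite !subrr normr0 mulr0.
rewrite leq_eqVlt => /orP[/eqP ->|kd]; first by rewrite !subrr normr0 mulr0.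
rewrite -(subrK (A d) (A d.+1)) -addrA; apply: le_trans (ler_normD _ _) _.
apply: le_trans (lerD (avg_step dm) (IH (ltnW dm) _ _)) _ => //.
rewrite exprS /rho45; move: (K0) (r0 d) (r0 k'); rewrite /rho45; nra.
Qed.

End Averages.
End DiscreteEigenfunctions.

(** Moore-Osgood exchange of limits, with m along G and n to infinity. *)
Lemma two_scale (R : realType) (G : set_system nat) (FG : Filter G) (a : nat -> R) (b : nat -> nat -> R)
    (b' e : nat -> R) (l : R) : e @ \oo --> 0 -> b' @ \oo --> l ->
  (forall n, \forall m \near G, `|a m - b n m| <= e n) -> (forall n, b n m @[m --> G] --> b' n) ->
  a m @[m --> G] --> l.
Proof.
move=> e0 bl ab bb; apply/cvgrPdist_le => eps eps0.
have eps3 : 0 < eps / 3 by rewrite divr_gt0.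
have [n [en bn]] : exists n, e n <= eps / 3 /\ `|l - b' n| <= eps / 3.
  have /cvgrPdist_le/(_ _ eps3) H1 := e0; have /cvgrPdist_le/(_ _ eps3) H2 := bl.
  have [n [h1 h2]] := filter_ex (filterI H1 H2).
  by exists n; split => //; apply: le_trans h1; rewrite sub0r normrN ler_norm.
have /cvgrPdist_le/(_ _ eps3) H3 := bb n.
apply: filterS2 (ab n) H3 => m h1 h3.
have -> : l - a m = (l - b' n) + (b' n - b n m) - (a m - b n m) by ring.
have -> : eps = eps / 3 + eps / 3 + eps / 3 by field.
apply: le_trans (ler_normB _ _) _; rewrite lerD ?(le_trans h1) //.
by apply: le_trans (ler_normD _ _) _; rewrite lerD.
Qed.

Lemma cvg_zero_dist (R : realType) (a e : nat -> R) (l : R) :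
  e @ \oo --> 0 -> (forall n, `|l - a n| <= e n) -> a @ \oo --> l.
Proof.
move=> e0 H; apply/cvgrPdist_le => eps eps0; have /cvgrPdist_le/(_ _ eps0) := e0.
by apply: filterS => n h; apply: le_trans (H n) _; apply: le_trans h; rewrite sub0r normrN ler_norm.
Qed.

Lemma rho_anti (R : realType) n m : (n <= m)%N -> rho45 ^+ m <= rho45 ^+ n :> R.
Proof.
move=> nm; apply: ler_wiXn2l => //; rewrite /rho45; first by rewrite divr_ge0.
by rewrite ler_pdivrMr // mul1r ler_nat.
Qed.

Section DiscreteToContinuous.
Context {R : realType}.
Variable q : 'I_3 -> plane R.
Hypothesis hq : equilateral q.
Variable SG : set (plane R).
Hypothesis hSG : is_attractor q SG.
Local Notation cell := (@cell R q SG).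
Local Notation pt := (@pt R q).
Local Notation ref := (@ref R q).
Local Notation energym := (@energym R q).
Local Notation Star := (VOmegaStar q).

Section MassAverage.
Variables (m : nat) (C D W : R) (v w : plane R -> R).
Hypotheses (C0 : 0 <= C) (D0 : 0 <= D) (W0 : 0 <= W).
Hypotheses (eC : energym m v v <= C ^+ 2) (eD : energym m w w <= D ^+ 2).
Hypotheses (v1 : forall x, VOmega q m x -> `|v x| <= 1) (wW : forall x, Star x -> `|w x| <= W).

(** A good cell has three corners of weight 1/2, so the factor 2/3 turns its mass into a mean value:
    this is the origin of 3/2 in the theorem. The second error term pays for the 2^m cells touching
    L, which [MP] omits. *)
Lemma mass_avg : `|2 / 3 * (3 ^- m * MP q m v w) - avg q m (fun x => v x * w x)|
  <= (C * W + D) * rho45 ^+ m + W * (2 / 3) ^+ m.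
Proof.
pose p x := v x * w x.
pose h1 z := if word12 z then 0 else 3^-1 * (\sum_i p (pt (z, i))) - p (ref z).
pose h2 z := if word12 z then - p (ref z) else 0.
have -> : 2 / 3 * (3 ^- m * MP q m v w) - avg q m p =
    \sum_(z <- words m) 3 ^- m * h1 z + \sum_(z <- words m) 3 ^- m * h2 z.
  have -> : 2 / 3 * (3 ^- m * MP q m v w) = \sum_(z <- words m) 3 ^- m *
      (if word12 z then 0 else 3^-1 * (\sum_i p (pt (z, i)))).
    rewrite /MP /gcorners big_allpairs_dep /gwords big_filter big_mkcond /= !mulr_sumr.
    apply: eq_bigr => z _; case: (word12 z) => /=; rewrite ?mulr0 // !big_cons big_nil big3 /p.
    by move: (3 ^- m) => r; field.
  rewrite -big_split -sumrB; apply: eq_bigr => z _ /=; rewrite /h1 /h2.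
  by case: (word12 z); ring.
apply: le_trans (ler_normD _ _) _; apply: lerD.
  apply: sum_words_le => z sz; rewrite /h1; case: ifP => bz.
    by rewrite normr0 mulr_ge0 ?addr_ge0 ?mulr_ge0 // ltW ?rho_gt0.
  have gz : ~~ word12 z by rewrite bz.
  have key i : `|p (pt (z, i)) - p (ref z)| <= (C * W + D) * rho45 ^+ m.
    have nL : ~~ onL z i by apply: onL_good.
    apply: le_trans (product_diff _ _ _ _) _; rewrite mulrDl; apply: lerD.
      rewrite mulrAC; apply: ler_pM => //.
        by rewrite -sz; apply: (corner_osc hq C0 eC); rewrite // sz.
      by apply: wW; apply: (@gcorners_star _ _ hq m); rewrite mem_gcorners gz /= sz.
    rewrite -[leRHS]mul1r; apply: ler_pM => //.
      by apply: v1; exact: (ref_VOmega hq).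
    by rewrite -sz; apply: (corner_osc hq D0 eD); rewrite // sz.
  have -> : 3^-1 * (\sum_i p (pt (z, i))) - p (ref z) =
      3^-1 * \sum_i (p (pt (z, i)) - p (ref z)) by rewrite !big3; field.
  rewrite normrM ger0_norm ?invr_ge0 // ler_pdivrMl //.
  apply: le_trans (ler_norm_sum _ _ _) _; rewrite big3.
  have -> : 3 * ((C * W + D) * rho45 ^+ m) = (C * W + D) * rho45 ^+ m + (C * W + D) * rho45 ^+ m + (C * W + D) * rho45 ^+ m by ring.
  by rewrite !lerD.
apply: le_trans (ler_norm_sum _ _ _) _.
rewrite (eq_bigr (fun z => if word12 z then 3 ^- m * `|p (ref z)| else 0)); last first.
  move=> z _; rewrite /h2; case: ifP => _; last by rewrite mulr0 normr0.
  by rewrite normrM normrN ger0_norm // invr_ge0 exprn_ge0.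
rewrite -big_mkcond /=.
apply: (@le_trans _ _ (\sum_(z <- words m | word12 z) 3 ^- m * W)).
  rewrite big_seq_cond [leRHS]big_seq_cond; apply: ler_sum => z /andP[]; rewrite mem_words => /eqP sz _.
  rewrite ler_wpM2l ?invr_ge0 ?exprn_ge0 // /p normrM -[leRHS]mul1r; apply: ler_pM => //.
    by apply: v1; exact: (ref_VOmega hq).
  by apply: wW; exact: (ref_star hq).
rewrite -big_filter big_const_seq count_predT bad_count iter_addr addr0.
rewrite -[leLHS]mulr_natr natrX expr_div_n le_eqVlt; apply/orP; left; apply/eqP.
by move: (3 ^- m) (2 ^+ m) => a b; ring.
Qed.

End MassAverage.

Section Passage.
Variable mu : probability (plane R) R.
Hypothesis hmu : forall w : seq 'I_3, mu (cell w) = (3 ^- size w)%:E.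
Variables (v : nat -> plane R -> R) (lam : nat -> R) (t C : R) (m1 : nat).
Hypothesis C0 : 0 <= C.
Hypothesis v1 : forall m, (m1 <= m)%N -> forall x, VOmega q m x -> `|v m x| <= 1.
Hypothesis eC : forall m, (m1 <= m)%N -> energym m (v m) (v m) <= C ^+ 2.
Hypothesis vlam : forall m, (m1 <= m)%N -> forall w, EE q m (v m) w = lam m * MP q m (v m) w.
Hypothesis lamt : (fun m => 5 ^+ m * lam m) @ \oo --> t.
Variables (G : set_system nat) (UG : UltraFilter G) (hG : \oo `<=` G).
Variable u : plane R -> R.
Hypothesis vu : forall x, v m x @[m --> G] --> u x.

Local Instance ultra_G_proper : ProperFilter G := @ultra_proper _ _ UG.

Lemma nearG n (P : nat -> Prop) : (forall m, (n <= m)%N -> P m) -> \forall m \near G, P m.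
Proof. by move=> H; apply: hG; exists n. Qed.

Lemma star_limit_le1 x : Star x -> `|u x| <= 1.
Proof.
move=> [n _ vx]; apply: (@cvgr_to_le _ G _ _ (fun m => `|v m x|)); first exact: cvg_norm.
apply: (@nearG (maxn n m1)) => m; rewrite geq_max => /andP[nm mm].
exact: v1 mm _ (VOmega_le hq nm vx).
Qed.

Lemma energym_limit n (w : plane R -> R) : energym n (v m) w @[m --> G] --> energym n u w.
Proof.
rewrite (energymE hq); under eq_fun do rewrite (energymE hq).
apply: cvgM; first exact: cvg_cst.
rewrite EE_Ef; under eq_fun do rewrite EE_Ef.
by apply: Ef_cvg => // x; exact: cvg_cst.
Qed.

Lemma limit_bndE : bndE q u C.
Proof.
split=> // n; apply: (@cvgr_to_le _ G _ _ (fun m => energym n (v m) (v m))).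
  rewrite (energymE hq); under eq_fun do rewrite (energymE hq).
  apply: cvgM; first exact: cvg_cst.
  rewrite EE_Ef; under eq_fun do rewrite EE_Ef.
  exact: Ef_cvg.
apply: (@nearG (maxn n m1)) => m; rewrite geq_max => /andP[nm mm].
exact: le_trans (energym_le hq _ nm) (eC mm).
Qed.

Let Fu : FOmega q u. Proof. by apply/(FOmegaP hq); exists C; exact: limit_bndE. Qed.

Lemma energy_limit w : FOmega q w -> energym m (v m) w @[m --> G] --> EOmega q u w.
Proof.
move=> Fw; have cw := EOmega_cvg hq Fw.
pose e n := C * Num.sqrt (EOmega q w w - energym n w w).
apply: (@two_scale _ G _ _ (fun n m => energym n (v m) w) (fun n => energym n u w) e).
- rewrite -(mulr0 C); apply: cvgM; first exact: cvg_cst.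
  rewrite -[X in _ --> X](@sqrtr0 R) -(subrr (EOmega q w w)).
  apply: (@continuous_cvg _ _ _ _ _ _ _ _ (@sqrt_continuous R _)).
  by apply: cvgB => //; exact: cvg_cst.
- exact: (EOmega_cvg2 hq).
- move=> n; apply: (@nearG (maxn n m1)) => m; rewrite geq_max => /andP[nm mm].
  have d0 : 0 <= EOmega q w w - energym n w w by rewrite subr_ge0 (energym_le_EOmega hq).
  rewrite -(@ler_pXn2r _ 2) ?nnegrE ?mulr_ge0 ?sqrtr_ge0 // exprMn sqr_sqrtr // real_normK ?num_real //.
  apply: le_trans (increment_CS hq _ _ nm) _; apply: ler_pM.
  + by rewrite subr_ge0 (energym_le hq).
  + by rewrite subr_ge0 (energym_le hq).
  + by rewrite (le_trans _ (eC mm)) // gerBl (energym_ge0 hq).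
  + by rewrite lerD2r (energym_le_EOmega hq).
move=> n; exact: energym_limit.
Qed.

(** The averages of level n mediate: uniformly in large m they are close to the mass of level m, for
    fixed n they converge pointwise along G, and in n they are Riemann sums of the integral. *)
Lemma mass_limit V : Ftilde q V ->
  2 / 3 * (3 ^- m * MP q m (v m) (on_star V)) @[m --> G] -->
    \int[mu]_(x in Omega q SG) (on_Omega q (Uext u) x * on_Omega q V x).
Proof.
move=> FV; have [_ Fw] := FV; have bD := bndE_sqrt hq Fw.
set w := on_star V in Fw bD *; set D := Num.sqrt _ in bD; have [D0 eD] := bD.
have [W W0 wW] := star_bounded hq hSG bD.
pose K := C * W + D; have K0 : 0 <= K by rewrite addr_ge0 // mulr_ge0.
have FU := Uext_Ftilde hq hSG Fu.
set I := \int[mu]_(x in _) _.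
have RI : (fun n => avg q n (fun x => u x * w x)) @ \oo --> I.
  pose e n := 7 * (C * (W + 7 * D) + D) * rho45 ^+ n.
  have e0 : e @ \oo --> 0 by apply: rho_cvg0.
  apply: (cvg_zero_dist e0) => n; apply: (Riemann_sum hq hSG hmu e0 (g := fun z => u (ref z) * w (ref z))).
  move=> z x ox cx; apply: le_trans (product_diff _ _ _ _) _.
  have bU : bndE q (on_star (Uext u)) C by rewrite on_star_Uext; exact: limit_bndE.
  have hU := on_Omega_cell hq hSG FU bU ox cx; rewrite on_star_Uext in hU.
  have hV := on_Omega_cell hq hSG FV bD ox cx; rewrite -/w in hV.
  have sz := ref_star hq z.
  have bV : `|on_Omega q V x| <= W + 7 * D.
    rewrite -(subrK (w (ref z)) (on_Omega q V x)) addrC; apply: le_trans (ler_normD _ _) _.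
    apply: lerD; first exact: wW.
    apply: le_trans hV _; rewrite -[leRHS]mulr1 ler_wpM2l ?mulr_ge0 //.
    by rewrite -(expr0 rho45) rho_anti.
  have -> : e (size z) = 7 * C * rho45 ^+ size z * (W + 7 * D) + 1 * (7 * D * rho45 ^+ size z).
    by rewrite /e; ring.
  apply: lerD; apply: ler_pM => //; exact: star_limit_le1.
pose e n := 5 * K * rho45 ^+ n + W * (2 / 3) ^+ n.
apply: (@two_scale _ G _ _ (fun n m => avg q n (fun x => v m x * w x)) _ e _ _ RI).
- rewrite -(addr0 0); apply: cvgD; first exact: rho_cvg0.
  rewrite -(mulr0 W); apply: cvgM; first exact: cvg_cst.
  by apply: cvg_ratio; rewrite ?divr_ge0 // ltr_pdivrMr // mul1r ltr_nat.
- move=> n; apply: (@nearG (maxn n m1)) => m; rewrite geq_max => /andP[nm mm].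
  have h1 := mass_avg C0 D0 W0 (eC mm) (eD m) (v1 mm) wW.
  have h2 := avg_chain hq C0 D0 W0 (eC mm) (eD m) (v1 mm) wW nm.
  rewrite -/K in h1 h2; rewrite -(subrK (avg q m (fun x => v m x * w x)) (_ * (_ * _))) -addrA.
  apply: le_trans (ler_normD _ _) _; apply: le_trans (lerD h1 h2) _.
  have r1 : rho45 ^+ m <= rho45 ^+ n :> R by apply: rho_anti.
  have r2 : (2 / 3) ^+ m <= (2 / 3) ^+ n :> R.
    by apply: ler_wiXn2l => //; rewrite ?divr_ge0 // ler_pdivrMr // mul1r ler_nat.
  have := ler_wpM2l K0 r1; have := ler_wpM2l W0 r2; rewrite /e.
  move: (K * rho45 ^+ m) (W * (2 / 3) ^+ m) (W * (2 / 3) ^+ n) => a b c.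
  by rewrite -!mulrA; move: (K * rho45 ^+ n) => d *; lra.
move=> n; apply: cvg_bigsum => z; apply: cvgM; first exact: cvg_cst.
by apply: cvgM => //; exact: cvg_cst.
Qed.

Lemma limit_weak V : Ftilde q V -> Etilde q (Uext u) V =
  3 / 2 * t * \int[mu]_(x in Omega q SG) (on_Omega q (Uext u) x * on_Omega q V x).
Proof.
move=> FV; have [_ Fw] := FV; rewrite /Etilde on_star_Uext.
apply: (cvg_unique _ (energy_limit Fw)) => //.
set I := \int[mu]_(x in _) _.
have -> : 3 / 2 * t * I = t * (3 / 2 * I) by ring.
(* By the weak equation of level m, (5/3)^m EE = (5^m lam_m) (3^-m MP); the two factors converge
   separately. *)
have H : (5 ^+ m * lam m) * (3 / 2 * (2 / 3 * (3 ^- m * MP q m (v m) (on_star V)))) @[m --> G] --> t * (3 / 2 * I).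
  apply: cvgM; first exact: (cvg_trans (cvg_app _ hG) lamt).
  by apply: cvgM; [exact: cvg_cst|exact: mass_limit].
apply: cvg_trans H; apply: near_eq_cvg; apply: (@nearG m1) => m mm.
rewrite (energymE hq) (vlam mm) expr_div_n.
by move: (MP _ _ _ _) (3 ^- m) (5 ^+ m) => a b c; field.
Qed.

End Passage.
End DiscreteToContinuous.

(** * Symmetry, nonvanishing and eigenvalue equation of the limit *)

Lemma eq_of_dist (R : realType) (a b : R) (e : nat -> R) :
  e @ \oo --> 0 -> (forall n, `|a - b| <= e n) -> a = b.
Proof.
move=> e0 H; apply/eqP; rewrite -subr_eq0 -normr_eq0 eq_le normr_ge0 andbT.
exact: (cvgr_to_ge e0 (nearW _ H)).
Qed.

Section LimitEigenfunction.
Context {R : realType}.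
Variable q : 'I_3 -> plane R.
Hypothesis hq : equilateral q.
Variable SG : set (plane R).
Hypothesis hSG : is_attractor q SG.
Local Notation cell := (@cell R q SG).
Local Notation pt := (@pt R q).
Local Notation ref := (@ref R q).
Local Notation energym := (@energym R q).
Local Notation Star := (VOmegaStar q).

Lemma Omega_cellrefl w x : cell w x -> Omega q SG x -> Omega q SG (cellrefl q w x).
Proof.
move=> [y sy <-] [sx nx]; have ty := SG_tri hq hSG sy; rewrite (cellrefl_contrw hq).
have tr := refl_tri hq ty; split; first by apply: (SG_contrw hSG); exact: (SG_refl hq hSG).
move=> [e|lx]; apply: nx; [left|right].
  have [-> e'] := contrw_eq_q hq tr e; have e0 := refl_q hq 0; rewrite swap12E in e0.
  have -> : y = q 0 by apply: (refl_inj hq); rewrite e' e0.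
  by rewrite contrw_nseq.
move: lx; rewrite (segLE hq (tri_contrw hq _ tr)) => /eqP.
rewrite (bary0_contrw hq _ tr) (bary_refl hq) swap12E -(bary0_contrw hq _ ty) => /eqP.
by rewrite -(segLE hq (tri_contrw hq _ ty)).
Qed.

(** Points of Omega need not lie in Omega_*, so both values are approximated by reference points.
    Mirrored addresses have reference points exchanged by R_w, each within 7 C rho^n; hence 14 C. *)
Lemma symmetric_extension u C : bndE q u C -> FOmega q u ->
  (forall w x, word12 w -> cell w x -> Star x -> u (cellrefl q w x) = u x) ->
  symmetric_primitive q SG (Uext u).
Proof.
move=> bC Fu usym w bw x cx ox.
have FU := Uext_Ftilde hq hSG Fu.
have bU : bndE q (on_star (Uext u)) C by rewrite on_star_Uext.
have ox' := Omega_cellrefl cx ox.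
have [y sy xy] := cx.
set a := on_Omega q (Uext u) _; set b := on_Omega q (Uext u) x.
apply: (eq_of_dist (@rho_cvg0 R (14 * C))) => n.
have [v [sv [z sz yz]]] := address hSG n sy.
have c1 : cell (w ++ v) x by exists z; rewrite // contrw_cat yz.
have c2 : cell (w ++ map swap12 v) (cellrefl q w x).
  by exists (cellrefl q [::] z); [exact: (SG_refl hq hSG)|rewrite contrw_cat -(refl_contrw hq) yz -(cellrefl_contrw hq) xy].
have h1 := on_Omega_cell hq hSG FU bU ox c1; have h2 := on_Omega_cell hq hSG FU bU ox' c2.
have e : u (ref (w ++ map swap12 v)) = u (ref (w ++ v)).
  rewrite /ref -{1}swap12E (pt_rho hq) usym //; last exact: (ref_star hq).
  exact: cell_point.
rewrite !on_star_Uext !size_cat size_map sv e -/a -/b in h1 h2.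
have r : C * rho45 ^+ (size w + n) <= C * rho45 ^+ n.
  by rewrite ler_wpM2l ?rho_anti ?leq_addl //; case: bC.
have -> : a - b = (a - u (ref (w ++ v))) - (b - u (ref (w ++ v))) by ring.
apply: le_trans (ler_normB _ _) _; apply: le_trans (lerD h2 h1) _.
by rewrite -!mulrA; move: r; move: (C * _) (C * _) => ? ? h; clear -h; lra.
Qed.

Theorem limit_eigen (mu : probability (plane R) R) (lam : nat -> R) (m0 : nat) (t : R) :
  (forall w : seq 'I_3, mu (cell w) = (3 ^- size w)%:E) ->
  (forall m, (m0 <= m)%N -> PNm q SG m (lam m)) -> (fun m => 5 ^+ m * lam m) @ \oo --> t ->
  PN q SG mu (3 / 2 * t).
Proof.
move=> hmu hlam ht.
have /choice[v Hv] : forall m, exists v : plane R -> R, (maxn m0 1 <= m)%N ->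
    [/\ forall x, ~ Star x -> v x = 0,
     forall x, VOmega q m x -> `|v x| <= 1,
     exists2 x, VOmega q m x & `|v x| = 1,
     forall w, EE q m v w = lam m * MP q m v w &
     forall w, word12 w -> forall x, cell w x -> VOmega q m x -> v (cellrefl q w x) = v x].
  move=> m; have [h|h] := leqP (maxn m0 1) m; last by exists (fun=> 0).
  move: (h); rewrite geq_max => /andP[h1 h2].
  by have [v H] := normalised_eigenfunction hq hSG h2 (hlam m h1); exists v.
have [m2 _ hm2] : \forall m \near \oo, 5 ^+ m * lam m <= `|t| + 1.
  have /cvgrPdist_le/(_ 1 ltr01) := ht; apply: filterS => m h.
  have := ler_norm t; have := ler_norm (5 ^+ m * lam m - t); rewrite distrC in h.
  move: (`|5 ^+ m * lam m - t|) (`|t|) (5 ^+ m * lam m) h => a b c; lra.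
(* C^2 has to dominate (|t| + 1) 3/2, the bound on 5^m lam_m times that of [MP_le]; |t| + 2 is large
   enough. *)
pose m1 := maxn m2 (maxn m0 1); pose C := `|t| + 2.
have C0 : 0 <= C by rewrite addr_ge0.
have hm1 m : (m1 <= m)%N -> (m2 <= m)%N /\ (maxn m0 1 <= m)%N by rewrite /m1 geq_max => /andP[].
have v1 m : (m1 <= m)%N -> forall x, VOmega q m x -> `|v m x| <= 1.
  by move=> /hm1[_ /Hv[]].
have vlam m : (m1 <= m)%N -> forall w, EE q m (v m) w = lam m * MP q m (v m) w.
  by move=> /hm1[_ /Hv[]].
have eC m : (m1 <= m)%N -> energym m (v m) (v m) <= C ^+ 2.
  move=> mm; have [h0 h1] := MP_le hq (v1 m mm).
  have -> : energym m (v m) (v m) = (5 ^+ m * lam m) * (3 ^- m * MP q m (v m) (v m)).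
    by rewrite (energymE hq) (vlam m mm) expr_div_n; ring.
  have := hm2 m (proj1 (hm1 m mm)); rewrite /= => h2.
  apply: (@le_trans _ _ ((`|t| + 1) * (3 / 2))).
    apply: (@le_trans _ _ ((`|t| + 1) * (3 ^- m * MP q m (v m) (v m)))); first exact: ler_wpM2r.
    by apply: ler_wpM2l; rewrite // addr_ge0.
  by rewrite /C; move: (normr_ge0 t); move: (`|t|) => s s0; nra.
have [G [UG hG]] := @ultraFilterLemma _ (\oo : set_system nat) _.
have FG : ProperFilter G := @ultra_proper _ _ UG.
have nearG (n : nat) (P : nat -> Prop) : (forall m, (n <= m)%N -> P m) -> \forall m \near G, P m.
  by move=> H; apply: hG; exists n.
have /choice[u vu] : forall x, exists l : R, v m x @[m --> G] --> l.
  move=> x; apply: (@ultra_bounded_cvg R G UG _ 1).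
  have [[n _ vx]|nx] := pselect (Star x).
    apply: (nearG (maxn n m1)) => m; rewrite geq_max => /andP[nm mm].
    exact: v1 mm _ (VOmega_le hq nm vx).
  by apply: (nearG m1) => m /hm1[_ /Hv[-> //]]; rewrite normr0.
have bC := limit_bndE hq C0 eC UG hG vu.
have Fu : FOmega q u by apply/(FOmegaP hq); exists C.
exists (Uext u); split; last first.
  apply: (symmetric_extension bC Fu) => w x bw cx [n _ vx].
  apply: (cvg_unique _ (vu _)) => //; apply: cvg_trans (vu x).
  apply: near_eq_cvg; apply: (nearG (maxn n m1)) => m; rewrite geq_max => /andP[nm /hm1[_ /Hv[_ _ _ _ H]]].
  by rewrite H //; exact: (VOmega_le hq nm vx).
split; first exact: (Uext_Ftilde hq hSG Fu).
  apply: contrapT => Hn.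
  have u0 x : Star x -> u x = 0.
    move=> sx; apply: contrapT => /eqP nz; apply: Hn.
    by exists (cst x); rewrite ?Uext_cst //; exact: (Otilde_cst hq hSG).
  (* Every late v_m has a point of absolute value 1 and oscillates by at most 1/2 from the reference
     point of a level-N cell, so some reference value of level N is at least 1/2. That cell depends
     on m; summing over all words of length N removes the dependence. *)
  have [N hN] : exists N, 5 * C * rho45 ^+ N <= 2^-1.
    have /cvgrPdist_le/(_ 2^-1) := @rho_cvg0 R (5 * C).
    case=> [|N _ H]; first by rewrite invr_gt0.
    exists N; apply: le_trans (H N (leqnn N)).
    by rewrite sub0r normrN ler_norm.
  have H0 : \sum_(p <- words N) `|v m (ref p)| @[m --> G] --> \sum_(p <- words N) `|u (ref p)|.
    by apply: cvg_bigsum => p; apply: cvg_norm; exact: vu.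
  rewrite [X in _ --> X]big1 in H0; last by move=> p _; rewrite u0 ?normr0 //; exact: (ref_star hq).
  suff : (2^-1 : R) <= 0 by rewrite leNgt invr_gt0 ltr0n.
  apply: (cvgr_to_ge H0); apply: (nearG (maxn N m1)) => m; rewrite geq_max => /andP[Nm mm].
  have [_ [_ _ [x vx x1] _ _]] := (hm1 m mm, Hv m (proj2 (hm1 m mm))).
  have [w [i [sw xw nL]]] := (VOmegaP hq m x).1 vx.
  have tN : take N w \in words N by rewrite mem_words size_takel ?sw.
  have wN : w = take N w ++ drop N w by rewrite cat_take_drop.
  have h := osc hq C0 (eC m mm) (w := take N w) (v := drop N w) (i := i).
  rewrite -wN sw size_takel ?sw // in h; have {}h := h (leqnn m) nL.
  rewrite /pt /= -xw in h.
  apply: (@le_trans _ _ `|v m (ref (take N w))|).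
    have := ler_normB (v m x) (v m x - v m (ref (take N w))).
    rewrite subKr => h'.
    have := ler_normD (v m (ref (take N w))) (v m x - v m (ref (take N w))).
    rewrite addrC subrK x1 => h''.
    by move: h h'' hN; move: `|v m (ref (take N w))| `|_ - _| (5 * _ * _) => a b c h1 h2 h3; move: h1 h2 h3; clear; lra.
  rewrite (big_rem _ tN) /= lerDl; apply: sumr_ge0 => p _; exact: normr_ge0.
move=> V FV; exact: (limit_weak hq hSG hmu C0 v1 eC vlam ht UG hG vu FV).
Qed.

End LimitEigenfunction.

(** * Tracking the index, and conclusion *)

Section Main.
Context {R : realType}.
Variable q : 'I_3 -> plane R.
Hypothesis hq : equilateral q.
Variable SG : set (plane R).
Hypothesis hSG : is_attractor q SG.
Local Notation pt := (@pt R q).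

Lemma pt1_q0 k i : (pt ([:: k], i) == q 0) = (k == 0) && (i == 0).
Proof.
apply/eqP/andP => [e|[/eqP -> /eqP ->]]; last exact: (contrw_nseq hq 1 0).
have [[->] /(q_inj hq) ->] := contrw_eq_q hq (v := [:: k]) (tri_q hq i) e; by rewrite eqxx.
Qed.

(** On the single good cell of level 1, the values -2, 1, 1 have sum 0 and so give the eigenvalue 6.
    Together with 0 it starts the count in [Bs_size]. *)
Lemma Bspec1_6 : Bspec q 1 6.
Proof.
pose u x : R := if `[< VOmega q 1 x >] then (if x == q 0 then -2 else 1) else 0.
have uE x : VOmega q 1 x -> u x = if x == q 0 then -2 else 1 by move=> vx; rewrite /u asboolT.
have vpt k i : ~~ onL [:: k] i -> VOmega q 1 (pt ([:: k], i)).
  by move=> nL; apply/(VOmegaP hq); exists [:: k], i.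
have ux : u (x0 q 1) = 1 by rewrite (uE _ (x0_VOmega hq 1)) pt1_q0.
exists u; last by rewrite ux oner_eq0.
split; last 1 first.
- have w0 : [seq w <- words 1 | ~~ word12 w] = [:: [:: 0]] by [].
  have gc : gcorners 1 = [:: ([:: 0], 0); ([:: 0], 1); ([:: 0], 2)] by [].
  move=> v _; rewrite /EE /MP gc /gwords w0 !big_cons !big_nil /=.
  rewrite !uE ?pt1_q0 /=; last first.
  all: try by apply: vpt.
  by field.
- split; first by move=> x nx; rewrite /u asboolF.
  move=> w v i bw sz nL.
  have sz' : size (w ++ map swap12 v) = 1%N by rewrite size_cat size_map -size_cat.
  have nL' : ~~ onL (w ++ map swap12 v) (swap12 i) by rewrite onL_swap.
  rewrite !uE; last first.
  + by apply/(VOmegaP hq); exists (w ++ map swap12 v), (swap12 i).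
  + by apply/(VOmegaP hq); exists (w ++ v), i.
  case: w v bw sz {sz' nL nL'} => [|k [|? ?]] [|k' [|? ?]] //= bw _.
    by rewrite !pt1_q0 !swap12_eq0.
  by rewrite !pt1_q0; case/andP: bw => /negPf ->.
by exists (x0 q 1); rewrite ux oner_eq0.
Qed.

Lemma PNm_finite m : (0 < m)%N -> finite_set (PNm q SG m).
Proof.
move=> m0; have [s Hs] := EP_finite hq m0.
apply: (@sub_finite_set _ _ [set` s]); last exact: finite_seq.
by move=> l /(PNm_AB hq hSG _ m0)[[u eu _]|[u eu _]]; apply: Hs eu.
Qed.

(** An index is given at each level separately, but the entries are distinct, so the value lam m
    determines it and one k serves throughout. *)
Lemma tracks_index (Ps : nat -> seq R) (lam : nat -> R) (M : nat) :
  (forall m, sorted <%R (Ps m.+1)) -> (forall m l, l \in Ps m.+1 -> 0 <= l) ->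
  (forall m, 2 ^ m < size (Ps m.+1))%N ->
  (forall m, (M <= m)%N -> exists k, [/\ (2 <= k <= 2 ^ m)%N,
     lam m = nth 0 (Ps m) k.-1 & lam m.+1 = nth 0 (Ps m.+1) k.-1]) ->
  exists k, forall m, (M < m)%N -> lam m = nth 0 (Ps m) k.
Proof.
move=> Psorted Ps_ge0 Psize Hk.
have [K [/andP[K2 KM] _ e0]] := Hk M (leqnn M).
have KM' n : (M <= n)%N -> (K.-1 < size (Ps n.+1))%N.
  move=> Mn; apply: leq_ltn_trans (Psize n); apply: leq_trans (leq_pred _) _.
  by apply: leq_trans KM _; rewrite leq_exp2l.
exists K.-1; case=> // n; rewrite ltnS => Mn.
elim: n Mn => [|n IH]; first by rewrite leqn0 => /eqP M0; rewrite -M0 e0.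
rewrite leq_eqVlt => /orP[/eqP <-//|]; rewrite ltnS => Mn.
have [k [/andP[k2 _] e1 ->]] := Hk n.+1 (leqW Mn).
suff -> : k.-1 = K.-1 by [].
have r := KM' n Mn; have us := lt_sorted_uniq (Psorted n).
(* Outside its range [nth] returns 0, and the list is only known to be longer than half the range of
   k. As the tracked index is not the first, lam is positive there, which excludes this. *)
have pos : 0 < nth 0 (Ps n.+1) K.-1.
  have K0 : (0 < K.-1)%N by case: (K) K2 => [|[]].
  apply: (@le_lt_trans _ _ (nth 0 (Ps n.+1) 0)).
    by apply: (Ps_ge0 n); apply: mem_nth; apply: leq_ltn_trans r.
  by rewrite (lt_sorted_ltn_nth 0 (Psorted n)) ?inE //; apply: leq_ltn_trans r.
have kr : (k.-1 < size (Ps n.+1))%N.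
  rewrite ltnNge; apply/negP => h; move: pos.
  by rewrite -(IH Mn) e1 nth_default // ltxx.
by apply/eqP; rewrite -(nth_uniq 0 kr r us) -e1 -(IH Mn).
Qed.

Lemma eventually_phit_minus m0 (lam : nat -> R) :
  (forall m, (m0 <= m)%N -> phit_minus q SG m (lam m) (lam m.+1) \/
     phit_plus q SG m (lam m) (lam m.+1)) ->
  finite_set [set m | (m0 <= m)%N /\ phit_plus q SG m (lam m) (lam m.+1)] ->
  exists M, forall m, (M <= m)%N -> phit_minus q SG m (lam m) (lam m.+1).
Proof.
move=> H /finite_seqP[s Hs]; exists (maxn m0 (\max_(m <- s) m).+1) => m; rewrite geq_max => /andP[m0m sm].
have [//|hp] := H m m0m.
have ms : m \in s by have : [set` s] m by rewrite -Hs.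
by move: sm; rewrite ltnNge leq_bigmax_seq.
Qed.

End Main.

Theorem theorem3p15 (R : realType) (q : 'I_3 -> plane R)
  (SG : set (plane R)) (mu : probability (plane R) R)
  (hq : equilateral q)
  (hSG : is_attractor q SG)
  (hmu : forall w : seq 'I_3,
     mu (contrw q w @` SG) = (3 ^- size w)%:E)
  (m0 : nat) (lam : nat -> R)
  (hm0 : (1 <= m0)%N)
  (hlam : forall m, (m0 <= m)%N -> PNm q SG m (lam m))
  (hphi : forall m, (m0 <= m)%N ->
     phit_minus q SG m (lam m) (lam m.+1) \/
     phit_plus q SG m (lam m) (lam m.+1))
  (hfin : finite_set
     [set m | (m0 <= m)%N /\ phit_plus q SG m (lam m) (lam m.+1)]) :
  cvgn (fun m => 5 ^+ m * lam m) /\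
  PN q SG mu (3 / 2 * limn (fun m => 5 ^+ m * lam m)).
Proof.
suff cv : cvgn (fun m => 5 ^+ m * lam m).
  by split=> //; apply: (limit_eigen hq hSG hmu hlam).
have [Bs HB] := Blists hq.
(* [lamN q SG m k] is by definition [nth 0 (Ps m) k.-1]: the k-th eigenvalue has list index k -
   1. *)
pose Ps m := sort <=%R (fset_set (PNm q SG m)).
have PsP m l : (0 < m)%N -> l \in Ps m <-> PNm q SG m l.
  move=> m1; rewrite mem_sort in_fset_set; last exact: PNm_finite.
  by split=> [/set_mem|/mem_set].
have Psorted m : (0 < m)%N -> sorted <%R (Ps m) by rewrite sort_lt_sorted fset_uniq.
have PsE m : (0 < m)%N -> forall l, l \in Ps m <-> Aspec q m l \/ l \in Bs m.
  move=> m1 l; have [_ H _ _ _] := HB m m1.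
  by rewrite PsP // (PNm_AB hq hSG l m1) H.
have Ps_ge0 m : (0 < m)%N -> forall l, l \in Ps m -> 0 <= l.
  by move=> m1 l; rewrite PsP // => /(PNm_AB hq hSG _ m1)[[u eu _]|[u eu _]]; apply: EP_ge0 eu.
have Bsorted m : (0 < m)%N -> sorted <%R (Bs m) by move=> /HB[].
have Bsize m : (0 < m)%N -> (2 * size (Bs m) <= (size (Bs m.+1)).+1)%N by move=> /HB[].
have Blt2 m : (0 < m)%N -> forall j, (j < size (Bs m))%N -> nth 0 (Bs m.+1) j < 2 by move=> /HB[].
have Bstep m : (0 < m)%N -> forall j, (j < size (Bs m))%N ->
  nth 0 (Bs m) j < 6 -> nth 0 (Bs m.+1) j <= phim (nth 0 (Bs m) j) by move=> /HB[].
have Bsize1 : (1 < size (Bs 1))%N.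
  have [_ H _ _ _] := HB 1%N isT.
  have := @uniq_leq_size _ [:: 0; 6] (Bs 1%N); apply.
    by rewrite /= inE andbT eq_sym pnatr_eq0.
  move=> l; rewrite !inE => /orP[/eqP ->|/eqP ->]; apply/H; first exact: Bspec0.
  exact: Bspec1_6.
have Aup m : (0 < m)%N -> forall l, 0 <= l -> l < 6 -> Aspec q m l -> Aspec q m.+1 (phim l).
  move=> m1 l l0 l6 Al; have [h1 h2 h3] := phimP l0 l6.
  apply: (A_up hq); first by rewrite lt_eqF.
    by rewrite lt_eqF // (lt_trans h2) // ltr_nat.
  by rewrite h3.
have Adown m : (0 < m)%N -> forall l, l < 2 -> Aspec q m.+1 l -> Aspec q m (l * (5 - l)).
  by move=> m1 l l2; apply: A_down.
have Psize m : (2 ^ m < size (Ps m.+1))%N by apply: (Ps_size PsE Bsorted Bsize Bsize1).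
have [M HM] := eventually_phit_minus hphi hfin.
have [k Hk] := tracks_index (fun m => Psorted m.+1 isT) (fun m => Ps_ge0 m.+1 isT) Psize HM.
have [N [_ HN]] := stabilisation Psorted PsE Ps_ge0 Bsorted Bsize Bsize1 Blt2 Bstep Aup Adown k.
apply: (@renormalised_cvg _ _ (maxn M.+1 N)) => m; rewrite geq_max => /andP[Mm Nm].
by rewrite (Hk m.+1) ?(Hk m) ?leqW //; apply: HN.
Qed.
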